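(* For $n\in\{1,2\}$ and every partition $\lambda$ with at most $n$ positive parts, the poset $\mathcal B_\lambda^n$ is a lattice. Now suppose $n\geq 3$ and let $\lambda$ be a partition with at most $n$ positive parts. Then $\mathcal B_\lambda^n$ is a lattice if and only if at least one of the following holds: (1) $\lambda=(1^m)$ for some $0\leq m\leq n$; (2) $\lambda=(2,1^m)$ for some $1\leq m\leq n-1$; (3) $\lambda=(2^{n-m},1^m)$ for some $1\leq m\leq n-1$; (4) $\lambda=(k)$ for some $k\geq 1$; (5) $\lambda=(k^n)$ for some $k\geq 1$; (6) $\lambda=(k,1)$ for some $k\geq 1$; (7) $\lambda=(k^{n-1},k-1)$ for some $k\geq 1$; (8) $\lambda=(3,2,1)$ and $n=3$.
   Context: Superscripts denote repeated parts of a partition, e.g. $(2^3,1)=(2,2,2,1)$. Fix $n\geq 1$ and a partition $\lambda=(\lambda_1\geq\cdots\geq\lambda_\ell>0)$ with $\ell\leq n$. Cell $(i,j)$ is in row $i$ (top to bottom) and column $j$ (left to right) of the Young diagram (English notation). $\mathcal B_\lambda^n$ is the set of semistandard Young tableaux of shape $\lambda$ (rows weakly increasing left to right, columns strictly increasing top to bottom) with entries in $\{1,\ldots,n+1\}$; it is the type $A_n$ crystal of highest weight $\lambda$. The reading word of a tableau is obtained by reading its rows from the bottom row to the top row, each row left to right. For $i\in\{1,\ldots,n\}$, the lowering operator $F_i$ acts on $T$ as follows: delete from the reading word all letters other than $i$ and $i+1$, replace each $i$ by '')'' and each $i+1$ by ''('', and match parentheses in the usual way; if there is no unmatched '')'',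 then $F_i(T)=0$ (undefined); otherwise $F_i(T)$ is obtained by changing the entry $i$ of $T$ corresponding to the rightmost unmatched '')'' into $i+1$. The partial order on $\mathcal B_\lambda^n$ is the one whose cover relations are $T\lessdot F_i(T)$ for $F_i(T)\neq 0$ (i.e. $T\leq T'$ iff $T'$ is obtained from $T$ by a sequence of lowering operators). *)

(* Defs.v *)
From Stdlib Require Import Relations.Relation_Operators.
From mathcomp Require Import all_boot.

Set Implicit Arguments.
Unset Strict Implicit.
Unset Printing Implicit Defensive.

Definition is_partition (n : nat) (lam : seq nat) : bool :=
  [&& sorted geq lam, all (fun x => 0 < x) lam & size lam <= n].

(* A tableau is a list of rows (top row first), each row a list of entries
   (left to right).  Cell (i,j) (1-based) is nth 0 (nth [::] T (i-1)) (j-1). *)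
Definition tableau := seq (seq nat).

Definition is_ssyt (n : nat) (lam : seq nat) (T : tableau) : Prop :=
  [/\ map size T = lam,
      all (fun r => all (fun x => 0 < x <= n.+1) r) T,
      all (sorted leq) T &
      forall r c, r.+1 < size T -> c < size (nth [::] T r.+1) ->
        nth 0 (nth [::] T r) c < nth 0 (nth [::] T r.+1) c].

Definition reading_word (T : tableau) : seq nat := flatten (rev T).

(* Bracket scan: letters i are ")" and letters i+1 are "(".  Scanning left to
   right with [opn] = number of currently unmatched "(", a ")" is matched with
   the nearest unmatched "(" to its left if any; otherwise it is unmatched.
   Returns the position of the rightmost unmatched ")" (if any). *)
Fixpoint rightmost_unmatched (i : nat) (w : seq nat) (pos opn : nat)
    (last : option nat) : option nat :=
  match w with
  | [::] => last
  | a :: w' =>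
      if a == i then
        (if opn == 0 then rightmost_unmatched i w' pos.+1 0 (Some pos)
         else rightmost_unmatched i w' pos.+1 opn.-1 last)
      else if a == i.+1 then rightmost_unmatched i w' pos.+1 opn.+1 last
      else rightmost_unmatched i w' pos.+1 opn last
  end.

(* Lowering operator on words: None plays the role of 0 (undefined). *)
Definition Fword (i : nat) (w : seq nat) : option (seq nat) :=
  match rightmost_unmatched i w 0 0 None with
  | Some p => Some (set_nth 0 w p i.+1)
  | None => None
  end.

Definition Ftab (i : nat) (T : tableau) : option tableau :=
  match Fword i (reading_word T) with
  | Some w => Some (rev (reshape (rev (map size T)) w))
  | None => None
  end.

Definition cover (n : nat) (T T' : tableau) : Prop :=
  exists2 i, 1 <= i <= n & Ftab i T = Some T'.

Definition crystal_le (n : nat) : tableau -> tableau -> Prop := clos_refl_trans tableau (cover n).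

Definition is_join (n : nat) (lam : seq nat) (T1 T2 J : tableau) : Prop :=
  [/\ is_ssyt n lam J, crystal_le n T1 J, crystal_le n T2 J &
      forall U, is_ssyt n lam U -> crystal_le n T1 U -> crystal_le n T2 U ->
        crystal_le n J U].

Definition is_meet (n : nat) (lam : seq nat) (T1 T2 M : tableau) : Prop :=
  [/\ is_ssyt n lam M, crystal_le n M T1, crystal_le n M T2 &
      forall U, is_ssyt n lam U -> crystal_le n U T1 -> crystal_le n U T2 ->
        crystal_le n U M].

Definition crystal_is_lattice (n : nat) (lam : seq nat) : Prop :=
  forall T1 T2, is_ssyt n lam T1 -> is_ssyt n lam T2 ->
    (exists J, is_join n lam T1 T2 J) /\ (exists M, is_meet n lam T1 T2 M).

Definition rect_minus_one (n k : nat) : seq nat :=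
  filter (fun x => 0 < x) (rcons (nseq n.-1 k) k.-1).

(* Main.v *)
(** Lowering operators only see the columns of a tableau: [F_i] changes [i] into
    [i+1] in the column of the rightmost unmatched bracket, where a column
    containing [i] but not [i+1] counts as a closing bracket and a column
    containing [i+1] but not [i] as an opening one.  Complementing all columns
    and reversing their order therefore reverses the crystal order, which pairs
    the shapes (2)/(3), (4)/(5) and (6)/(7).

    For the remaining lattice shapes the elements are coded by integer vectors
    on which reachability is given by explicit inequalities; least upper bounds
    are then componentwise maxima (after a closure step), and a graded join
    semilattice with a bottom is a lattice.  The shape (3,2,1) is a finite check.

    For all other shapes there are elements [x], [y] below [z], [w] with nothing
    in between.  They come from five configurations in crystals of type A_3:
    outer columns are filled with highest or lowest weight letters and the other
    letters outside four consecutive ones are frozen, which makes the relevant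
    intervals coincide with those of the small crystal. *)
Require Import Defs.
From Stdlib Require Import Classical Relations.Relation_Operators Relations.Operators_Properties.
From mathcomp Require Import all_boot zify.

Set Implicit Arguments.
Unset Strict Implicit.
Unset Printing Implicit Defensive.

(** * Order-theoretic lattice criteria *)

(** The order is only given by its covers, so both directions need control over reachability.
    Componentwise comparison of code vectors is too weak as soon as one letter can pass another:
    such a crossing happens only at a moment when three neighbouring entries have the form
    [i, i, i+1]. Entries are monotone along the order, so a crossing on the way leaves a trace, one
    more inequality between source and target; these inequalities together with the componentwise
    ones turn out to describe the order of the hooks. For the other shapes no description of the
    order is needed. Entries never decrease along a chain, so a cell with equal values at both ends
    of an interval is constant on the whole interval. This turns freezing into a reduction to type
    A_3, where the sum of the entries bounds the length of chains and an exhaustive search becomes a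
    proof. *)

Definition lattice_on (A : Type) (P : A -> Prop) (le : A -> A -> Prop) : Prop :=
  forall x y, P x -> P y ->
    (exists j, [/\ P j, le x j, le y j &
       forall u, P u -> le x u -> le y u -> le j u]) /\
    (exists m, [/\ P m, le m x, le m y &
       forall u, P u -> le u x -> le u y -> le u m]).

Lemma lattice_flip (A : Type) (P : A -> Prop) (le : A -> A -> Prop) :
  lattice_on P le -> lattice_on P (fun x y => le y x).
Proof. by move=> L x y Px Py; have [J M] := L x y Px Py. Qed.

Lemma lattice_iso (A B : Type) (P : A -> Prop) (Q : B -> Prop)
    (leA : A -> A -> Prop) (leB : B -> B -> Prop) (f : A -> B) (g : B -> A) :
  (forall x, P x -> Q (f x)) -> (forall y, Q y -> P (g y)) ->
  (forall y, Q y -> f (g y) = y) ->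
  (forall x x', P x -> P x' -> (leA x x' <-> leB (f x) (f x'))) ->
  lattice_on P leA -> lattice_on Q leB.
Proof.
move=> PQ QP fg le_f L y z Qy Qz.
have [[j [Pj yj zj jmin]] [m [Pm my mz mmax]]] := L _ _ (QP _ Qy) (QP _ Qz).
have leE a b : P a -> Q b -> (leA a (g b) <-> leB (f a) b).
  by move=> Pa Qb; rewrite le_f ?fg //; apply: QP.
have leE' a b : Q a -> P b -> (leA (g a) b <-> leB a (f b)).
  by move=> Qa Pb; rewrite le_f ?fg //; apply: QP.
split; [exists (f j) | exists (f m)]; split; try exact: PQ.
- exact/leE'.
- exact/leE'.
- move=> u Qu yu zu; apply/leE => //.
  by apply: jmin; [exact: QP | apply/leE' => //; rewrite ?fg //; apply: QP ..].
- exact/leE.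
- exact/leE.
- move=> u Qu yu zu; apply/leE' => //.
  by apply: mmax; [exact: QP | apply/leE => //; rewrite ?fg //; apply: QP ..].
Qed.

Lemma clos_mono (A B : Type) (P : A -> Prop) (sA : A -> A -> Prop)
    (sB : B -> B -> Prop) (f : A -> B) :
  (forall x x', P x -> sA x x' -> P x' /\ sB (f x) (f x')) ->
  forall x x', P x -> clos_refl_trans A sA x x' ->
    P x' /\ clos_refl_trans B sB (f x) (f x').
Proof.
move=> H x x' Px c; have {c} := clos_rt_rt1n _ _ _ _ c.
move=> c; elim: c Px => {x x'}[x|x y z xy _ IH] Px.
  by split=> //; apply: rt_refl.
have [Py s] := H _ _ Px xy; have [Pz c] := IH Py.
by split=> //; apply: rt_trans c; apply: rt_step.
Qed.

Lemma clos_flip (A : Type) (s : A -> A -> Prop) x y :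
  clos_refl_trans A (fun a b => s b a) x y -> clos_refl_trans A s y x.
Proof.
elim=> [a b ab|a|a b c _ IH1 _ IH2]; first exact: rt_step.
  exact: rt_refl.
exact: rt_trans IH2 IH1.
Qed.

(* A graded join-semilattice with a bottom element is a lattice, the meet being
   a lower bound of maximal rank. *)
Lemma lattice_of_code (X A : Type) (PX : X -> Prop) (P : A -> Prop)
    (enc : X -> A) (st : A -> A -> Prop) (R : X -> X -> Prop) (rk : X -> nat)
    (bot : X) :
  (forall x, PX x -> P (enc x)) ->
  (forall a, P a -> exists2 x, PX x & a = enc x) ->
  (forall x y, PX x -> PX y -> enc x = enc y -> x = y) ->
  PX bot -> (forall x, PX x -> R bot x) ->
  (forall x, PX x -> R x x) ->
  (forall x y z, PX x -> PX y -> PX z -> R x y -> R y z -> R x z) ->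
  (forall x y, PX x -> PX y -> R x y -> rk x <= rk y) ->
  (forall x a, PX x -> st (enc x) a ->
     exists y, [/\ PX y, a = enc y, R x y & rk x < rk y]) ->
  (forall x y, PX x -> PX y -> R x y -> x <> y ->
     exists z, [/\ PX z, st (enc x) (enc z) & R z y]) ->
  (forall x y, PX x -> PX y -> exists j, [/\ PX j, R x j, R y j &
     forall u, PX u -> R x u -> R y u -> R j u]) ->
  lattice_on P (clos_refl_trans A st).
Proof.
move=> encP decP inj Pbot Rbot Rrefl Rtrans Rrk Rst prog jn.
have up x a : PX x -> clos_refl_trans A st (enc x) a ->
    exists y, [/\ PX y, a = enc y & R x y].
  move=> Px c; have {c} := clos_rt_rt1n _ _ _ _ c; move E: (enc x) => e c.
  elim: c x Px E => {e a}[a|a b c ab _ IH] x Px E.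
    by exists x; split=> //; apply: Rrefl.
  rewrite -E in ab; have [y [Py Eb xy _]] := Rst _ _ Px ab.
  have [z [Pz Ec yz]] := IH y Py (esym Eb).
  by exists z; split=> //; apply: Rtrans xy yz.
have reach x y : PX x -> PX y -> R x y -> clos_refl_trans A st (enc x) (enc y).
  have [k] := ubnP (rk y - rk x); elim: k x => // k IH x le_k Px Py xy.
  case: (classic (x = y)) => [->|neq]; first exact: rt_refl.
  have [z [Pz xz zy]] := prog _ _ Px Py xy neq.
  have [z' [Pz' Ez _ lt_z]] := Rst _ _ Px xz.
  rewrite -(inj _ _ Pz Pz' Ez) in lt_z.
  apply: rt_trans (rt_step _ _ _ _ xz) _; apply: IH => //.
  have := Rrk _ _ Pz Py zy; lia.
have leE x y : PX x -> PX y -> (clos_refl_trans A st (enc x) (enc y) <-> R x y).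
  move=> Px Py; split; last exact: reach.
  by move=> /(up _ _ Px)[z [Pz Ez]]; rewrite (inj _ _ Py Pz Ez).
have meet x y : PX x -> PX y -> exists m, [/\ PX m, R m x, R m y &
    forall u, PX u -> R u x -> R u y -> R u m].
  move=> Px Py.
  suff H k m : rk x - rk m < k -> PX m -> R m x -> R m y ->
      exists m, [/\ PX m, R m x, R m y & forall u, PX u -> R u x -> R u y -> R u m].
    by apply: (H _ bot (leqnn _)) => //; apply: Rbot.
  elim: k m => // k IH m le_k Pm mx my.
  case: (classic (forall u, PX u -> R u x -> R u y -> R u m)) => [H|].
    by exists m.
  move=> nmax; have [u nu] := not_all_ex_not _ _ nmax.
  have [Pu {}nu] := imply_to_and _ _ nu; have [ux {}nu] := imply_to_and _ _ nu.
  have [uy num] := imply_to_and _ _ nu.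
  (* The lower bound [u] is not below [m], so the join of [m] and [u] is a lower bound strictly
     above [m], and its larger rank makes the induction stop. *)
  have [j [Pj mj uj jmin]] := jn _ _ Pm Pu.
  have jx : R j x by apply: jmin.
  have jy : R j y by apply: jmin.
  apply: (IH j) => //.
  have ne : m <> j by move=> E; apply: num; rewrite E.
  have [z [Pz mz zj]] := prog _ _ Pm Pj mj ne.
  have [z' [Pz' Ez _ lt_z]] := Rst _ _ Pm mz.
  rewrite -(inj _ _ Pz Pz' Ez) in lt_z.
  by have := Rrk _ _ Pz Pj zj; have := Rrk _ _ Pj Px jx; lia.
move=> a b /decP[x Px ->] /decP[y Py ->]; split.
  have [j [Pj xj yj jmin]] := jn _ _ Px Py.
  exists (enc j); split; try by [exact: encP | apply/leE].
  by move=> _ /decP[u Pu ->] /leE xu /leE yu; apply/leE => //; apply: jmin; auto.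
have [m [Pm mx my mmax]] := meet _ _ Px Py.
exists (enc m); split; try by [exact: encP | apply/leE].
by move=> _ /decP[u Pu ->] /leE ux /leE uy; apply/leE => //; apply: mmax; auto.
Qed.

(** The join of [x] and [y] is the element in between. The contrapositive is the only obstruction
    used below. *)
Lemma lattice_no_bowtie (A : Type) (P : A -> Prop) (le : A -> A -> Prop) x y z w :
  lattice_on P le -> P x -> P y -> P z -> P w ->
  le x z -> le x w -> le y z -> le y w ->
  exists m, [/\ P m, le x m, le y m, le m z & le m w].
Proof.
move=> L Px Py Pz Pw xz xw yz yw.
by have [[j [Pj xj yj jmin]] _] := L x y Px Py; exists j; split=> //; apply: jmin.
Qed.

(** * Columns, signatures, and the scan of the reading word *)

Definition rp (i : nat) (C : seq nat) : bool := (i \in C) && (i.+1 \notin C).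
Definition lp (i : nat) (C : seq nat) : bool := (i.+1 \in C) && (i \notin C).
Definition raise (i : nat) (C : seq nat) : seq nat :=
  [seq if x == i then i.+1 else x | x <- C].

(** Every opening bracket of [A] is closed inside [A], so a closing bracket placed right after [A]
    stays unmatched. *)
Definition okL (i : nat) (A : seq (seq nat)) : Prop :=
  forall j, count (lp i) (drop j A) <= count (rp i) (drop j A).
(** Every closing bracket of [B] is matched inside [B], even if nothing is open before [B]. *)
Definition okR (i : nat) (B : seq (seq nat)) : Prop :=
  forall j, count (rp i) (take j B) <= count (lp i) (take j B).

(** [okL] makes the bracket of [C] unmatched and [okR] makes it the last unmatched one. Unlike a
    left-to-right scan, these counting conditions are exchanged by reversal, which is what duality
    needs. *)
Inductive cstep (n : nat) : seq (seq nat) -> seq (seq nat) -> Prop :=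
  CStep i A C B of 0 < i <= n & rp i C & okL i A & okR i B :
    cstep n (A ++ C :: B) (A ++ raise i C :: B).

Definition colle (C D : seq nat) : bool :=
  (size D <= size C) && all (fun r => nth 0 C r <= nth 0 D r) (iota 0 (size D)).

Definition cvalid (n : nat) (hs : seq nat) (Cs : seq (seq nat)) : Prop :=
  [/\ map size Cs = hs, all (all (fun x => 0 < x <= n.+1)) Cs,
      all (sorted ltn) Cs & sorted colle Cs].

Definition clattice (n : nat) (hs : seq nat) : Prop :=
  lattice_on (cvalid n hs) (clos_refl_trans _ (cstep n)).

Lemma colleP C D :
  reflect (size D <= size C /\ forall r, r < size D -> nth 0 C r <= nth 0 D r)
          (colle C D).
Proof.
apply: (iffP andP) => -[-> H]; split=> //.
  by move=> r lt_r; apply: (allP H); rewrite mem_iota.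
by apply/allP => r; rewrite mem_iota => /andP[_ lt_r]; apply: H.
Qed.

Lemma colle_trans : transitive colle.
Proof.
move=> D C E /colleP[sCD CD] /colleP[sDE DE]; apply/colleP; split=> [|r lt_r].
  exact: leq_trans sDE sCD.
by apply: leq_trans (CD _ _) (DE _ lt_r); apply: leq_trans lt_r sDE.
Qed.

Lemma nth_sorted_ltn C r s :
  sorted ltn C -> r < s < size C -> nth 0 C r < nth 0 C s.
Proof.
move=> sC /andP[lt_rs lt_s].
by apply: (sorted_ltn_nth ltn_trans) => //; rewrite inE //; apply: ltn_trans lt_s.
Qed.

(** The state is the number of open brackets together with the column of the last unmatched closing
    bracket. Letters carry their column index because this index, unlike the position in the word,
    has the same meaning when reading by rows and by columns. *)
Definition tokR (s : nat * option nat) (j : nat) : nat * option nat :=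
  if s.1 == 0 then (0, Some j) else (s.1.-1, s.2).
Definition tokL (s : nat * option nat) : nat * option nat := (s.1.+1, s.2).
Definition tok (i : nat) (s : nat * option nat) (a : nat * nat) :=
  if a.1 == i then tokR s a.2 else if a.1 == i.+1 then tokL s else s.
Definition scan (i : nat) := foldl (tok i).
Definition ctok (i : nat) (s : nat * option nat) (j : nat) (C : seq nat) :=
  if rp i C then tokR s j else if lp i C then tokL s else s.
Fixpoint cscan (i : nat) (s : nat * option nat) (j : nat) (Cs : seq (seq nat)) :=
  if Cs is C :: Cs' then cscan i (ctok i s j C) j.+1 Cs' else s.

Lemma scan_cat i s w1 w2 : scan i s (w1 ++ w2) = scan i (scan i s w1) w2.
Proof. exact: foldl_cat. Qed.

Lemma scan_gt i s w : all (fun t : nat * nat => i < t.1) w ->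
  scan i s w = (s.1 + count (fun t => t.1 == i.+1) w, s.2).
Proof.
elim: w s => [|t w IH] s /=; first by rewrite addn0; case: s.
case/andP=> lt_i /IH->; rewrite /tok gtn_eqF //.
by case: eqP => _ /=; rewrite ?addnA ?addn1.
Qed.

(** From bottom to top, [i.+1] comes immediately before [i]: a column with both letters opens a
    bracket and closes it again, leaving the state unchanged. *)
Lemma scan_coltok i s j C :
  sorted ltn C -> scan i s (rev [seq (x, j) | x <- C]) = ctok i s j C.
Proof.
elim: C => [|c C IH] //= sC.
have lt_c : all (ltn c) C by apply: order_path_min sC; apply: ltn_trans.
rewrite rev_cons -cats1 scan_cat /=.
have cC : c \notin C by apply/negP => /(allP lt_c) /=; rewrite ltnn.
have gt_all x : x <= c -> all (fun t : nat * nat => x < t.1) (rev [seq (y, j) | y <- C]).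
  move=> le_xc; rewrite all_rev all_map; apply/allP => y /(allP lt_c) /=; lia.
have cnt (x : nat) : count (fun t : nat * nat => t.1 == x) (rev [seq (y, j) | y <- C])
    = (x \in C) :> nat.
  rewrite count_rev count_map -count_uniq_mem //.
  by apply: sorted_uniq (path_sorted sC); [exact: ltn_trans | exact: ltnn].
rewrite /tok /ctok /rp /lp !in_cons /=; case: eqP => [Ec|/eqP nci].
  rewrite scan_gt ?gt_all ?Ec // cnt eqxx gtn_eqF //=.
  case: (i.+1 \in C) => /=; last by rewrite addn0 -surjective_pairing.
  by rewrite /tokR /= addn1 /= -surjective_pairing.
case: (eqVneq c i.+1) => [Ec|ncs].
  rewrite scan_gt ?gt_all ?Ec // 1?ltnW // cnt -Ec ?eqxx (negPf cC) addn0.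
  have iC : i \notin C by apply/negP => /(allP lt_c) /=; lia.
  by rewrite (negPf iC) /= ltn_eqF ?Ec // andbT /tokL.
by rewrite [i == c]eq_sym (negPf nci) /= IH ?(path_sorted sC).
Qed.

Fixpoint rowtok (r j : nat) (Cs : seq (seq nat)) : seq (nat * nat) :=
  if Cs is C :: Cs' then
    if r < size C then (nth 0 C r, j) :: rowtok r j.+1 Cs' else rowtok r j.+1 Cs'
  else [::].

Definition rowstok (r k j : nat) (Cs : seq (seq nat)) : seq (nat * nat) :=
  flatten (rev [seq rowtok r' j Cs | r' <- iota r k]).

Lemma rowstokS r k j Cs :
  rowstok r k.+1 j Cs = rowstok r.+1 k j Cs ++ rowtok r j Cs.
Proof. by rewrite /rowstok /= rev_cons -cats1 flatten_cat /= cats0. Qed.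

Lemma mem_rowstok r k j Cs (t : nat * nat) : t \in rowstok r k j Cs ->
  exists2 D : seq nat, D \in Cs & exists2 s : nat, r <= s < r + k & s < size D /\ t.1 = nth 0 D s.
Proof.
case/flattenP=> w; rewrite mem_rev => /mapP[s]; rewrite mem_iota => s_rk ->.
elim: Cs j => [|C Cs IH] j //=.
case: ifP => [lt_s|_].
  rewrite in_cons => /predU1P[->|/IH[D D_Cs H]].
    by exists C; rewrite ?mem_head //; exists s.
  by exists D; rewrite ?in_cons ?D_Cs ?orbT.
by move=> /IH[D D_Cs H]; exists D; rewrite ?in_cons ?D_Cs ?orbT.
Qed.

(* Moving a letter [c] of the first column leftwards past the remaining parts
   of the lower rows does not change the scan: those letters exceed [c], and
   if one of them is [c+1] then so is the letter just below [c]. *)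
Lemma scan_first_column i C Cs j k r s :
  sorted ltn C -> all (colle C) Cs ->
  scan i s (rowstok r k j (C :: Cs)) =
  scan i (scan i s (rev [seq (x, j) | x <- take k (drop r C)])) (rowstok r k j.+1 Cs).
Proof.
move=> sC leC; elim: k r => [|k IH] r; first by rewrite take0.
rewrite !rowstokS !scan_cat IH /=.
case: ltnP => [lt_r|ge_r]; last first.
  by rewrite !drop_oversize // ltnW.
rewrite (drop_nth 0 lt_r) /= rev_cons -cats1 scan_cat /=.
set U := rev _; set W := rowstok r.+1 k j.+1 Cs; set c := nth 0 C r.
congr (scan i _ _).
have memU (x : nat) : x \in [seq t.1 | t <- U] = (x \in take k (drop r.+1 C)).
  by rewrite /U map_rev mem_rev -map_comp map_id.
have gtU : all (fun t => c < t.1) U.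
  apply/allP => t /(map_f fst); rewrite memU => /mem_take /(nthP 0)[m].
  rewrite size_drop nth_drop => lt_m <-.
  by have {}lt_m : m < size C - r.+1 := lt_m; apply: nth_sorted_ltn => //; lia.
have gtW : all (fun t => c < t.1) W.
  apply/allP => t /mem_rowstok[D /(allP leC)/colleP[sCD CD] [m m_r [lt_m ->]]].
  have {}lt_m : m < size D := lt_m.
  apply: leq_trans (CD _ lt_m); apply: nth_sorted_ltn => //; lia.
(* Applied to [x = c.+1]: an entry [c.+1] in a lower row of a later column bounds the entry of [C]
   in that row from above, and strict increase of [C] bounds it from below. *)
have WU (x : nat) : has (fun t => t.1 == x) W -> (forall y, c < y -> x <= y) ->
    has (fun t => t.1 == x) U.
  move=> /hasP[t /mem_rowstok[D /(allP leC)/colleP[sCD CD] [m m_r [lt_m Et]]] /eqP Ex] xmin.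
  have {}lt_m : m < size D := lt_m.
  have xU : x \in [seq t.1 | t <- U].
    rewrite memU; have -> : x = nth 0 (take k (drop r.+1 C)) (m - r.+1).
      rewrite nth_take ?nth_drop; last by lia.
      rewrite subnKC; last by lia.
      apply/eqP; rewrite eqn_leq -{2}Ex Et CD // andbT; apply: xmin.
      apply: nth_sorted_ltn => //; lia.
    apply: mem_nth; rewrite size_take size_drop.
    have lt1 : m - r.+1 < size C - r.+1 by lia.
    have lt2 : m - r.+1 < k by lia.
    by case: ifP.
  by case/mapP: xU => t' t'U ->; apply/hasP; exists t'.
rewrite /tok /=; case: (eqVneq c i) => [Ec|nci].
  rewrite -Ec !scan_gt // /tokR /=.
  have := WU c.+1; rewrite !has_count => /(_ _ (fun _ => id)).
  case: (posnP (count _ W)) => [-> _|W0 /(_ isT) U0].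
    by rewrite !addn0; case: ifP => _; rewrite /= ?addn0.
  rewrite !gtn_eqF /= ?addn_gt0 ?U0 ?orbT //; congr (_, _).
  by move: U0; set u := count _ U; set v := count _ W => U0; clearbody u v; lia.
case: (eqVneq c i.+1) => [Ec|//].
have gt1 w : all (fun t : nat * nat => c < t.1) w -> all (fun t : nat * nat => i < t.1) w.
  by apply: sub_all => t /=; rewrite Ec => /ltnW.
by rewrite !(scan_gt _ (gt1 _ gtW)) /tokL /= addSn.
Qed.

Lemma scan_rows i s N j Cs :
  all (sorted ltn) Cs -> sorted colle Cs -> all (fun C => size C <= N) Cs ->
  scan i s (rowstok 0 N j Cs) = cscan i s j Cs.
Proof.
elim: Cs s j => [|C Cs IH] s j /=.
  rewrite /rowstok => _ _ _; suff -> : flatten (rev [seq [::] | _ <- iota 0 N]) = [::] :> seq (nat * nat) by [].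
  by elim: (iota 0 N) => //= _ l; rewrite rev_cons -cats1 flatten_cat => ->.
case/andP=> sC sCs cC /andP[leC leCs].
rewrite scan_first_column //; last exact: order_path_min colle_trans cC.
by rewrite drop0 take_oversize // scan_coltok // IH // (path_sorted cC).
Qed.

Lemma flatten_split (T : Type) (ss : seq (seq T)) W1 x W2 :
  flatten ss = W1 ++ x :: W2 ->
  exists s0 A B s1, [/\ ss = s0 ++ (A ++ x :: B) :: s1,
    W1 = flatten s0 ++ A & W2 = B ++ flatten s1].
Proof.
elim: ss W1 => [|s ss IH] W1 /=; first by case: W1.
move=> E; case: (ltnP (size W1) (size s)) => [lt_W|le_W].
  have Es : take (size W1) s = W1.
    by have := congr1 (take (size W1)) E; rewrite takel_cat ?take_size_cat // ltnW.
  have /(congr1 (drop (size W1))) := E.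
  rewrite drop_cat lt_W drop_size_cat // => Ed.
  case Eds: (drop (size W1) s) Ed => [|x' B].
    by have := size_drop (size W1) s; rewrite Eds /=; lia.
  case=> Ex EB; exists [::], W1, B, ss; split=> //=.
  suff -> : W1 ++ x :: B = s by [].
  by rewrite -{1}Es -Ex -Eds cat_take_drop.
have E1 : take (size s) W1 = s.
  by have := congr1 (take (size s)) E; rewrite take_size_cat // takel_cat.
have := congr1 (drop (size s)) E; rewrite drop_size_cat // drop_cat.
case: ltnP => [lt_s /IH[s0 [A [B [s1 [-> EW ->]]]]]|ge_s].
  exists (s :: s0), A, B, s1; split=> //=.
  by rewrite -catA -EW -{1}(cat_take_drop (size s) W1) E1.
have EW : W1 = s by rewrite -E1 take_oversize.
rewrite EW subnn drop0 => /(IH [::])[s0 [A [B [s1 [-> E0 ->]]]]].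
exists (s :: s0), A, B, s1; split=> //=.
by rewrite -catA -E0 cats0.
Qed.

(** [last] records a position in the word and [l] a column index, hence two independent parameters.
    Either both records survive or both are overwritten at the same letter; this alternative is
    stable under the induction. *)
Lemma rightmost_unmatched_scan i w pos o last l :
  (rightmost_unmatched i [seq t.1 | t <- w] pos o last = last /\
     (scan i (o, l) w).2 = l) \/
  (exists W1 c W2, [/\ w = W1 ++ (i, c) :: W2,
     rightmost_unmatched i [seq t.1 | t <- w] pos o last = Some (pos + size W1) &
     (scan i (o, l) w).2 = Some c]).
Proof.
elim: w pos o last l => [|[a c] w IH] pos o last l /=; first by left.
have shift p last' o' l' : p = pos.+1 ->
    (exists W1 c W2, [/\ w = W1 ++ (i, c) :: W2,
     rightmost_unmatched i [seq t.1 | t <- w] p o' last' = Some (p + size W1) &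
     (scan i (o', l') w).2 = Some c]) ->
    exists W1 c' W2, [/\ (a, c) :: w = W1 ++ (i, c') :: W2,
     rightmost_unmatched i [seq t.1 | t <- w] p o' last' = Some (pos + size W1) &
     (scan i (o', l') w).2 = Some c'].
  move=> -> [W1 [c' [W2 [-> -> ->]]]].
  by exists ((a, c) :: W1), c', W2; split; rewrite //= addSnnS.
rewrite {1 2}/tok /tokR /tokL /=; case: eqP => [Ea|_].
  case: eqP => _.
    have [[-> ->]|H] := IH pos.+1 0 (Some pos) (Some c); right.
      by exists [::], c, w; rewrite addn0 Ea.
    exact: (shift _ _ _ _ erefl H).
  by have [[-> ->]|H] := IH pos.+1 o.-1 last l; [left | right; apply: (shift _ _ _ _ erefl H)].
case: eqP => _.
  by have [[-> ->]|H] := IH pos.+1 o.+1 last l; [left | right; apply: (shift _ _ _ _ erefl H)].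
by have [[-> ->]|H] := IH pos.+1 o last l; [left | right; apply: (shift _ _ _ _ erefl H)].
Qed.

Lemma cscan_cat i s j A B :
  cscan i s j (A ++ B) = cscan i (cscan i s j A) (j + size A) B.
Proof.
by elim: A s j => [|C A IH] s j /=; [rewrite addn0 | rewrite IH addSnnS].
Qed.

Lemma rp_lp i C : rp i C -> lp i C = false.
Proof. by rewrite /rp /lp => /andP[-> /negPf->]. Qed.

Lemma cscan_okL i s j A : s.1 + count (lp i) A <= count (rp i) A ->
  okL i A -> (cscan i s j A).1 = 0.
Proof.
elim: A s j => [|C A IH] s j /= cA okA; first lia.
have okA' : okL i A by move=> k; have := okA k.+1.
have := okA' 0; rewrite drop0 => cA'.
apply: IH => //; rewrite /ctok /tokR /tokL; case: ifP cA => [rC|_].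
  by rewrite rp_lp //; case: eqP => /=; lia.
by case: ifP => /=; lia.
Qed.

Lemma cscan_okR i s j B :
  (forall k, count (rp i) (take k B) <= count (lp i) (take k B) + s.1) ->
  (cscan i s j B).2 = s.2.
Proof.
elim: B s j => [|C B IH] s j //= okB.
have := okB 1; rewrite /= take0 /= => ok1.
rewrite IH => [|k]; first by rewrite /ctok /tokR /tokL; case: ifP ok1 => [rC|_];
  [rewrite rp_lp //=; case: eqP => //=; lia | case: ifP].
have := okB k.+1; rewrite /= /ctok /tokR /tokL; case: ifP ok1 => [rC|_].
  by rewrite rp_lp //; case: eqP => /=; lia.
by case: ifP => /=; lia.
Qed.

(** The [s.1] initially open brackets count as opening brackets in front of [Cs]. For [s.1 = 0] the
    second alternative is the condition in [cstep]. *)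
Lemma cscan_Some i s j Cs c : (cscan i s j Cs).2 = Some c ->
  (s.2 = Some c /\
     forall k, count (rp i) (take k Cs) <= count (lp i) (take k Cs) + s.1) \/
  (exists A C B, [/\ Cs = A ++ C :: B, c = j + size A, rp i C,
     s.1 + count (lp i) A <= count (rp i) A & okL i A /\ okR i B]).
Proof.
elim: Cs s j => [|C Cs IH] s j /=; first by left.
move/IH=> [[Es okCs]|[A [D [B [-> -> rD cA [okA okB]]]]]]; last first.
  right; exists (C :: A), D, B; split=> //=; first by rewrite addSnnS.
    move: cA; rewrite /ctok /tokR /tokL; case: ifP => [rC|_].
      by rewrite rp_lp //; case: eqP => /=; lia.
    by case: ifP => /=; lia.
  split=> // -[|k]; last exact: okA.
  rewrite drop0 /=; move: cA; rewrite /ctok /tokR /tokL; case: ifP => [rC|_].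
    by rewrite rp_lp //; case: eqP => /=; lia.
  by case: ifP => /=; lia.
move: Es okCs; rewrite /ctok /tokR /tokL; case: ifP => [rC|rC].
  case: eqP => /= [s0 [<-] okCs|s0 -> okCs].
    right; exists [::], C, Cs; rewrite s0 addn0; split=> //; split=> // k.
    by have := okCs k; rewrite addn0.
  left; split=> // -[|k] //=; rewrite rC (rp_lp rC); have := okCs k; lia.
case: ifP => lC /= -> okCs; left; split=> // -[|k] //=.
  by rewrite rC lC; have := okCs k; lia.
by rewrite rC lC; have := okCs k; lia.
Qed.

Lemma set_nth_mid (T : Type) (x0 x y : T) A B :
  set_nth x0 (A ++ x :: B) (size A) y = A ++ y :: B.
Proof. by elim: A => //= a A ->. Qed.

Lemma nth_mid (T : Type) (x0 x : T) A B : nth x0 (A ++ x :: B) (size A) = x.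
Proof. by elim: A. Qed.

Definition raise_col (i c : nat) (Cs : seq (seq nat)) : seq (seq nat) :=
  set_nth [::] Cs c (raise i (nth [::] Cs c)).

Lemma cstepP n Cs Cs' : cstep n Cs Cs' <-> exists i c,
  [/\ 0 < i <= n, (cscan i (0, None) 0 Cs).2 = Some c & Cs' = raise_col i c Cs].
Proof.
split=> [[i A C B i_n rC okA okB]|[i [c [i_n sc ->]]]].
  exists i, (size A); split=> //; last by rewrite /raise_col set_nth_mid nth_mid.
  have A0 : (cscan i (0, None) 0 A).1 = 0.
    by apply: cscan_okL => //; have := okA 0; rewrite drop0.
  rewrite cscan_cat /= /ctok rC /tokR A0 /= cscan_okR //.
  by move=> k; have := okB k; rewrite addn0.
case: (cscan_Some sc) => [[]//|[A [C [B [-> -> rC _ [okA okB]]]]]].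
by rewrite /raise_col add0n set_nth_mid nth_mid; apply: CStep.
Qed.

Lemma size_raise i C : size (raise i C) = size C.
Proof. exact: size_map. Qed.

Lemma nth_raise i C r : r < size C ->
  nth 0 (raise i C) r = if nth 0 C r == i then i.+1 else nth 0 C r.
Proof. by move=> lt_r; rewrite (nth_map 0). Qed.

Lemma raise_sorted i C : rp i C -> sorted ltn C -> sorted ltn (raise i C).
Proof.
case/andP=> iC siC sC; apply/(sortedP 0) => r; rewrite size_raise => lt_r.
have lt : nth 0 C r < nth 0 C r.+1 := sortedP 0 sC _ lt_r.
have ne : nth 0 C r.+1 != i.+1 by apply: contraNneq siC => <-; apply: mem_nth.
rewrite !nth_raise //=; last exact: ltnW.
by case: eqP; case: eqP; lia.
Qed.

(** Only the column [D] to the right of [C] could obstruct. If its entry in the raised row is [i],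
    it has no [i.+1], since an [i.+1] further down in [D] would force one in [C]. So [D] is a
    closing bracket, against [okR]. *)
Lemma cstep_valid n hs Cs Cs' : cvalid n hs Cs -> cstep n Cs Cs' -> cvalid n hs Cs'.
Proof.
move=> [Ehs rng srt comp] st; case: st Ehs rng srt comp => {Cs Cs'} i A C B i_n rC okA okB.
case/andP: (rC) => iC siC.
move=> Ehs; rewrite !all_cat /= !sorted_cat_cons => /and3P[rA rC' rB] /and3P[sA sC sB].
case/andP=> cA cB; split.
- by rewrite -Ehs !map_cat /= size_raise.
- rewrite all_cat /= rA rB andbT /=; apply/allP => x /mapP[y yC ->].
  by case: eqP => _; [case/andP: i_n | apply: (allP rC')].
- by rewrite all_cat /= sA sB andbT /= raise_sorted.
rewrite sorted_cat_cons; apply/andP; split.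
  case: (lastP A) cA => [|A' E] //; rewrite -!cats1 -!catA /= !sorted_cat_cons /=.
  case/andP=> -> /andP[/colleP[sEC EC] _]; rewrite !andbT; apply/colleP.
  rewrite size_raise; split=> // r lt_r; rewrite nth_raise //.
  by apply: leq_trans (EC _ lt_r) _; case: eqP => [->|].
case: B okB {rB} sB cB {Ehs} => [|D B] okB //= /andP[sD _] /andP[/colleP[sCD CD] ->].
rewrite andbT; apply/colleP; rewrite size_raise; split=> // r lt_r.
have lt_rC := leq_trans lt_r sCD; rewrite nth_raise //; case: eqP => [Ci|_]; last exact: CD.
rewrite ltn_neqAle -{2}Ci CD // andbT; apply/negP => /eqP Di.
have := okB 1; rewrite /= take0 /=.
suff rD : rp i D by rewrite rD rp_lp.
rewrite /rp {1}Di mem_nth //=; apply/negP => /(nthP 0)[s lt_s Es].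
have {}lt_s : s < size D := lt_s; have {}Es : nth 0 D s = i.+1 := Es.
have lt_rs : r < s.
  rewrite ltnNge; apply/negP => le_sr; suff : nth 0 D s <= nth 0 D r by rewrite Es Di ltnn.
  case: (ltngtP s r) le_sr => // [lt_sr _|-> //].
  by apply: ltnW; apply: nth_sorted_ltn => //; rewrite lt_sr.
have lt_sC := leq_trans lt_s sCD.
have := CD _ lt_s; rewrite Es => le_C.
have lt_C : nth 0 C r < nth 0 C s by apply: nth_sorted_ltn => //; rewrite lt_rs.
suff Es' : nth 0 C s = i.+1 by move: siC; rewrite -Es' mem_nth.
by apply/eqP; rewrite eqn_leq le_C -Ci.
Qed.

(** * Conjugate partitions and transposed arrays *)

Definition conjugate (lam : seq nat) : seq nat :=
  [seq count (ltn r) lam | r <- iota 0 (head 0 lam)].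

Lemma count_ltn_sorted lam k r :
  sorted geq lam -> (k < count (ltn r) lam) = (r < nth 0 lam k).
Proof.
elim: lam k => [|x lam IH] k s_lam /=; first by rewrite nth_nil !ltn0.
have le_x : all (geq x) lam.
  by apply: order_path_min s_lam => a b c /=; lia.
have c0 : x <= r -> count (ltn r) lam = 0.
  move=> le_xr; apply/eqP; rewrite -leqn0 leqNgt -has_count; apply/hasPn => y.
  by move=> /(allP le_x) /=; lia.
case: k => [|k] /=; first by case: (ltnP r x) => [//|/c0->].
case: (ltnP r x) => [_|le_xr]; first by rewrite /= -IH ?(path_sorted s_lam).
rewrite c0 //= ltn0; symmetry; apply/negbTE; rewrite -leqNgt.
case: (ltnP k (size lam)) => [lt_k|ge_k]; last by rewrite nth_default.
by apply: leq_trans le_xr; have := allP le_x _ (mem_nth 0 lt_k).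
Qed.

Lemma nth_conj lam r : sorted geq lam -> nth 0 (conjugate lam) r = count (ltn r) lam.
Proof.
move=> s_lam; case: (ltnP r (head 0 lam)) => [lt_r|ge_r].
  by rewrite (nth_map 0) ?size_iota // nth_iota.
rewrite nth_default ?size_map ?size_iota //.
by apply/esym/eqP; rewrite -leqn0 leqNgt count_ltn_sorted // nth0 -leqNgt.
Qed.

Lemma conjP lam k r :
  sorted geq lam -> (k < nth 0 (conjugate lam) r) = (r < nth 0 lam k).
Proof. by move=> s_lam; rewrite nth_conj // count_ltn_sorted. Qed.

Definition ent (X : seq (seq nat)) (k r : nat) : nat := nth 0 (nth [::] X k) r.

(** The shape of the result is prescribed, so one and the same map turns rows into columns and
    columns into rows; entries outside the array read as 0. *)
Definition tr (hs : seq nat) (X : seq (seq nat)) : seq (seq nat) :=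
  mkseq (fun r => mkseq (fun k => ent X k r) (nth 0 hs r)) (size hs).

Lemma shape_tr hs X : map size (tr hs X) = hs.
Proof.
rewrite /tr /mkseq -map_comp -[RHS](mkseq_nth 0); apply: eq_map => r /=.
by rewrite size_map size_iota.
Qed.

Lemma nth_shape (X : seq (seq nat)) k : size (nth [::] X k) = nth 0 (map size X) k.
Proof.
case: (ltnP k (size X)) => [lt_k|ge_k]; first by rewrite (nth_map [::]).
by rewrite !nth_default ?size_map.
Qed.

Lemma ent_tr hs X r k :
  ent (tr hs X) r k = if k < nth 0 hs r then ent X k r else 0.
Proof.
rewrite {1}/ent; case: (ltnP r (size hs)) => [lt_r|ge_r].
  rewrite nth_mkseq //; case: ifP => lt_k; first by rewrite nth_mkseq.
  by rewrite nth_default // size_mkseq leqNgt lt_k.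
by rewrite [nth [::] _ _]nth_default ?size_mkseq // nth_nil [nth 0 hs r]nth_default.
Qed.

Lemma ent_default X k r : nth 0 (map size X) k <= r -> ent X k r = 0.
Proof. by move=> le; rewrite /ent nth_default // nth_shape. Qed.

Lemma ent_inj X Y : map size X = map size Y ->
  (forall k r, ent X k r = ent Y k r) -> X = Y.
Proof.
move=> sXY eXY; have sz : size X = size Y by rewrite -(size_map (@size nat) X) sXY size_map.
apply: (eq_from_nth (x0 := [::])) => // k _.
by apply: (eq_from_nth (x0 := 0)) => [|r _]; [rewrite !nth_shape sXY | apply: eXY].
Qed.

Lemma trK lam X : sorted geq lam -> map size X = lam ->
  tr lam (tr (conjugate lam) X) = X.
Proof.
move=> s_lam sX; apply: ent_inj => [|r k]; first by rewrite shape_tr.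
rewrite !ent_tr conjP //; case: ltnP => // ge_k.
by rewrite ent_default // sX.
Qed.

Lemma tr_conjK lam X : sorted geq lam -> map size X = conjugate lam ->
  tr (conjugate lam) (tr lam X) = X.
Proof.
move=> s_lam sX; apply: ent_inj => [|r k]; first by rewrite shape_tr.
rewrite !ent_tr -(conjP _ _ s_lam); case: ltnP => // ge_k.
by rewrite ent_default // sX.
Qed.

Lemma rowtokE r j Cs m : (forall k, (k < m) = (r < size (nth [::] Cs k))) ->
  rowtok r j Cs = [seq (ent Cs k r, j + k) | k <- iota 0 m].
Proof.
elim: Cs j m => [|C Cs IH] j m H /=.
  by have := H 0; rewrite /= ltn0; case: m {H}.
rewrite -(H 0); case: m H => [|m] H /=; first by rewrite (IH _ 0) // => k; apply: (H k.+1).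
rewrite addn0 (IH _ m) => [|k]; last exact: (H k.+1).
congr (_ :: _); rewrite -[1]/(1 + 0) iotaDl -map_comp; apply: eq_map => k /=.
by rewrite addSnnS.
Qed.

(** * Tableaux and their columns *)

Lemma is_ssytP n lam T : is_ssyt n lam T <->
  [/\ map size T = lam,
      forall r k, k < nth 0 lam r -> 0 < ent T r k <= n.+1,
      forall r k, k.+1 < nth 0 lam r -> ent T r k <= ent T r k.+1 &
      forall r k, k < nth 0 lam r.+1 -> ent T r k < ent T r.+1 k].
Proof.
have lt_size r k : k < size (nth [::] T r) -> r < size T.
  by move=> lt_k; rewrite ltnNge; apply: contraL lt_k => /(nth_default [::])->.
split=> -[sT H1 H2 H3]; split=> //; rewrite -?sT.
- move=> r k; rewrite -nth_shape => lt_k.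
  exact: (all_nthP 0 ((all_nthP [::] H1) _ (lt_size _ _ lt_k))).
- move=> r k; rewrite -nth_shape => lt_k.
  exact: (sortedP 0 ((all_nthP [::] H2) _ (lt_size _ _ lt_k))).
- move=> r k; rewrite -nth_shape => lt_k.
  exact: H3 (lt_size _ _ lt_k) lt_k.
- apply/(all_nthP [::]) => r _; apply/(all_nthP 0) => k.
  by rewrite nth_shape sT; apply: H1.
- apply/(all_nthP [::]) => r _; apply/(sortedP 0) => k.
  by rewrite nth_shape sT; apply: H2.
- by move=> r k _; rewrite nth_shape sT; apply: H3.
Qed.

Lemma cvalidP n hs Cs : sorted geq hs -> (cvalid n hs Cs <->
  [/\ map size Cs = hs,
      forall k r, r < nth 0 hs k -> 0 < ent Cs k r <= n.+1,
      forall k r, r.+1 < nth 0 hs k -> ent Cs k r < ent Cs k r.+1 &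
      forall k r, r < nth 0 hs k.+1 -> ent Cs k r <= ent Cs k.+1 r]).
Proof.
move=> s_hs.
have lt_size k r : r < size (nth [::] Cs k) -> k < size Cs.
  by move=> lt_k; rewrite ltnNge; apply: contraL lt_k => /(nth_default [::])->.
split=> -[sC H1 H2 H3]; split=> //; rewrite -?sC.
- move=> k r; rewrite -nth_shape => lt_r.
  exact: (all_nthP 0 ((all_nthP [::] H1) _ (lt_size _ _ lt_r))).
- move=> k r; rewrite -nth_shape => lt_r.
  exact: (sortedP 0 ((all_nthP [::] H2) _ (lt_size _ _ (ltnW lt_r)))).
- move=> k r; rewrite -nth_shape => lt_r.
  have /colleP[_ H] := sortedP [::] H3 _ (lt_size _ _ lt_r); exact: H.
- apply/(all_nthP [::]) => k _; apply/(all_nthP 0) => r.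
  by rewrite nth_shape sC; apply: H1.
- apply/(all_nthP [::]) => k _; apply/(sortedP 0) => r.
  by rewrite nth_shape sC; apply: H2.
- apply/(sortedP [::]) => k lt_k; apply/colleP; rewrite !nth_shape sC.
  split=> [|r]; last exact: H3.
  by apply: (sortedP 0 s_hs); rewrite -sC size_map.
Qed.

Lemma sorted_geq_nth hs r s : sorted geq hs -> r <= s -> nth 0 hs s <= nth 0 hs r.
Proof.
move=> s_hs; case: (ltnP s (size hs)) => [lt_s le_rs|ge_s _]; last by rewrite [nth 0 hs s]nth_default.
apply: (@sorted_leq_nth _ geq _ _ 0 hs) => //; first by move=> a b c /= ? ?; lia.
  by move=> a /=.
by rewrite inE; apply: leq_ltn_trans lt_s.
Qed.

Lemma conj_sorted lam : sorted geq lam -> sorted geq (conjugate lam).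
Proof.
move=> s_lam; apply/(sortedP 0) => r _; rewrite /geq /= !nth_conj //.
by apply: sub_count => x /=; lia.
Qed.

Lemma conjK lam : is_partition (size lam) lam -> conjugate (conjugate lam) = lam.
Proof.
case/and3P=> s_lam pos _; have s_c := conj_sorted s_lam.
have sz : size (conjugate (conjugate lam)) = size lam.
  rewrite size_map size_iota -nth0 nth_conj //; apply/eqP; rewrite -all_count.
  by apply: sub_all pos.
apply: (eq_from_nth (x0 := 0)) => // k _; apply/eqP.
suff E a : (a < nth 0 (conjugate (conjugate lam)) k) = (a < nth 0 lam k).
  by rewrite eqn_leq; apply/andP; split; [rewrite leqNgt E ltnn | rewrite leqNgt -E ltnn].
by rewrite !conjP.
Qed.

Section Bridge.

Variables (n : nat) (lam : seq nat).
Hypothesis s_lam : sorted geq lam.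

Lemma ssyt_cvalid T : is_ssyt n lam T -> cvalid n (conjugate lam) (tr (conjugate lam) T).
Proof.
move=> /is_ssytP[sT H1 H2 H3]; apply/cvalidP; first exact: conj_sorted.
split; first exact: shape_tr.
- by move=> k r lt_r; rewrite ent_tr lt_r; apply: H1; rewrite -conjP.
- move=> k r lt_r; rewrite !ent_tr lt_r (ltnW lt_r); apply: H3; rewrite -conjP //.
- move=> k r lt_r; have := lt_r; rewrite conjP // => lt_k.
  rewrite !ent_tr lt_r conjP // (ltnW lt_k); exact: H2.
Qed.

Lemma cvalid_ssyt Cs : cvalid n (conjugate lam) Cs -> is_ssyt n lam (tr lam Cs).
Proof.
move=> /(cvalidP _ _ (conj_sorted s_lam))[sC H1 H2 H3]; apply/is_ssytP.
split; first exact: shape_tr.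
- by move=> k r lt_r; rewrite ent_tr lt_r; apply: H1; rewrite conjP.
- move=> k r lt_r; rewrite !ent_tr lt_r (ltnW lt_r); apply: H3; rewrite conjP //.
- move=> k r lt_r; have := lt_r; rewrite -conjP // => lt_k.
  rewrite !ent_tr lt_r -conjP // (ltnW lt_k); exact: H2.
Qed.

Lemma ent_mid T0 a x y b T1 r k :
  ent (T0 ++ (a ++ x :: b) :: T1) r k =
  if (r == size T0) && (k == size a) then x else ent (T0 ++ (a ++ y :: b) :: T1) r k.
Proof.
rewrite /ent; elim: T0 r => [|t T0 IH] [|r] //=.
by elim: a k => [|c a IH] [|k] //=.
Qed.

Definition labelled (row : seq nat) : seq (nat * nat) := zip row (iota 0 (size row)).

Lemma unlabel row : [seq t.1 | t <- labelled row] = row.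
Proof. by rewrite -/(unzip1 _) unzip1_zip // size_iota. Qed.

Lemma rowstok_tr T : map size T = lam ->
  rowstok 0 (size T) 0 (tr (conjugate lam) T) = flatten (rev [seq labelled row | row <- T]).
Proof.
move=> sT; rewrite /rowstok; congr (flatten (rev _)).
rewrite -[in RHS](mkseq_nth [::] T) -map_comp; apply: eq_map => r /=.
rewrite (rowtokE 0 (m := nth 0 lam r)) => [|k]; last first.
  by rewrite nth_shape shape_tr conjP.
rewrite /labelled -{1}(mkseq_nth 0 (nth [::] T r)) nth_shape sT.
rewrite /mkseq -[X in zip _ X]map_id zip_map.
apply/eq_in_map => k; rewrite mem_iota add0n => /= lt_k.
by rewrite ent_tr conjP // lt_k add0n.
Qed.

(** The position found in the word and the column found by the scan belong to the same letter;
    cutting the word back into rows recovers its cell. *)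
Lemma Ftab_cols i T : is_ssyt n lam T ->
  Ftab i T = omap (fun c => tr lam (raise_col i c (tr (conjugate lam) T)))
                  (cscan i (0, None) 0 (tr (conjugate lam) T)).2.
Proof.
move=> Tok; have /is_ssytP[sT _ _ colT] := Tok; set Cs := tr (conjugate lam) T.
have [sCs _ ltCs leCs] := ssyt_cvalid Tok.
rewrite -(@scan_rows i (0, None) (size T)) //; last first.
  apply/(all_nthP [::]) => k _; rewrite nth_shape sCs nth_conj // -sT.
  by rewrite -(size_map size T) count_size.
rewrite rowstok_tr //; set toks := flatten _.
have Eword : reading_word T = [seq t.1 | t <- toks].
  rewrite /toks map_flatten map_rev -map_comp /reading_word; congr (flatten (rev _)).
  by rewrite -[LHS]map_id; apply: eq_map => row /=; rewrite unlabel.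
rewrite /Ftab /Fword Eword.
have [[-> ->]//|[W1 [c [W2 [Etoks -> ->]]]]] :=
  rightmost_unmatched_scan i toks 0 0 None None.
have [s0 [A [B [s1 [Es EW1 EW2]]]]] := flatten_split Etoks.
rewrite /= add0n Etoks map_cat /= -(size_map fst W1) set_nth_mid.
have {}Es : map labelled T = rev s1 ++ (A ++ (i, c) :: B) :: rev s0.
  by rewrite -[LHS]revK Es rev_cat rev_cons cat_rcons.
pose u := map (map (@fst nat nat)); pose a := map fst A; pose b := map fst B.
have ET : T = u (rev s1) ++ (a ++ i :: b) :: u (rev s0).
  transitivity (u (map labelled T)).
    by rewrite /u -map_comp -[LHS]map_id; apply: eq_map => row /=; rewrite unlabel.
  by rewrite Es /u map_cat /= map_cat.
(* The label of a letter is its index in its row, which is its column. *)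
have Ec : c = size a.
  have lt_r : size (rev s1) < size T.
    by rewrite -(size_map labelled) Es size_cat /= addnS ltnS leq_addr.
  have := congr1 (fun X => nth [::] X (size (rev s1))) Es.
  rewrite nth_mid (nth_map [::]) // => /(congr1 (map snd)).
  rewrite /labelled -/(unzip2 _) unzip2_zip ?size_iota // => /(congr1 (fun s => nth 0 s (size A))).
  rewrite map_cat /= -{2}(size_map snd A) nth_mid => <-; rewrite size_map nth_iota //.
  have := congr1 (fun X => size (nth [::] X (size (rev s1)))) Es.
  rewrite nth_mid (nth_map [::]) // size_zip size_iota minnn => ->.
  by rewrite size_cat /= addnS ltnS leq_addr.
set T0 := u (rev s1) in ET; set T1 := u (rev s0) in ET.
pose T' := T0 ++ (a ++ i.+1 :: b) :: T1.
have sT' : map size T' = lam by rewrite -sT ET /T' !map_cat /= !size_cat.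
have -> : map fst W1 ++ i.+1 :: map fst W2 = flatten (rev T').
  rewrite /T' rev_cat rev_cons cat_rcons !flatten_cat /= EW1 EW2 !map_cat.
  by rewrite /T0 /T1 /u -!map_rev !revK !map_flatten -!catA.
rewrite -map_rev; have -> : [seq size i0 | i0 <- rev T] = shape (rev T').
  by rewrite /shape !map_rev sT' sT.
rewrite flattenK revK; congr Some; apply: ent_inj => [|r k]; first by rewrite shape_tr.
rewrite ent_tr; case: ltnP => [lt_k|ge_k]; last by rewrite ent_default // sT'.
have lt_r : r < nth 0 (conjugate lam) k by rewrite conjP.
have -> : ent (raise_col i c Cs) k r =
    if (k == c) && (ent T r k == i) then i.+1 else ent T r k.
  have ECs : ent Cs k r = ent T r k by rewrite ent_tr lt_r.
  rewrite /ent /raise_col nth_set_nth /=; case: eqP => [Ekc|_] //=.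
  by rewrite -Ekc nth_raise ?nth_shape ?sCs // -/(ent Cs k r) ECs.
rewrite (ent_mid _ _ _ i) -ET -/T0 andbC Ec; case: eqP => //= Eka.
have Ei : ent T (size T0) k = i by rewrite Eka ET /ent !nth_mid.
(* [raise] changes every [i] of the column. Columns increase strictly, so the cell in row [size T0]
   is the only one affected. *)
have mono x y : x < y -> k < nth 0 lam y -> ent T x k < ent T y k.
  elim: y => // y IH; rewrite ltnS leq_eqVlt => /predU1P[->|lt_xy] lt_ky.
    exact: colT.
  apply: ltn_trans (colT _ _ lt_ky); apply: IH => //.
  exact: leq_trans lt_ky (sorted_geq_nth s_lam (leqnSn _)).
have lt_k0 : k < nth 0 lam (size T0).
  by rewrite -sT -nth_shape ET nth_mid size_cat Eka /= addnS ltnS leq_addr.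
case: (ltngtP r (size T0)) => [lt|gt|->]; last by rewrite Ei eqxx.
  by have := mono _ _ lt lt_k0; rewrite Ei => /ltn_eqF->.
by have := mono _ _ gt lt_k; rewrite Ei => /gtn_eqF->.
Qed.

(** The equation says that [T'] has shape [lam]. Here [T'] is an arbitrary array, and its columns
    alone would not exclude, for instance, additional empty rows. *)
Lemma cover_cstep T T' : is_ssyt n lam T -> (Defs.cover n T T' <->
  T' = tr lam (tr (conjugate lam) T') /\ cstep n (tr (conjugate lam) T) (tr (conjugate lam) T')).
Proof.
move=> Tok; have cok := ssyt_cvalid Tok; split.
  case=> i i_n; rewrite Ftab_cols //; case Ec: (cscan _ _ _ _).2 => [c|] //= [<-].
  have st : cstep n (tr (conjugate lam) T) (raise_col i c (tr (conjugate lam) T)).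
    by apply/cstepP; exists i, c.
  have [sC _ _ _] := cstep_valid cok st.
  by rewrite !tr_conjK.
case=> ET' /cstepP[i [c [i_n Ec E]]]; exists i => //.
by rewrite Ftab_cols // Ec /= -E -ET'.
Qed.

Lemma cover_ssyt T T' : is_ssyt n lam T -> Defs.cover n T T' ->
  is_ssyt n lam T' /\ cstep n (tr (conjugate lam) T) (tr (conjugate lam) T').
Proof.
move=> Tok /(cover_cstep _ Tok)[ET' st]; split=> //; rewrite ET'.
exact: cvalid_ssyt (cstep_valid (ssyt_cvalid Tok) st).
Qed.

Lemma crystal_is_lattice_cols : crystal_is_lattice n lam <-> clattice n (conjugate lam).
Proof.
have le T T' : is_ssyt n lam T -> is_ssyt n lam T' -> (crystal_le n T T' <->
    clos_refl_trans _ (cstep n) (tr (conjugate lam) T) (tr (conjugate lam) T')).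
  move=> Tok Tok'; have [sT _ _ _] := Tok; have [sT' _ _ _] := Tok'; split.
    exact: (fun c => (clos_mono cover_ssyt Tok c).2).
  move=> /(clos_mono (sB := Defs.cover n) (P := cvalid n (conjugate lam)) (f := tr lam)) H.
  rewrite -(trK s_lam sT) -(trK s_lam sT'); apply: proj2 (H _ (ssyt_cvalid Tok)).
  move=> Cs Cs' Cok st; have Cok' := cstep_valid Cok st; split=> //.
  have [sC _ _ _] := Cok; have [sC' _ _ _] := Cok'.
  by apply/cover_cstep; [exact: cvalid_ssyt | rewrite !tr_conjK].
split.
  apply: (lattice_iso (f := tr (conjugate lam)) (g := tr lam)) => //.
  - exact: ssyt_cvalid.
  - exact: cvalid_ssyt.
  - by move=> Cs [sC _ _ _]; rewrite tr_conjK.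
apply: (lattice_iso (f := tr lam) (g := tr (conjugate lam))).
- exact: cvalid_ssyt.
- exact: ssyt_cvalid.
- by move=> T [sT _ _ _]; rewrite trK.
- move=> Cs Cs' Cok Cok'; have [sC _ _ _] := Cok; have [sC' _ _ _] := Cok'.
  rewrite -{1}(tr_conjK s_lam sC) -{1}(tr_conjK s_lam sC').
  by apply: iff_sym; apply: le; apply: cvalid_ssyt.
Qed.

End Bridge.

(** * Duality *)

Lemma sorted_ltn_eq (C D : seq nat) : sorted ltn C -> sorted ltn D -> C =i D -> C = D.
Proof. exact: (irr_sorted_eq ltn_trans ltnn). Qed.

Lemma sorted_ltn_uniq (C : seq nat) : sorted ltn C -> uniq C.
Proof. exact: (sorted_uniq ltn_trans ltnn). Qed.

Lemma mem_raise i C x : rp i C ->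
  (x \in raise i C) = (x == i.+1) || (x \in C) && (x != i).
Proof.
case/andP=> iC _; apply/mapP/orP => [[y yC ->]|[/eqP->|/andP[xC xi]]].
- by case: (eqVneq y i) => [_|yi]; [left | right; rewrite yC].
- by exists i; rewrite ?eqxx.
- by exists x; rewrite ?(negPf xi).
Qed.

Lemma ltn_count_sorted (C : seq nat) v r : sorted ltn C ->
  (r < count (geq v) C) = (r < size C) && (nth 0 C r <= v).
Proof.
elim: C r => [|c C IH] r //= sC.
have gt_c : all (ltn c) C by apply: order_path_min sC; apply: ltn_trans.
case: (leqP c v) => [le_cv|lt_vc].
  by case: r => [|r] //=; rewrite add1n ltnS IH ?(path_sorted sC).
have -> : count (geq v) C = 0.
  apply/eqP; rewrite -leqn0 leqNgt -has_count; apply/hasPn => x /(allP gt_c) /=; lia.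
rewrite ltn0; case: r => [|r] /=; first by lia.
apply/esym/negP => /andP[lt_r le_r].
by have := allP gt_c _ (mem_nth 0 lt_r); rewrite /=; lia.
Qed.

(** In this form the comparison is visibly reversed by complementation: the counts for a column and
    for its complement add up to a constant. *)
Lemma colle_count (C D : seq nat) : sorted ltn C -> sorted ltn D ->
  colle C D <-> forall v, count (geq v) D <= count (geq v) C.
Proof.
move=> sC sD; split=> [/colleP[sDC DC] v|H].
  case E: (count _ D) => [|m] //; have : m < count (geq v) D by rewrite E.
  rewrite !ltn_count_sorted // => /andP[lt_m le_m].
  by rewrite (leq_trans lt_m sDC) (leq_trans (DC _ lt_m) le_m).
have K r : r < size D -> (r < size C) && (nth 0 C r <= nth 0 D r).
  by move=> lt_r; rewrite -ltn_count_sorted // (leq_trans _ (H _)) // ltn_count_sorted // lt_r /=.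
apply/colleP; split=> [|r /K/andP[]//].
by case E: (size D) => [|m] //; have := K m; rewrite E => /(_ (leqnn _))/andP[].
Qed.

Definition compl (n : nat) (C : seq nat) : seq nat := [seq x <- iota 1 n.+1 | x \notin C].

Definition dual (n : nat) (Cs : seq (seq nat)) : seq (seq nat) := rev (map (compl n) Cs).

Definition dual_heights (n : nat) (hs : seq nat) : seq nat := rev [seq n.+1 - h | h <- hs].

Section Dual.

Variable n : nat.

Notation inrange := (all (fun x => 0 < x <= n.+1)).

Lemma mem_compl C x : (x \in compl n C) = (0 < x <= n.+1) && (x \notin C).
Proof. by rewrite mem_filter mem_iota add1n ltnS andbC. Qed.

Lemma compl_sorted C : sorted ltn (compl n C).
Proof. exact/(sorted_filter ltn_trans)/iota_ltn_sorted. Qed.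

Lemma compl_inrange C : inrange (compl n C).
Proof. by apply/allP => x; rewrite mem_compl => /andP[]. Qed.

Lemma complK C : inrange C -> sorted ltn C -> compl n (compl n C) = C.
Proof.
move=> rC sC; apply: sorted_ltn_eq => // [|x]; first exact: compl_sorted.
rewrite !mem_compl negb_and negbK; case: (boolP (x \in C)) => [xC|_].
  by rewrite orbT andbT (allP rC).
by rewrite orbF andbN.
Qed.

Lemma count_compl (a : pred nat) C : inrange C -> sorted ltn C ->
  count a (compl n C) + count a C = count a (iota 1 n.+1).
Proof.
move=> rC sC.
have -> : count a C = count a [seq x <- iota 1 n.+1 | x \in C].
  apply/permP: a; rewrite perm_sym; apply: uniq_perm.
  - exact/filter_uniq/iota_uniq.
  - exact: sorted_ltn_uniq.
  move=> x; rewrite mem_filter mem_iota andb_idr // => /(allP rC).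
  by rewrite add1n ltnS.
rewrite /compl; elim: (iota 1 n.+1) => //= x s <-.
by case: (x \in C) => /=; lia.
Qed.

Lemma size_compl C : inrange C -> sorted ltn C -> size (compl n C) = n.+1 - size C.
Proof.
move=> rC sC; have := count_compl predT rC sC.
by rewrite !count_predT size_iota; lia.
Qed.

Lemma colle_compl C D : inrange C -> sorted ltn C -> inrange D -> sorted ltn D ->
  colle C D -> colle (compl n D) (compl n C).
Proof.
move=> rC sC rD sD /(colle_count sC sD) CD; apply/colle_count => [||v]; try exact: compl_sorted.
have := CD v; have := count_compl (geq v) rC sC; have := count_compl (geq v) rD sD.
by move: (count _ _) (count _ _) (count _ _) (count _ _) (count _ _); lia.
Qed.

Lemma dualK Cs : all inrange Cs -> all (sorted ltn) Cs -> dual n (dual n Cs) = Cs.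
Proof.
rewrite /dual map_rev revK; elim: Cs => //= C Cs IH /andP[rC rCs] /andP[sC sCs].
by rewrite complK // IH.
Qed.

Lemma dual_valid hs Cs : cvalid n hs Cs -> cvalid n (dual_heights n hs) (dual n Cs).
Proof.
move=> [<- rCs sCs cCs]; split.
- rewrite /dual /dual_heights map_rev -!map_comp; congr rev.
  apply/eq_in_map => C CCs /=; rewrite size_compl //; [exact: (allP rCs) | exact: (allP sCs)].
- by rewrite all_rev all_map; apply/allP => C _; apply: compl_inrange.
- by rewrite all_rev all_map; apply/allP => C _; apply: compl_sorted.
rewrite rev_sorted.
have al : all (fun C => inrange C && sorted ltn C) Cs.
  by apply/allP => C CCs; rewrite (allP rCs) // (allP sCs).
apply: homo_sorted_in al cCs => C D /andP[rC sC] /andP[rD sD] /=.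
exact: colle_compl.
Qed.

Lemma rp_compl i C : 0 < i <= n -> rp i (compl n C) = lp i C.
Proof.
move=> i_n; rewrite /rp /lp !mem_compl.
have -> : 0 < i <= n.+1 by lia.
have -> : 0 < i.+1 <= n.+1 by lia.
by rewrite /= negbK andbC.
Qed.

Lemma lp_compl i C : 0 < i <= n -> lp i (compl n C) = rp i C.
Proof.
move=> i_n; rewrite /rp /lp !mem_compl.
have -> : 0 < i <= n.+1 by lia.
have -> : 0 < i.+1 <= n.+1 by lia.
by rewrite /= negbK andbC.
Qed.

Lemma raise_compl i C : 0 < i <= n -> inrange C -> sorted ltn C -> rp i C ->
  rp i (compl n (raise i C)) /\ raise i (compl n (raise i C)) = compl n C.
Proof.
move=> i_n rC sC riC; have [iC siC] := andP riC.
have r1 : rp i (compl n (raise i C)).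
  rewrite rp_compl // /lp !mem_raise // !eqxx /= andbF orbF.
  by rewrite ltn_eqF.
split=> //; apply: sorted_ltn_eq => [||x].
- exact: raise_sorted (compl_sorted _).
- exact: compl_sorted.
rewrite mem_raise // !mem_compl mem_raise //.
case: (eqVneq x i.+1) => [->|nx] /=; first by rewrite siC andbT; lia.
case: (eqVneq x i) => [->|nx'] /=; first by rewrite iC /= !andbF.
by rewrite !andbT.
Qed.

(** Complementation exchanges [rp] with [lp], and reversing the list exchanges suffixes with
    prefixes, so [okL] and [okR] trade places. The complement of the raised column contains [i] and
    not [i.+1], and raising it restores the complement of [C]. *)
Lemma dual_cstep hs Cs Cs' : cvalid n hs Cs -> cstep n Cs Cs' ->
  cstep n (dual n Cs') (dual n Cs).
Proof.
move=> [_ rCs sCs _] st; case: st rCs sCs => {Cs Cs'} i A C B i_n riC okA okB.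
rewrite !all_cat /= => /and3P[_ rC _] /and3P[_ sC _].
have [r1 E] := raise_compl i_n rC sC riC.
rewrite /dual !map_cat !rev_cat /= !rev_cons !cat_rcons -E.
have cr X a b : (forall C, a (compl n C) = b C) ->
    count a (map (compl n) X) = count b X.
  by move=> ab; rewrite count_map; apply: eq_count => D /=.
apply: CStep => // j.
  rewrite drop_rev count_rev [X in _ <= X]count_rev -map_take.
  by rewrite !(cr _ _ _ (fun C => lp_compl C i_n)) !(cr _ _ _ (fun C => rp_compl C i_n)).
rewrite take_rev count_rev [X in _ <= X]count_rev -map_drop.
by rewrite !(cr _ _ _ (fun C => lp_compl C i_n)) !(cr _ _ _ (fun C => rp_compl C i_n)).
Qed.

Lemma dual_heightsK hs : all (geq n.+1) hs -> dual_heights n (dual_heights n hs) = hs.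
Proof.
rewrite /dual_heights map_rev revK; elim: hs => //= h hs IH /andP[le_h /IH->].
by rewrite subKn.
Qed.

Lemma clattice_dual hs : all (geq n.+1) hs ->
  clattice n hs -> clattice n (dual_heights n hs).
Proof.
move=> le_hs L; apply/lattice_flip; move: L.
have dK hs' Cs : cvalid n hs' Cs -> dual n (dual n Cs) = Cs.
  by case=> _ rCs sCs _; apply: dualK.
have le hs' Cs Cs' : cvalid n hs' Cs -> clos_refl_trans _ (cstep n) Cs Cs' ->
    clos_refl_trans _ (cstep n) (dual n Cs') (dual n Cs).
  move=> v c; apply: clos_flip.
  apply: (clos_mono (P := cvalid n hs') (sA := cstep n) _ v c).2 => X X' vX st.
  by split; [exact: cstep_valid vX st | exact: dual_cstep vX st].
apply: (lattice_iso (P := cvalid n hs) (f := dual n) (g := dual n)).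
- exact: dual_valid.
- by move=> Cs v; rewrite -(dual_heightsK le_hs); apply: dual_valid.
- exact: dK.
move=> Cs Cs' v v'; split; first exact: le v.
by move=> /(le _ _ _ (dual_valid v')); rewrite (dK _ _ v) (dK _ _ v').
Qed.

End Dual.

(** * Obstructions to the lattice property *)

Definition nexts (n : nat) (Cs : seq (seq nat)) : seq (seq (seq nat)) :=
  pmap (fun i => omap (fun c => raise_col i c Cs) (cscan i (0, None) 0 Cs).2) (iota 1 n).

Lemma mem_nexts n Cs Cs' : cstep n Cs Cs' <-> Cs' \in nexts n Cs.
Proof.
rewrite mem_pmap; split=> [/cstepP[i [c [i_n Ec ->]]]|/mapP[i]].
  by apply/mapP; exists i; rewrite ?mem_iota ?add1n ?ltnS // Ec.
rewrite mem_iota add1n ltnS => i_n; case Ec: (cscan _ _ _ _).2 => [c|] //= [->].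
by apply/cstepP; exists i, c.
Qed.

Definition next_level (n : nat) (S : seq (seq (seq nat))) : seq (seq (seq nat)) :=
  undup (flatten (map (nexts n) S)).

Definition upset (n k : nat) (Cs : seq (seq nat)) : seq (seq (seq nat)) :=
  flatten (traject (next_level n) [:: Cs] k.+1).

Lemma mem_upset n k Cs Cs' :
  reflect (exists2 i, i <= k & Cs' \in iter i (next_level n) [:: Cs]) (Cs' \in upset n k Cs).
Proof.
apply: (iffP flattenP) => [[S /trajectP[i lt_i ->] in_S]|[i le_i in_i]]; first by exists i.
by exists (iter i (next_level n) [:: Cs]) => //; apply/trajectP; exists i.
Qed.

Lemma upset_reach n k Cs Cs' : Cs' \in upset n k Cs -> clos_refl_trans _ (cstep n) Cs Cs'.
Proof.
case/mem_upset=> i _; elim: i Cs' => [|i IH] Cs' /=; first by rewrite inE => /eqP->; apply: rt_refl.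
rewrite mem_undup => /flattenP[S /mapP[X /IH X_in ->]] /mem_nexts st.
exact: rt_trans X_in (rt_step _ _ _ _ st).
Qed.

Lemma cat_split (T : Type) (X Y A B : seq T) c : X ++ Y = A ++ c :: B ->
  (exists2 B', X = A ++ c :: B' & B = B' ++ Y) \/
  (exists2 A', A = X ++ A' & Y = A' ++ c :: B).
Proof.
elim: X A => [|x X IH] [|a A] /=; try by [right; exists [::] | right; exists (a :: A)].
  by case=> -> <-; left; exists X.
case=> -> /IH[[B' -> ->]|[A' -> ->]]; first by left; exists B'.
by right; exists A'.
Qed.

Lemma okL_cat i A B : okL i (A ++ B) -> okL i B.
Proof. by move=> H j; have := H (size A + j); rewrite drop_cat ltnNge leq_addr addKn. Qed.

Lemma okR_cat i A B : okR i (A ++ B) -> okR i A.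
Proof.
move=> H j; case: (leqP j (size A)) => [le_j|gt_j].
  by have := H j; rewrite takel_cat.
by have := H (size A); rewrite take_size_cat // take_oversize // ltnW.
Qed.

Lemma cstep_mono n Cs Cs' k r : cstep n Cs Cs' -> ent Cs k r <= ent Cs' k r.
Proof.
case=> i A C B _ _ _ _; rewrite /ent; elim: A k => [|a A IH] [|k] //=.
case: (ltnP r (size C)) => [lt_r|ge_r]; last by rewrite nth_default.
by rewrite nth_raise //; case: eqP => [->|_] //.
Qed.

Lemma clos_mono_ent n Cs Cs' k r :
  clos_refl_trans _ (cstep n) Cs Cs' -> ent Cs k r <= ent Cs' k r.
Proof.
elim=> {Cs Cs'} [X Y|//|X Y Z _ XY _ YZ]; first exact: cstep_mono.
exact: leq_trans XY YZ.
Qed.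

(** A raised cell never returns to its old value. Every freezing argument rests on this. *)
Lemma raised_stuck n i A C B Z : i \in C ->
  clos_refl_trans _ (cstep n) (A ++ raise i C :: B) Z ->
  i < ent Z (size A) (index i C).
Proof.
move=> iC /(clos_mono_ent (size A) (index i C)); apply: leq_trans.
by rewrite /ent nth_mid nth_raise ?index_mem // nth_index // eqxx.
Qed.

Lemma sorted_ltn_ge C r : sorted ltn C -> all (ltn 0) C -> r < size C -> r < nth 0 C r.
Proof.
move=> sC pC; elim: r => [|r IH] lt_r; first exact: (allP pC _ (mem_nth 0 lt_r)).
by apply: leq_ltn_trans (IH (ltnW lt_r)) _; apply: nth_sorted_ltn => //; rewrite leqnn.
Qed.

Lemma sorted_ltn_le C r m : sorted ltn C -> all (geq m) C -> r < size C ->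
  nth 0 C r + (size C - r.+1) <= m.
Proof.
move=> sC mC lt_r; move E: (size C - r.+1) => d; elim: d r lt_r E => [|d IH] r lt_r E.
  by rewrite addn0; apply: (allP mC _ (mem_nth 0 lt_r)).
have lt_r1 : r.+1 < size C by lia.
apply: leq_trans (IH r.+1 lt_r1 _); last by lia.
by rewrite addnS -addSn leq_add2r; apply: nth_sorted_ltn => //; rewrite leqnn.
Qed.

Lemma colle_iota_l h D : sorted ltn D -> all (ltn 0) D -> size D <= h -> colle (iota 1 h) D.
Proof.
move=> sD pD le_h; apply/colleP; rewrite size_iota; split=> // r lt_r.
by rewrite nth_iota; [exact: sorted_ltn_ge | apply: leq_trans le_h].
Qed.

Lemma colle_iota_r n h C : sorted ltn C -> all (geq n.+1) C -> h <= size C -> h <= n.+1 ->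
  colle C (iota (n.+2 - h) h).
Proof.
move=> sC nC le_h le_n; apply/colleP; rewrite size_iota; split=> // r lt_r.
rewrite nth_iota //; have := sorted_ltn_le sC nC (leq_trans lt_r le_h); lia.
Qed.

Lemma map_split (T U : Type) (f : T -> U) s A c B : map f s = A ++ c :: B ->
  exists s1 x s2, [/\ s = s1 ++ x :: s2, A = map f s1, c = f x & B = map f s2].
Proof.
elim: A s => [|a A IH] [|x s] //= []; first by move=> <- <-; exists [::], x, s.
by move=> <- /IH[s1 [y [s2 [-> -> -> ->]]]]; exists (x :: s1), y, s2.
Qed.

Lemma cstep_shape n Cs Cs' : cstep n Cs Cs' ->
  all (all (fun x => 0 < x <= n.+1)) Cs ->
  map size Cs = map size Cs' /\ all (all (fun x => 0 < x <= n.+1)) Cs'.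
Proof.
case=> i A C B i_n _ _ _; rewrite !map_cat /= size_raise !all_cat /=.
case/and3P=> -> rC ->; split=> //=; rewrite andbT.
by apply/allP => x /mapP[y yC ->]; case: eqP => _; [lia | apply: (allP rC)].
Qed.

Lemma nth_catr (T : Type) (x0 : T) s1 s2 k : nth x0 (s1 ++ s2) (size s1 + k) = nth x0 s2 k.
Proof. by rewrite nth_cat ltnNge leq_addr /= addKn. Qed.

(** * Intervals of type A_3 inside larger crystals *)

Section Core.

(* Columns are the highest weight columns [1..h] for [h] in [h1s], then core
   columns [emb f K], then the lowest weight columns [n+2-h..n+1].  The letters
   of [f] stay fixed between two elements of this form, so that such intervals
   are intervals of the crystal of type A_3 on the letters [p+1..p+4]. *)
Variables (n p : nat) (h1s h2s : seq nat) (fr : seq (seq nat * seq nat)).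

Definition emb (f : seq nat * seq nat) (K : seq nat) : seq nat :=
  f.1 ++ map (addn p) K ++ f.2.

Definition embs (Ks : seq (seq nat)) : seq (seq nat) := [seq emb t.1 t.2 | t <- zip fr Ks].

Definition full (Ks : seq (seq nat)) : seq (seq nat) :=
  [seq iota 1 h | h <- h1s] ++ embs Ks ++ [seq iota (n.+2 - h) h | h <- h2s].

Definition frozen (f : seq nat * seq nat) : bool :=
  [&& sorted ltn f.1, sorted ltn f.2, all (fun x => 0 < x <= p) f.1 &
      all (fun x => p + 4 < x <= n.+1) f.2].

Definition corecol (K : seq nat) : bool := sorted ltn K && all (fun x => 0 < x <= 4) K.

Hypothesis p_le : p + 3 <= n.
Hypothesis frP : all frozen fr.

Lemma mem_emb f K x : frozen f -> 0 < x <= 4 -> (p + x \in emb f K) = (x \in K).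
Proof.
case/and4P=> _ _ /allP f1 /allP f2 x4; rewrite !mem_cat mem_map; last exact: addnI.
have -> : (p + x \in f.1) = false by apply/negP => /f1; lia.
have -> : (p + x \in f.2) = false by apply/negP => /f2; lia.
by rewrite orbF.
Qed.

Lemma rp_emb f K x : frozen f -> 0 < x <= 3 -> rp (p + x) (emb f K) = rp x K.
Proof. by move=> fP x3; rewrite /rp -addnS !mem_emb //; lia. Qed.

Lemma lp_emb f K x : frozen f -> 0 < x <= 3 -> lp (p + x) (emb f K) = lp x K.
Proof. by move=> fP x3; rewrite /lp -addnS !mem_emb //; lia. Qed.

Lemma raise_emb f K x : frozen f -> 0 < x <= 3 ->
  raise (p + x) (emb f K) = emb f (raise x K).
Proof.
case/and4P=> _ _ /allP f1 /allP f2 x3; rewrite /raise /emb !map_cat; congr (_ ++ _).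
  rewrite -[RHS]map_id; apply/eq_in_map => y /f1; case: eqP => //; lia.
congr (_ ++ _).
  rewrite -!map_comp; apply: eq_map => y /=; rewrite eqn_add2l.
  by case: eqP => //; rewrite addnS.
rewrite -[RHS]map_id; apply/eq_in_map => y /f2; case: eqP => //; lia.
Qed.

Lemma count_embs (a b : pred (seq nat)) (zs : seq (seq nat * seq nat * seq nat)) :
  {subset unzip1 zs <= fr} -> (forall f K, frozen f -> a (emb f K) = b K) ->
  count a [seq emb t.1 t.2 | t <- zs] = count b (unzip2 zs).
Proof.
move=> zfr ab; rewrite !count_map; apply: eq_in_count => -[f K] zin /=; apply: ab.
by apply: (allP frP); apply: zfr; apply/mapP; exists (f, K).
Qed.

Lemma zip_split (T U : Type) (s : seq T) (t : seq U) A c B : size s = size t ->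
  t = A ++ c :: B -> exists s1 x s2, [/\ s = s1 ++ x :: s2, size s1 = size A & size s2 = size B].
Proof.
elim: A s t => [|a A IH] [|x s] t /= sz E; rewrite E //= in sz *; try by [].
  by exists [::], x, s; case: sz.
case: sz => sz; have [s1 [y [s2 [-> E1 E2]]]] := IH s _ sz erefl.
by exists (x :: s1), y, s2; rewrite /= E1.
Qed.

(** A column [1..h] is never an opening bracket, and a column [n+2-h..n+1] is never a closing one
    for [i <= n]. Hence the outer columns do not disturb the matching inside the core. *)
Lemma full_cstep Ks Ks' : size fr = size Ks -> cstep 3 Ks Ks' -> cstep n (full Ks) (full Ks').
Proof.
move=> sz st; case: st sz => {Ks Ks'} x A K B x3 rK okA okB sz.
have [f1 [f [f2 [Efr sz1 sz2]]]] := zip_split sz erefl.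
have fP g : g \in fr -> frozen g by exact: (allP frP).
have ff : frozen f by apply: fP; rewrite Efr mem_cat mem_head orbT.
rewrite /full /embs Efr !zip_cat //= !map_cat /= -!catA !cat_cons.
rewrite -(raise_emb _ ff x3) [X in cstep n X _]catA [X in cstep n _ X]catA.
have n_x : p + x <= n by lia.
have sub1 : {subset unzip1 (zip f1 A) <= fr}.
  by rewrite unzip1_zip ?sz1 // => g gin; rewrite Efr mem_cat gin.
have sub2 : {subset unzip1 (zip f2 B) <= fr}.
  by rewrite unzip1_zip ?sz2 // => g gin; rewrite Efr mem_cat in_cons gin !orbT.
apply: CStep => //.
- by rewrite n_x andbT addn_gt0 (proj1 (andP x3)) orbT.
- by rewrite rp_emb.
- move=> j; rewrite drop_cat; case: ltnP => _.
    rewrite !count_cat (count_embs sub1 (fun f K fP => lp_emb K fP x3)).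
    rewrite (count_embs sub1 (fun f K fP => rp_emb K fP x3)) unzip2_zip ?sz1 //.
    rewrite [X in X + _ <= _](_ : _ = 0).
      by have := okA 0; rewrite drop0; lia.
    apply/eqP; rewrite -leqn0 leqNgt -has_count; apply/hasPn => C /mem_drop/mapP[h _ ->].
    by rewrite /lp !mem_iota; lia.
  set k := j - _; rewrite -!map_drop.
  have subd : {subset unzip1 (drop k (zip f1 A)) <= fr}.
    by move=> g; rewrite /unzip1 map_drop => /mem_drop; apply: sub1.
  rewrite (count_embs subd (fun f K fP => lp_emb K fP x3)).
  rewrite (count_embs subd (fun f K fP => rp_emb K fP x3)).
  by rewrite /unzip2 map_drop -/(unzip2 _) unzip2_zip ?sz1.
move=> j; rewrite take_cat; case: ltnP => _.
  rewrite -!map_take.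
  have subt : {subset unzip1 (take j (zip f2 B)) <= fr}.
    by move=> g; rewrite /unzip1 map_take => /mem_take; apply: sub2.
  rewrite (count_embs subt (fun f K fP => lp_emb K fP x3)).
  rewrite (count_embs subt (fun f K fP => rp_emb K fP x3)).
  by rewrite /unzip2 map_take -/(unzip2 _) unzip2_zip ?sz2.
rewrite !count_cat (count_embs sub2 (fun f K fP => lp_emb K fP x3)).
rewrite (count_embs sub2 (fun f K fP => rp_emb K fP x3)) unzip2_zip ?sz2 //.
rewrite [X in _ + X <= _](_ : _ = 0).
  by have := okB (size B); rewrite take_size; lia.
apply/eqP; rewrite -leqn0 leqNgt -has_count; apply/hasPn => C /mem_take/mapP[h _ ->].
by rewrite /rp !mem_iota; lia.
Qed.

(** By [raised_stuck] the raised cell must have different values in [full Ks] and [full Kz]. Outer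
    columns and frozen letters have the same values in both, so the raised letter belongs to the
    core. *)
Lemma full_cstep_inv Ks Z Kz : size fr = size Ks -> map size Ks = map size Kz ->
  all (all (fun x => 0 < x <= 4)) Ks -> all (all (fun x => 0 < x <= 4)) Kz ->
  cstep n (full Ks) Z -> clos_refl_trans _ (cstep n) Z (full Kz) ->
  exists2 Ks', Z = full Ks' & cstep 3 Ks Ks'.
Proof.
move=> sz szK rK rKz st; have [i [A [C [B [EF EZ riC [okA okB]]]]]] :
    exists i A C B, [/\ full Ks = A ++ C :: B, Z = A ++ raise i C :: B, rp i C & okL i A /\ okR i B].
  by case: st => i A C B _ riC okA okB; exists i, A, C, B.
rewrite EZ {Z EZ st}; have iC : i \in C by case/andP: riC.
have same : nth [::] (full Kz) (size A) = C ->
    ~ clos_refl_trans (seq (seq nat)) (cstep n) (A ++ raise i C :: B) (full Kz).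
  by move=> E /(raised_stuck iC); rewrite /ent E nth_index // ltnn.
have szE : size (embs Ks) = size (embs Kz).
  by rewrite !size_map !size_zip -(size_map size Ks) szK size_map.
rewrite {1}/full in EF; case: (cat_split EF) => [[B' EX _] /same[]|[A' EA EY]].
  by rewrite /full EX -catA nth_mid.
case: (cat_split EY) => {EY} [[B' EX EB]|[A'' EA' EY] /same[]]; last first.
  rewrite /full EA EA' !nth_cat !size_cat !(ltnNge _ (size _)) !leq_addr /= !addKn szE.
  by rewrite leq_addr /= addKn EY nth_mid.
have sz' : size fr = size Kz by rewrite sz -(size_map size Ks) szK size_map.
have [zs [[f K] [zs' [Ez EA1 EC EB1]]]] := map_split EX.
have Efr : fr = unzip1 zs ++ f :: unzip1 zs'.
  by rewrite -[fr](unzip1_zip (t := Ks)) ?sz // Ez /unzip1 map_cat.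
have EKs : Ks = unzip2 zs ++ K :: unzip2 zs'.
  by rewrite -[Ks](unzip2_zip (s := fr)) ?sz // Ez /unzip2 map_cat.
have [k1 [Kc [k2 [EKz sz1 _]]]] := zip_split (esym sz') Efr.
rewrite size_map in sz1.
have szc : size K = size Kc.
  have := congr1 (fun s => nth 0 s (size zs)) szK.
  rewrite EKs EKz !map_cat /= -{1}(size_map (@snd _ _) zs) -/(unzip2 zs) -(size_map size (unzip2 zs)) nth_mid.
  by rewrite -sz1 -(size_map size k1) nth_mid.
have Enth : nth [::] (full Kz) (size A) = emb f Kc.
  rewrite /full /embs Efr EKz zip_cat ?size_map //= map_cat /= EA EA1 -catA cat_cons.
  have szz : size (zip (unzip1 zs) k1) = size zs by rewrite size_zip size_map sz1 minnn.
  rewrite size_cat !size_map catA.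
  rewrite (_ : size h1s + size zs = size ([seq iota 1 h | h <- h1s] ++ [seq emb t.1 t.2 | t <- zip (unzip1 zs) k1])) ?nth_mid //.
  by rewrite size_cat !size_map szz.
move=> /(raised_stuck iC); rewrite {1}/ent Enth.
have fin : f \in fr by rewrite Efr mem_cat mem_head orbT.
have fP := allP frP _ fin.
have KP : all (fun x => 0 < x <= 4) K by apply: (allP rK); rewrite EKs mem_cat mem_head orbT.
have KcP : all (fun x => 0 < x <= 4) Kc by apply: (allP rKz); rewrite EKz mem_cat mem_head orbT.
move: iC; rewrite EC [emb]lock /= -lock /emb /= !mem_cat => iC.
rewrite index_cat; case: ifP iC => [if1 _|_ /= iC].
  by rewrite nth_cat index_mem if1 nth_index // ltnn.
rewrite nth_catr index_cat size_map.
case: ifP iC => [/mapP[x xK Ei] _|_ /= if2]; last first.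
  by rewrite szc -(size_map (addn p) Kc) nth_catr nth_index // ltnn.
rewrite Ei (index_map (@addnI p)) nth_cat size_map -szc index_mem xK.
have lt_x : index x K < size Kc by rewrite -szc index_mem.
rewrite (nth_map 0) // ltn_add2l => lt_xc.
(* The letter ends strictly larger and still among the four core letters, so the operator is one of
   those of type A_3. *)
have x3 : 0 < x <= 3.
  have x4 : 0 < x <= 4 := allP KP _ xK.
  have c4 : 0 < nth 0 Kc (index x K) <= 4 := allP KcP _ (mem_nth 0 lt_x).
  by lia.
exists (unzip2 zs ++ raise x K :: unzip2 zs').
  rewrite /full /embs Efr zip_cat ?size_map //= !zip_unzip map_cat /= -raise_emb //.
  by rewrite EA EB -EA1 -EB1 -!catA.
have sub1 : {subset unzip1 zs <= fr} by move=> g gin; rewrite Efr mem_cat gin.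
have sub2 : {subset unzip1 zs' <= fr}.
  by move=> g gin; rewrite Efr mem_cat in_cons gin !orbT.
rewrite EKs; apply: CStep => //.
- by move: riC; rewrite EC Ei rp_emb.
- move=> j; rewrite /unzip2 -map_drop -/(unzip2 _).
  have subd : {subset unzip1 (drop j zs) <= fr}.
    by move=> g; rewrite /unzip1 map_drop => /mem_drop; apply: sub1.
  rewrite -(count_embs subd (fun f K fP => lp_emb K fP x3)).
  rewrite -(count_embs subd (fun f K fP => rp_emb K fP x3)) map_drop -EA1 -Ei.
  by move: okA; rewrite EA => /okL_cat; apply.
move=> j; rewrite /unzip2 -map_take -/(unzip2 _).
have subt : {subset unzip1 (take j zs') <= fr}.
  by move=> g; rewrite /unzip1 map_take => /mem_take; apply: sub2.
rewrite -(count_embs subt (fun f K fP => lp_emb K fP x3)).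
rewrite -(count_embs subt (fun f K fP => rp_emb K fP x3)) map_take -EB1 -Ei.
by move: okB; rewrite EB => /okR_cat; apply.
Qed.

Lemma full_path Ks M Kz : size fr = size Ks -> map size Ks = map size Kz ->
  all (all (fun x => 0 < x <= 4)) Ks -> all (all (fun x => 0 < x <= 4)) Kz ->
  clos_refl_trans _ (cstep n) (full Ks) M -> clos_refl_trans _ (cstep n) M (full Kz) ->
  exists Km, [/\ M = full Km, clos_refl_trans _ (cstep 3) Ks Km,
     map size Ks = map size Km & all (all (fun x => 0 < x <= 4)) Km].
Proof.
move=> sz szK rK rKz c cM; have {c} := clos_rt_rt1n _ _ _ _ c.
move EX: (full Ks) => X c; elim: c Ks sz szK rK EX cM => {X M} [X|X Y M XY YM IH] Ks sz szK rK EX cM.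
  by exists Ks; split=> //; apply: rt_refl.
rewrite -EX in XY.
have cY : clos_refl_trans _ (cstep n) Y (full Kz).
  by apply: rt_trans cM; apply: clos_rt1n_rt.
have [Ks' EY st] := full_cstep_inv sz szK rK rKz XY cY.
have [sz' rK'] := cstep_shape st rK.
have szf : size fr = size Ks' by rewrite sz -(size_map size Ks) sz' size_map.
have [Km [EM cKm szm rm]] := IH Ks' szf (etrans (esym sz') szK) rK' (esym EY) cM.
exists Km; split=> //; last by rewrite sz'.
exact: rt_trans (rt_step _ _ _ _ st) cKm.
Qed.

End Core.

(** * Finite search for bow-ties *)

Definition tot (Cs : seq (seq nat)) : nat := sumn (map sumn Cs).

Lemma cstep_tot n Cs Cs' : cstep n Cs Cs' -> tot Cs < tot Cs'.
Proof.
case=> i A C B _ /andP[iC _] _ _; rewrite /tot !map_cat !sumn_cat /= ltn_add2l ltn_add2r.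
elim: C iC => //= c C IH; rewrite in_cons eq_sym; case: eqP => [-> _|_ /= /IH]; last by lia.
suff : sumn C <= sumn (raise i C) by rewrite /raise; lia.
by elim: C {IH} => //= d C IH; case: eqP; lia.
Qed.

Lemma clos_tot n Cs Cs' : clos_refl_trans _ (cstep n) Cs Cs' -> tot Cs <= tot Cs'.
Proof.
elim=> {Cs Cs'} [X Y /cstep_tot/ltnW|//|X Y Z _ XY _ YZ] //; exact: leq_trans XY YZ.
Qed.

(** Each step increases [tot], so no chain from [Cs] to [Cs'] is longer than the difference of the
    sums, and a search to depth [k] finds every chain. *)
Lemma upset_complete n k Cs Cs' : clos_refl_trans _ (cstep n) Cs Cs' ->
  tot Cs' <= tot Cs + k -> Cs' \in upset n k Cs.
Proof.
move=> c le_k; have {c} := clos_rt_rtn1 _ _ _ _ c => c.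
suff [i in_i le_i] : exists2 i, Cs' \in iter i (next_level n) [:: Cs] & tot Cs + i <= tot Cs'.
  by apply/mem_upset; exists i => //; lia.
elim: c {le_k} => {Cs'} [|Y Z YZ CY [i in_i le_i]]; first by exists 0; rewrite ?mem_head ?addn0.
exists i.+1; last by have := cstep_tot YZ; lia.
rewrite /= mem_undup; apply/flattenP; exists (nexts n Y); last exact/mem_nexts.
exact: map_f.
Qed.

(** A computable test; the bounds on [tot] make the searches to depth [k] exhaustive for elements in
    between. *)
Definition bowtie (n k : nat) (x y z w : seq (seq nat)) : bool :=
  [&& tot z <= tot x + k, tot z <= tot y + k, tot w <= tot x + k,
      all (fun u => (z \in upset n k u) && (w \in upset n k u)) [:: x; y] &
      all (fun m => (m \in upset n k y) ==>
             ~~ ((z \in upset n k m) && (w \in upset n k m))) (upset n k x)].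

Lemma bowtieP n k x y z w : bowtie n k x y z w ->
  [/\ clos_refl_trans _ (cstep n) x z, clos_refl_trans _ (cstep n) x w,
      clos_refl_trans _ (cstep n) y z, clos_refl_trans _ (cstep n) y w &
      forall m, clos_refl_trans _ (cstep n) x m -> clos_refl_trans _ (cstep n) y m ->
        clos_refl_trans _ (cstep n) m z -> clos_refl_trans _ (cstep n) m w -> False].
Proof.
case/and5P=> xz yz xw /and3P[/andP[/upset_reach zx /upset_reach wx]
  /andP[/upset_reach zy /upset_reach wy] _] /allP nom; split=> // m xm ym mz mw.
have tx := clos_tot xm; have ty := clos_tot ym; have tz := clos_tot mz; have tw := clos_tot mw.
have /nom : m \in upset n k x by apply: upset_complete => //; lia.
by rewrite !upset_complete //; lia.
Qed.

Lemma sorted_colle_cat X Y : sorted colle X -> sorted colle Y ->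
  (forall C D, C \in X -> D \in Y -> colle C D) -> sorted colle (X ++ Y).
Proof.
rewrite !(sorted_pairwise colle_trans) pairwise_cat => -> -> XY; rewrite !andbT.
by apply/allrelP.
Qed.

Lemma corecol_emb n p f K : p + 3 <= n -> frozen n p f -> corecol K ->
  sorted ltn (emb p f K) /\ all (fun x => 0 < x <= n.+1) (emb p f K).
Proof.
move=> p_le /and4P[s1 s2 a1 a2] /andP[sK aK]; split.
  rewrite /emb !(sorted_pairwise ltn_trans) !pairwise_cat -!(sorted_pairwise ltn_trans).
  rewrite s1 s2 (_ : sorted ltn (map (addn p) K)); last first.
    by rewrite sorted_map; apply: sub_sorted sK => x y /=; rewrite ltn_add2l.
  rewrite /= !andbT; apply/andP; split; apply/allrelP => x y.
    move=> /(allP a1) x1; rewrite mem_cat => /orP[/mapP[z /(allP aK) z1 ->]|/(allP a2)]; lia.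
  by move=> /mapP[z /(allP aK) z1 ->] /(allP a2); lia.
rewrite /emb !all_cat; apply/and3P; split.
- by apply: sub_all a1 => x; lia.
- by apply/allP => x /mapP[z /(allP aK) z1 ->]; lia.
- by apply: sub_all a2 => x; lia.
Qed.

Section NotLattice.

Variables (n p : nat) (h1s ch h2s : seq nat) (fr : seq (seq nat * seq nat)).
Hypothesis p_le : p + 3 <= n.
Hypothesis frP : all (frozen n p) fr.
Hypothesis hsS : sorted geq (h1s ++ ch ++ h2s).
Hypothesis hsN : all (geq n) (h1s ++ ch ++ h2s).

(** [1..h] lies to the left of every column of height at most [h], and [n+2-h..n+1] to the right of
    every column of height at least [h]. Only comparisons inside the core remain as hypotheses. *)
Lemma full_valid Ks : size fr = size Ks -> all corecol Ks ->
  map size (embs p fr Ks) = ch -> sorted colle (embs p fr Ks) ->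
  cvalid n (h1s ++ ch ++ h2s) (full n p h1s h2s fr Ks).
Proof.
move=> sz cK szE cE.
have EE D : D \in embs p fr Ks -> [/\ sorted ltn D, all (fun x => 0 < x <= n.+1) D & size D \in ch].
  move=> Din; have szD : size D \in ch by rewrite -szE map_f.
  case/mapP: Din szD => t tin -> szD.
  have fin : t.1 \in fr by rewrite -[fr](@unzip1_zip _ _ _ Ks) ?sz // map_f.
  have kin : t.2 \in Ks by rewrite -[Ks](@unzip2_zip _ _ fr) ?sz // map_f.
  by have [] := corecol_emb p_le (allP frP _ fin) (allP cK _ kin).
have geqT : transitive geq by move=> a b c /=; lia.
have := hsS; rewrite (sorted_pairwise geqT) !pairwise_cat -!(sorted_pairwise geqT).
case/and3P=> /allrelP h1R s1 /and3P[/allrelP c2 _ s2].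
move: hsN; rewrite !all_cat => /and3P[/allP n1 /allP nc /allP n2].
have hwP h : h <= n -> [/\ sorted ltn (iota 1 h), all (ltn 0) (iota 1 h) & all (geq n.+1) (iota 1 h)].
  move=> le_h; split; first exact: iota_ltn_sorted.
    by apply/allP => x; rewrite mem_iota /=; lia.
  by apply/allP => x; rewrite mem_iota /=; lia.
have lwP h : h <= n -> [/\ sorted ltn (iota (n.+2 - h) h), all (ltn 0) (iota (n.+2 - h) h) &
    all (geq n.+1) (iota (n.+2 - h) h)].
  move=> le_h; split; first exact: iota_ltn_sorted.
    by apply/allP => x; rewrite mem_iota /=; lia.
  by apply/allP => x; rewrite mem_iota /=; lia.
have EEl D : all (fun x => 0 < x <= n.+1) D -> all (ltn 0) D.
  by apply: sub_all => x /andP[].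
have EEr D : all (fun x => 0 < x <= n.+1) D -> all (geq n.+1) D.
  by apply: sub_all => x /andP[].
split.
- rewrite /full !map_cat szE -!map_comp; congr (_ ++ _ ++ _).
    by rewrite -[RHS]map_id; apply: eq_map => h /=; rewrite size_iota.
  by rewrite -[RHS]map_id; apply: eq_map => h /=; rewrite size_iota.
- rewrite /full !all_cat; apply/and3P; split; apply/allP.
  + by move=> C /mapP[h /n1 /= le_h ->]; apply/allP => x; rewrite mem_iota; lia.
  + by move=> D /EE[].
  + by move=> C /mapP[h /n2 /= le_h ->]; apply/allP => x; rewrite mem_iota; lia.
- rewrite /full !all_cat; apply/and3P; split; apply/allP.
  + by move=> C /mapP[h /n1 /= le_h ->]; apply: iota_ltn_sorted.
  + by move=> D /EE[].
  + by move=> C /mapP[h /n2 /= le_h ->]; apply: iota_ltn_sorted.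
rewrite /full; apply: sorted_colle_cat; [|apply: sorted_colle_cat => //|].
- have al : all (geq n) h1s by apply/allP.
  apply: homo_sorted_in al s1 => h h' /= le_h le_h' le_hh'.
  by have [? ? _] := hwP _ le_h'; apply: colle_iota_l; rewrite ?size_iota.
- have al : all (geq n) h2s by apply/allP.
  apply: homo_sorted_in al s2 => h h' /= le_h le_h' le_hh'.
  by have [? _ ?] := lwP _ le_h; apply: colle_iota_r; rewrite ?size_iota // ltnW.
- move=> C D /EE[sC rC szC] /mapP[h h2 ->]; apply: colle_iota_r => //; first exact: EEr.
    exact: c2.
  exact: leq_trans (n2 _ h2) (leqnSn n).
move=> C D /mapP[h h1 ->]; rewrite mem_cat => /orP[/EE[sD rD szD]|/mapP[h' h2 ->]].
  apply: colle_iota_l => //; first exact: EEl.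
  by apply: h1R; rewrite ?mem_cat ?szD.
have [? ? _] := lwP _ (n2 _ h2); apply: colle_iota_l => //.
by rewrite size_iota; apply: h1R; rewrite ?mem_cat ?h2 ?orbT.
Qed.

Lemma embs_inj Ks Ks' : size fr = size Ks -> map size Ks = map size Ks' ->
  embs p fr Ks = embs p fr Ks' -> Ks = Ks'.
Proof.
rewrite /embs; elim: fr Ks Ks' => [|f fr' IH] [|K Ks] [|K' Ks'] //= [sz] [szK szKs] [E Es].
congr (_ :: _); last exact: IH.
move/eqP: E; rewrite /emb eqseq_cat // eqxx eqseq_cat ?size_map // eqxx andbT => /eqP.
exact/inj_map/addnI.
Qed.

Lemma full_inj Ks Ks' : size fr = size Ks -> map size Ks = map size Ks' ->
  full n p h1s h2s fr Ks = full n p h1s h2s fr Ks' -> Ks = Ks'.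
Proof.
move=> sz szK /eqP; rewrite /full eqseq_cat // eqxx eqseq_cat; last first.
  by rewrite !size_map !size_zip -(size_map size Ks) szK size_map.
by case/and3P=> _ /eqP E _; apply: embs_inj E.
Qed.

(** An element between the two pairs has the form [full] when seen from [Kx] and again when seen
    from [Ky]. Injectivity of [full] identifies the two cores, and this core would lie inside the
    bow-tie. *)
Lemma core_not_lattice k Kx Ky Kz Kw :
  bowtie 3 k Kx Ky Kz Kw ->
  [&& size Kx == size fr, map size Ky == map size Kx, map size Kz == map size Kx,
      all corecol Kx & all corecol Ky] ->
  map size (embs p fr Kx) = ch -> map size (embs p fr Ky) = ch ->
  sorted colle (embs p fr Kx) -> sorted colle (embs p fr Ky) ->
  ~ clattice n (h1s ++ ch ++ h2s).
Proof.
move=> /bowtieP[xz xw yz yw nom] /and5P[/eqP/esym szx /eqP Eyx /eqP Ezx cx cy] shx shy sx sy L.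
have szy : size fr = size Ky by rewrite szx -(size_map size Kx) -Eyx size_map.
have step X Y : size fr = size X -> clos_refl_trans _ (cstep 3) X Y ->
    clos_refl_trans _ (cstep n) (full n p h1s h2s fr X) (full n p h1s h2s fr Y).
  move=> szX c; apply: (clos_mono (P := fun X => size fr = size X) _ szX c).2 => A B szA st.
  split; last exact: full_cstep.
  by case: st szA => i A' C B' _ _ _ _; rewrite !size_cat.
have vx := full_valid szx cx shx sx; have vy := full_valid szy cy shy sy.
have vstep X Y : cvalid n (h1s ++ ch ++ h2s) X -> clos_refl_trans _ (cstep n) X Y ->
    cvalid n (h1s ++ ch ++ h2s) Y.
  move=> vX c.
  apply: (clos_mono (P := cvalid n (h1s ++ ch ++ h2s)) (sB := cstep n) (f := id) _ vX c).1.
  by move=> A B vA st; split=> //; apply: cstep_valid st.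
have sxz := step _ _ szx xz; have sxw := step _ _ szx xw.
have syz := step _ _ szy yz; have syw := step _ _ szy yw.
have [m [_ xm ym mz mw]] := lattice_no_bowtie L vx vy (vstep _ _ vx sxz) (vstep _ _ vx sxw) sxz sxw syz syw.
have rng X : all corecol X -> all (all (fun x => 0 < x <= 4)) X.
  by apply: sub_all => K /andP[].
have shape X Y : clos_refl_trans _ (cstep 3) X Y -> all (all (fun x => 0 < x <= 4)) X ->
    map size X = map size Y /\ all (all (fun x => 0 < x <= 4)) Y.
  elim=> {X Y} [X Y /cstep_shape|//|X Y Z _ XY _ YZ rX]; first exact.
  by have [-> /YZ] := XY rX.
have [Exz rz] := shape _ _ xz (rng _ cx); have [Exw rw] := shape _ _ xw (rng _ cx).
have [m1 [Em xm1 szm1 rm1]] := full_path p_le frP szx Exz (rng _ cx) rz xm mz.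
have [m2 [Em2 ym2 szm2 rm2]] := full_path p_le frP szy (etrans Eyx Exz) (rng _ cy) rz ym mz.
have szm : size fr = size m1 by rewrite szx -(size_map size Kx) szm1 size_map.
have E12 : m1 = m2.
  by apply: full_inj => //; [rewrite -szm1 -szm2 | rewrite -Em -Em2].
have low K : map size Kx = map size K -> all (all (fun x => 0 < x <= 4)) K ->
    clos_refl_trans _ (cstep n) m (full n p h1s h2s fr K) -> clos_refl_trans _ (cstep 3) m1 K.
  move=> EK rK; rewrite Em => c.
  have [K' [EK' c' sK' _]] := full_path p_le frP szm (etrans (esym szm1) EK) rm1 rK c (rt_refl _ _ _).
  rewrite (full_inj _ _ EK') //; first by rewrite szx -(size_map size Kx) EK size_map.
  by rewrite -EK szm1.
by apply: (nom m1) => //; [rewrite E12 | exact: low | exact: low].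
Qed.

End NotLattice.

Lemma colle_refl : reflexive colle.
Proof. by move=> C; apply/colleP. Qed.

Lemma colle_cat C D b b' : size C = size D -> colle C D -> colle b b' ->
  colle (C ++ b) (D ++ b').
Proof.
move=> sz /colleP[_ CD] /colleP[szb bb]; apply/colleP; rewrite !size_cat sz leq_add2l.
split=> // r lt_r; rewrite !nth_cat sz; case: ltnP => [/CD //|le_r].
by apply: bb; lia.
Qed.

Lemma colle_catr C D b : colle C D -> colle (C ++ b) D.
Proof.
move=> /colleP[sz CD]; apply/colleP; rewrite size_cat (leq_trans sz) ?leq_addr //.
by split=> // r lt_r; rewrite nth_cat (leq_trans lt_r sz) CD.
Qed.

Lemma colle_map p C D : colle C D -> colle (map (addn p) C) (map (addn p) D).
Proof.
move=> /colleP[sz CD]; apply/colleP; rewrite !size_map; split=> // r lt_r.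
by rewrite !(nth_map 0) ?leq_add2l ?CD // (leq_trans lt_r).
Qed.

Lemma colle_iota x a b : b <= a -> colle (iota x a) (iota x b).
Proof.
move=> le_ba; apply/colleP; rewrite !size_iota; split=> // r lt_r.
by rewrite !nth_iota // (leq_trans lt_r).
Qed.

Lemma frozenI n p s a x b : s + a <= p.+1 -> p + 4 < x -> x + b <= n.+2 -> 0 < s ->
  frozen n p (iota s a, iota x b).
Proof.
move=> le_a lt_x le_b s_gt0; apply/and4P; split; try exact: iota_ltn_sorted.
  by apply/allP => y; rewrite mem_iota /=; lia.
by apply/allP => y; rewrite mem_iota /=; lia.
Qed.

(** * The obstructed sequences of column heights *)

Section Bad.

Variables (n : nat) (h1s h2s : seq nat).

Notation heights ch := (sorted geq (h1s ++ ch ++ h2s) && all (geq n) (h1s ++ ch ++ h2s)).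

(** Core heights 2, 2. The letters [1..j-2] on top of both columns and [j+3..i+2] at the bottom of
    the first one fill up the heights; [i < n] leaves room for [i+2]. Here and in the later
    configurations [Kx] and [Ky] have the same sum of entries, and those of [Kz] and [Kw] exceed it
    by at most 3, whence [k]. *)
Lemma not_lattice_22 i j : 1 < j <= i -> i < n -> heights [:: i; j] ->
  ~ clattice n (h1s ++ [:: i; j] ++ h2s).
Proof.
move=> ij i_n /andP[S N].
have p3 : j - 2 + 3 <= n by lia.
pose s := iota 1 (j - 2); pose b := iota (j + 3) (i - j).
(* [iota n.+2 0] is the empty list, in the form to which [frozenI] applies. *)
have fr : all (frozen n (j - 2)) [:: (s, b); (s, iota n.+2 0)].
  by apply/and3P; split=> //; apply: frozenI; lia.
apply: (core_not_lattice p3 fr S N (k := 3) (Kx := [:: [:: 1; 2]; [:: 1; 4]])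
  (Ky := [:: [:: 1; 2]; [:: 2; 3]]) (Kz := [:: [:: 1; 2]; [:: 2; 4]])
  (Kw := [:: [:: 1; 3]; [:: 2; 4]])) => //.
- by rewrite /= !size_cat /= !size_iota; congr [:: _; _]; lia.
- by rewrite /= !size_cat /= !size_iota; congr [:: _; _]; lia.
- by rewrite /= andbT colle_cat ?colle_refl // cats0 colle_catr // colle_map.
- by rewrite /= andbT colle_cat ?colle_refl // cats0 colle_catr // colle_map.
Qed.

(** Core heights 3, 1, 1, with [5..m+1] frozen at the bottom of the first column. *)
Lemma not_lattice_311 m : 2 < m <= n -> heights [:: m; 1; 1] ->
  ~ clattice n (h1s ++ [:: m; 1; 1] ++ h2s).
Proof.
move=> m_n /andP[S N].
have p3 : 0 + 3 <= n by lia.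
have fr : all (frozen n 0) [:: ([::], iota 5 (m - 3)); ([::], [::]); ([::], [::])].
  by apply/and4P; split=> //; apply: (@frozenI n 0 1 0); lia.
apply: (core_not_lattice p3 fr S N (k := 3) (Kx := [:: [:: 1; 2; 4]; [:: 1]; [:: 3]])
  (Ky := [:: [:: 1; 2; 3]; [:: 1]; [:: 4]]) (Kz := [:: [:: 1; 3; 4]; [:: 1]; [:: 4]])
  (Kw := [:: [:: 1; 2; 4]; [:: 3]; [:: 4]])) => //.
- by rewrite /= size_iota; congr [:: _; _; _]; lia.
- by rewrite /= size_iota; congr [:: _; _; _]; lia.
Qed.

(** Core heights 3, 3, 1 on the letters [m..m+3]. A column of height [n] misses exactly one letter;
    freezing [1..m-1] and [m+4..n+1] in both long columns keeps the missing letter inside the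
    core. *)
Lemma not_lattice_331 m : 0 < m -> m.+1 < n -> heights [:: n; n; m] ->
  ~ clattice n (h1s ++ [:: n; n; m] ++ h2s).
Proof.
move=> m_gt0 m_n /andP[S N].
have p3 : m.-1 + 3 <= n by lia.
pose s := iota 1 m.-1; pose b := iota (m + 4) (n - m - 2).
have fr : all (frozen n m.-1) [:: (s, b); (s, b); (s, iota n.+2 0)].
  by apply/and4P; split=> //; apply: frozenI; lia.
apply: (core_not_lattice p3 fr S N (k := 3)
  (Kx := [:: [:: 1; 2; 3]; [:: 1; 3; 4]; [:: 2]])
  (Ky := [:: [:: 1; 2; 3]; [:: 1; 2; 4]; [:: 3]])
  (Kz := [:: [:: 1; 2; 3]; [:: 2; 3; 4]; [:: 3]])
  (Kw := [:: [:: 1; 2; 4]; [:: 2; 3; 4]; [:: 3]])) => //.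
- by rewrite /= !size_cat /= !size_iota; congr [:: _; _; _]; lia.
- by rewrite /= !size_cat /= !size_iota; congr [:: _; _; _]; lia.
- rewrite /= andbT; apply/andP; split.
    by rewrite colle_cat ?colle_refl // colle_cat ?colle_refl // colle_map.
  by rewrite colle_cat ?colle_refl // cats0 colle_catr // colle_map.
- rewrite /= andbT; apply/andP; split.
    by rewrite colle_cat ?colle_refl // colle_cat ?colle_refl // colle_map.
  by rewrite colle_cat ?colle_refl // cats0 colle_catr // colle_map.
Qed.

(** The middle column selects the configuration. For [m <= n-2] it takes one core letter and the
    [m-1] largest letters, which all exceed 4, and the core heights are 3, 1, 1. For [m = n-1] it
    takes three core letters, possible since [n > 3], and the core heights are 3, 3, 1. *)
Lemma not_lattice_n_m_1 m : 3 < n -> 1 < m < n -> heights [:: n; m; 1] ->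
  ~ clattice n (h1s ++ [:: n; m; 1] ++ h2s).
Proof.
move=> n4 m_n /andP[S N].
have p3 : 0 + 3 <= n by lia.
case: (ltnP m.+1 n) => [m_n2|m_n1].
  have fr : all (frozen n 0)
      [:: ([::], iota 5 (n - 3)); ([::], iota (n + 3 - m) m.-1); ([::], [::])].
    by apply/and4P; split=> //; apply: (@frozenI n 0 1 0); lia.
  have col (a c d : nat) : 0 < a <= c -> c <= 2 -> d <= 4 ->
      colle ([:: 0 + a; 0 + c; 0 + d] ++ iota 5 (n - 3)) ((0 + a) :: iota (n + 3 - m) m.-1).
    move=> ac c2 d4; apply/colleP; rewrite /= !size_iota; split=> [|r]; first by lia.
    case: r => [|[|[|r]]] //= lt_r; rewrite !nth_iota; lia.
  apply: (core_not_lattice p3 fr S N (k := 3) (Kx := [:: [:: 1; 2; 4]; [:: 1]; [:: 3]])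
    (Ky := [:: [:: 1; 2; 3]; [:: 1]; [:: 4]]) (Kz := [:: [:: 1; 3; 4]; [:: 1]; [:: 4]])
    (Kw := [:: [:: 1; 2; 4]; [:: 3]; [:: 4]])) => //.
  - by rewrite /= !size_iota; congr [:: _; _; _]; lia.
  - by rewrite /= !size_iota; congr [:: _; _; _]; lia.
  - by apply/andP; split; first exact: col.
  - by apply/andP; split; first exact: col.
have fr : all (frozen n 0)
    [:: ([::], iota 5 (n - 3)); ([::], iota 5 (n - 4)); ([::], [::])].
  by apply/and4P; split=> //; apply: (@frozenI n 0 1 0); lia.
apply: (core_not_lattice p3 fr S N (k := 3)
  (Kx := [:: [:: 1; 2; 3]; [:: 1; 3; 4]; [:: 2]])
  (Ky := [:: [:: 1; 2; 3]; [:: 1; 2; 4]; [:: 3]])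
  (Kz := [:: [:: 1; 2; 3]; [:: 2; 3; 4]; [:: 3]])
  (Kw := [:: [:: 1; 2; 4]; [:: 2; 3; 4]; [:: 3]])) => //.
- by rewrite /= !size_iota; congr [:: _; _; _]; lia.
- by rewrite /= !size_iota; congr [:: _; _; _]; lia.
- by apply/and3P; split=> //; apply: (@colle_cat [:: _; _; _] [:: _; _; _]) => //; apply: colle_iota; lia.
- by apply/and3P; split=> //; apply: (@colle_cat [:: _; _; _] [:: _; _; _]) => //; apply: colle_iota; lia.
Qed.

(** For [n = 3] the heights 3, 2, 1 alone give a lattice, so the bow-ties here and in
    [not_lattice_3321] use a fourth column. *)
Lemma not_lattice_3211 : n = 3 -> heights [:: 3; 2; 1; 1] ->
  ~ clattice n (h1s ++ [:: 3; 2; 1; 1] ++ h2s).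
Proof.
move=> n3 /andP[S N].
have p3 : 0 + 3 <= n by lia.
have fr : all (frozen n 0) (nseq 4 ([::], [::])) by [].
by apply: (core_not_lattice p3 fr S N (k := 3)
  (Kx := [:: [:: 1; 2; 4]; [:: 1; 2]; [:: 1]; [:: 3]])
  (Ky := [:: [:: 1; 2; 3]; [:: 1; 2]; [:: 1]; [:: 4]])
  (Kz := [:: [:: 1; 2; 4]; [:: 1; 3]; [:: 1]; [:: 4]])
  (Kw := [:: [:: 1; 2; 4]; [:: 1; 2]; [:: 3]; [:: 4]])).
Qed.

Lemma not_lattice_3321 : n = 3 -> heights [:: 3; 3; 2; 1] ->
  ~ clattice n (h1s ++ [:: 3; 3; 2; 1] ++ h2s).
Proof.
move=> n3 /andP[S N].
have p3 : 0 + 3 <= n by lia.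
have fr : all (frozen n 0) (nseq 4 ([::], [::])) by [].
by apply: (core_not_lattice p3 fr S N (k := 3)
  (Kx := [:: [:: 1; 2; 3]; [:: 1; 2; 4]; [:: 1; 3]; [:: 2]])
  (Ky := [:: [:: 1; 2; 3]; [:: 1; 2; 4]; [:: 1; 2]; [:: 3]])
  (Kz := [:: [:: 1; 2; 3]; [:: 1; 2; 4]; [:: 2; 3]; [:: 3]])
  (Kw := [:: [:: 1; 2; 4]; [:: 1; 2; 4]; [:: 2; 3]; [:: 3]])).
Qed.

End Bad.

(** * Column heights without obstruction *)

Lemma heights_split n hs : 1 < n -> sorted geq hs -> all (fun h => 0 < h <= n) hs ->
  exists c mid a, [/\ hs = nseq c n ++ mid ++ nseq a 1, all (fun h => 1 < h < n) mid & sorted geq mid].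
Proof.
move=> n_gt1; elim: hs => [|h hs IH] /= s_hs; first by exists 0, [::], 0.
case/andP=> h_n a_hs.
have geqT : transitive geq by move=> a b c /=; lia.
have le_h := order_path_min geqT s_hs.
have [c [mid [a [E am sm]]]] := IH (path_sorted s_hs) a_hs.
case: (eqVneq h n) => [->|hn]; first by exists c.+1, mid, a; rewrite E.
have c0 : c = 0.
  by case: c E => // c E; move: le_h; rewrite E /=; lia.
rewrite {c}c0 /= in E; case: (eqVneq h 1) => [h1|h1].
  case: mid E am sm => [|m mid] E am sm; first by exists 0, [::], a.+1; rewrite E h1.
  by move: le_h am; rewrite E h1 /=; lia.
exists 0, (h :: mid), a; rewrite E; split=> //=.
  by rewrite am andbT; lia.
by move: s_hs; rewrite E cat_path => /andP[].
Qed.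

Lemma nseq_shift (T : Type) k (x : T) s : nseq k x ++ x :: s = x :: nseq k x ++ s.
Proof. by elim: k => //= k ->. Qed.

(** Two heights strictly between 1 and [n] are excluded, so [hs] consists of [c] copies of [n], at
    most one intermediate height, and [a] copies of 1. The remaining obstructions restrict [c] and
    [a]. *)
Lemma clattice_heights n hs : 2 < n -> sorted geq hs -> all (fun h => 0 < h <= n) hs ->
  clattice n hs ->
  (exists c, hs = nseq c n) \/ (exists a, hs = nseq a 1) \/
  (exists m, [/\ 0 < m <= n & hs = [:: m]]) \/
  (exists m, [/\ 1 < m <= n & hs = [:: m; 1]]) \/
  (exists m, [/\ 0 < m < n & hs = [:: n; m]]) \/
  (exists a, hs = 2 :: nseq a 1) \/ (exists c, hs = nseq c n ++ [:: n.-1]) \/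
  (n = 3 /\ hs = [:: 3; 2; 1]).
Proof.
move=> n3 s_hs a_hs; have n2 : 1 < n by lia.
have N : all (geq n) hs by apply: sub_all a_hs => h /andP[].
have bad h1 ch h2 : h1 ++ ch ++ h2 = hs ->
    (sorted geq (h1 ++ ch ++ h2) && all (geq n) (h1 ++ ch ++ h2) ->
     ~ clattice n (h1 ++ ch ++ h2)) -> ~ clattice n hs.
  by move=> ->; rewrite s_hs N; apply.
have [c [mid [a [E am sm]]]] := heights_split n2 s_hs a_hs.
case: mid E am sm => [|m1 [|m2 mid]] /= E.
- move=> _ _; case: c a E => [|c] [|[|a]] E L.
  + by left; exists 0.
  + by right; left; exists 1.
  + by right; left; exists a.+2.
  + by left; exists c.+1; rewrite E cats0.
  + case: c E => [|c] E.
      by right; right; right; left; exists n; rewrite E; split=> //; lia.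
    case: (bad (nseq c n) [:: n; n; 1] [::] _ _ L); first by rewrite E /= !nseq_shift.
    by apply: not_lattice_331; lia.
  + case: (bad (nseq c n) [:: n; 1; 1] (nseq a 1) _ _ L); first by rewrite E /= !nseq_shift.
    by apply: not_lattice_311; lia.
- rewrite andbT => m_n _ L; case: c a E => [|c] [|a] E.
  + by right; right; left; exists m1; rewrite E; split=> //; lia.
  + case: a E => [|a] E.
      by right; right; right; left; exists m1; rewrite E; split=> //; lia.
    case: (eqVneq m1 2) => [m2|m2].
      by do 5 right; left; exists a.+2; rewrite E m2.
    case: (bad [::] [:: m1; 1; 1] (nseq a 1) _ _ L); first by rewrite E.
    by apply: not_lattice_311; lia.
  + case: c E => [|c] E.
      by do 4 right; left; exists m1; rewrite E; split=> //; lia.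
    case: (eqVneq m1 n.-1) => [m2|m2].
      by do 6 right; left; exists c.+2; rewrite E m2.
    case: (bad (nseq c n) [:: n; n; m1] [::] _ _ L); first by rewrite E /= !nseq_shift.
    by apply: not_lattice_331; lia.
  + case: (ltnP 3 n) => [n4|n_le3].
      case: (bad (nseq c n) [:: n; m1; 1] (nseq a 1) _ _ L); first by rewrite E /= !nseq_shift.
      by apply: not_lattice_n_m_1.
    have {n_le3} n_3 : n = 3 by lia.
    have Em : m1 = 2 by lia.
    move: E; rewrite Em n_3; case: c a => [|c] [|a] E.
    * by do 7 right; rewrite E.
    * case: (bad [::] [:: 3; 2; 1; 1] (nseq a 1) _ _ L); first by rewrite E.
      exact: not_lattice_3211.
    * case: (bad (nseq c 3) [:: 3; 3; 2; 1] [::] _ _ L); first by rewrite E /= !nseq_shift.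
      exact: not_lattice_3321.
    * case: (bad (nseq c 3) [:: 3; 3; 2; 1] (nseq a.+1 1) _ _ L); first by rewrite E /= !nseq_shift.
      exact: not_lattice_3321.
move=> /and3P[m1n m2n _] /andP[m12 _] L.
case: (bad (nseq c n) [:: m1; m2] (mid ++ nseq a 1) _ _ L); first by rewrite E.
by apply: not_lattice_22; rewrite /= in m12 *; lia.
Qed.

(** * Lattice families *)

Definition incr (y : seq nat) (j : nat) : seq nat := set_nth 0 y j (nth 0 y j).+1.

Lemma nth_incr y j k : nth 0 (incr y j) k = if k == j then (nth 0 y j).+1 else nth 0 y k.
Proof. exact: nth_set_nth. Qed.

Lemma size_incr y j : j < size y -> size (incr y j) = size y.
Proof. by move=> lt_j; rewrite size_set_nth; apply/maxn_idPr. Qed.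

Lemma sumn_incr y j : sumn (incr y j) = (sumn y).+1.
Proof.
elim: y j => [|x y IH] [|j] //=; last by rewrite -[set_nth _ _ _ _]/(incr y j) IH addnS.
by elim: j => //= j; rewrite /incr nth_nil.
Qed.

Definition lev (N : nat) (y z : seq nat) : Prop := forall j, j < N -> nth 0 y j <= nth 0 z j.

Lemma sumn_lev N y z : size y = N -> size z = N -> lev N y z -> sumn y <= sumn z.
Proof.
elim: N y z => [|N IH] [|a y] [|b z] //= [sy] [sz] le.
apply: leq_add; first exact: (le 0).
by apply: IH => // j; apply: (le j.+1).
Qed.

Lemma lev_incr N y z j : j < N -> nth 0 y j < nth 0 z j -> lev N y z -> lev N (incr y j) z.
Proof. by move=> lt_j lt le k lt_k; rewrite nth_incr; case: eqP => [->|_] //; apply: le. Qed.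

Lemma lev_incr_self N y j : lev N y (incr y j).
Proof. by move=> k _; rewrite nth_incr; case: eqP => [->|]. Qed.

(** [g j] is the least difference between entries [j] and [j+1]. The constant 0 gives rows and the
    constant 1 gives columns; the hooks deviate from these at a single index. *)
Definition vec (M N : nat) (g : nat -> nat) (y : seq nat) : Prop :=
  [/\ size y = N, forall j, j < N -> 0 < nth 0 y j <= M &
      forall j, j.+1 < N -> nth 0 y j + g j <= nth 0 y j.+1].

Lemma vec_incr M N g y j : vec M N g y -> j < N -> nth 0 y j < M ->
  (j.+1 < N -> nth 0 y j + g j < nth 0 y j.+1) -> vec M N g (incr y j).
Proof.
move=> [sy ry gy] lt_j lt_M lt_g; split; first by rewrite size_incr sy.
  by move=> k lt_k; rewrite nth_incr; case: eqP => _; [rewrite lt_M | apply: ry].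
move=> k lt_k; rewrite !nth_incr; case: (eqVneq k j) => [Ek|nk].
  by rewrite Ek gtn_eqF // addSn lt_g // -Ek.
case: eqP => [Ek|_]; last exact: gy.
by rewrite -Ek; apply: leq_trans (gy _ lt_k) _.
Qed.

(** The last index where [y] is below [z] can be raised: the next entry of [y] has already reached
    that of [z], whose gap leaves room. *)
Lemma vec_progress M N g y z : vec M N g y -> vec M N g z -> lev N y z -> y <> z ->
  exists j, [/\ j < N, nth 0 y j < nth 0 z j & vec M N g (incr y j)].
Proof.
move=> vy vz le ne; have [sy ry gy] := vy; have [sz rz gz] := vz.
pose P j := (j < N) && (nth 0 y j < nth 0 z j).
have hP : has P (iota 0 N).
  apply/negPn/negP => /hasPn noP; apply: ne.
  apply: (@eq_from_nth _ 0); first by rewrite sy sz.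
  move=> j; rewrite sy => lt_j; apply/eqP; rewrite eqn_leq le //= leqNgt.
  by have := noP j; rewrite mem_iota /P lt_j => /(_ isT).
have exP : exists j, P j by case/hasP: hP => j _ Pj; exists j.
have ubP j : P j -> j <= N by case/andP=> /ltnW.
case: (ex_maxnP exP ubP) => j /andP[lt_j lt] maxj.
exists j; split=> //; apply: vec_incr => //.
  by apply: leq_trans lt _; case/andP: (rz _ lt_j).
move=> lt_j1; have le1 : nth 0 z j.+1 <= nth 0 y j.+1.
  by rewrite leqNgt; apply/negP => lt1; have := maxj j.+1; rewrite /P lt_j1 lt1 ltnn => /(_ isT).
by apply: leq_trans le1; apply: leq_trans (gz _ lt_j1); rewrite -addSn leq_add2r.
Qed.

Definition vmax (N : nat) (y z : seq nat) : seq nat :=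
  mkseq (fun j => maxn (nth 0 y j) (nth 0 z j)) N.

Lemma nth_vmax N y z j : j < N -> nth 0 (vmax N y z) j = maxn (nth 0 y j) (nth 0 z j).
Proof. exact: nth_mkseq. Qed.

Lemma vmax_vec M N g y z : vec M N g y -> vec M N g z -> vec M N g (vmax N y z).
Proof.
move=> [sy ry gy] [sz rz gz]; split; first exact: size_mkseq.
  by move=> j lt_j; rewrite nth_vmax //; have := ry _ lt_j; have := rz _ lt_j; lia.
move=> j lt_j; rewrite !nth_vmax //; last exact: ltnW.
by have := gy _ lt_j; have := gz _ lt_j; lia.
Qed.

Lemma lattice_vec (A : Type) (P : A -> Prop) (st : A -> A -> Prop) M N g enc bot :
  (forall y, vec M N g y -> P (enc y)) ->
  (forall a, P a -> exists2 y, vec M N g y & a = enc y) ->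
  injective enc ->
  vec M N g bot -> (forall y, vec M N g y -> lev N bot y) ->
  (forall y a, vec M N g y -> st (enc y) a ->
     exists j, [/\ j < N, vec M N g (incr y j) & a = enc (incr y j)]) ->
  (forall y j, vec M N g y -> j < N -> vec M N g (incr y j) -> st (enc y) (enc (incr y j))) ->
  lattice_on P (clos_refl_trans A st).
Proof.
move=> encP decP inj vbot lbot sound compl.
apply: (lattice_of_code (PX := vec M N g) (enc := enc) (R := lev N) (rk := sumn) (bot := bot)) => //.
- by move=> x y _ _ /inj.
- by move=> x _ j _.
- by move=> x y z _ _ _ xy yz j lt_j; apply: leq_trans (xy _ lt_j) (yz _ lt_j).
- by move=> x y [sx _ _] [sy _ _]; apply: sumn_lev.
- move=> x a vx /(sound _ _ vx)[j [lt_j vj ->]]; exists (incr x j); split=> //.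
    exact: lev_incr_self.
  by rewrite sumn_incr.
- move=> x y vx vy xy ne; have [j [lt_j lt vj]] := vec_progress vx vy xy ne.
  by exists (incr x j); split=> //; [exact: compl | exact: lev_incr].
move=> x y vx vy; exists (vmax N x y); split; first exact: vmax_vec.
- by move=> j lt_j; rewrite nth_vmax // leq_maxl.
- by move=> j lt_j; rewrite nth_vmax // leq_maxr.
by move=> u _ xu yu j lt_j; rewrite nth_vmax // geq_max xu // yu.
Qed.

Lemma okR_none i B : (forall C, C \in B -> ~~ rp i C) -> okR i B.
Proof.
move=> H j; rewrite (_ : count _ _ = 0) //; apply/eqP; rewrite -leqn0 leqNgt -has_count.
by apply/hasPn => C /mem_take/H.
Qed.

Lemma okL_none i A : (forall C, C \in A -> ~~ lp i C) -> okL i A.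
Proof.
move=> H j; rewrite (_ : count _ _ = 0) //; apply/eqP; rewrite -leqn0 leqNgt -has_count.
by apply/hasPn => C /mem_drop/H.
Qed.

Lemma okR_head i C B : okR i (C :: B) -> ~~ rp i C.
Proof.
move=> /(_ 1); rewrite /= take0 /= => H; apply/negP => rC.
by move: H; rewrite rC (rp_lp rC).
Qed.

Lemma okL_last i A C : okL i (rcons A C) -> ~~ lp i C.
Proof.
move=> /(_ (size A)); rewrite -cats1 drop_size_cat //= => H; apply/negP => lC.
by case/andP: (lC) H => iC siC; rewrite lC /rp (negPf siC).
Qed.

Lemma rp1 i x : rp i [:: x] = (x == i).
Proof. by rewrite /rp !inE eq_sym; case: eqP => //= ->; rewrite gtn_eqF. Qed.

Lemma lp1 i x : lp i [:: x] = (x == i.+1).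
Proof. by rewrite /lp !inE eq_sym; case: eqP => //= ->; rewrite ltn_eqF. Qed.

Lemma nth_sorted_leq y r s : sorted leq y -> r <= s < size y -> nth 0 y r <= nth 0 y s.
Proof.
move=> sy /andP[le_rs lt_s].
by apply: (sorted_leq_nth leq_trans leqnn) => //; rewrite inE //; apply: leq_ltn_trans lt_s.
Qed.

Lemma incr_mid s1 x s2 : incr (s1 ++ x :: s2) (size s1) = s1 ++ x.+1 :: s2.
Proof. by rewrite /incr set_nth_mid nth_mid. Qed.

Lemma vec0_sorted M N y : vec M N (fun=> 0) y <->
  [/\ size y = N, all (fun x => 0 < x <= M) y & sorted leq y].
Proof.
split=> -[sy ry gy]; split=> //.
- by apply/(all_nthP 0) => j; rewrite sy; apply: ry.
- by apply/(sortedP 0) => j; rewrite sy => /gy; rewrite addn0.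
- by move=> j; rewrite -sy => lt_j; apply: (all_nthP 0 ry).
- by move=> j; rewrite -sy addn0 => lt_j; apply: (sortedP 0 gy).
Qed.

Lemma vec1_sorted M N y : vec M N (fun=> 1) y <->
  [/\ size y = N, all (fun x => 0 < x <= M) y & sorted ltn y].
Proof.
split=> -[sy ry gy]; split=> //.
- by apply/(all_nthP 0) => j; rewrite sy; apply: ry.
- by apply/(sortedP 0) => j; rewrite sy => /gy; rewrite addn1.
- by move=> j; rewrite -sy => lt_j; apply: (all_nthP 0 ry).
- by move=> j; rewrite -sy addn1 => lt_j; apply: (sortedP 0 gy).
Qed.

(** One row, coded by its entries. The last [i] can always be raised: entries to its left are at
    most [i] and open nothing. So the steps are the increments that keep the row weakly
    increasing. *)
Lemma clattice_nseq1 n k : clattice n (nseq k 1).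
Proof.
pose enc := map (fun x : nat => [:: x]).
apply: (@lattice_vec _ _ _ n.+1 k (fun=> 0) enc (nseq k 1)).
- move=> y /vec0_sorted[sy ry gy]; split.
  + by rewrite -sy /enc; elim: y {sy ry gy} => //= x y ->.
  + by rewrite all_map; apply: sub_all ry => x /= ->.
  + by rewrite all_map; apply/allP.
  + apply: homo_sorted gy => a b /= le_ab; apply/colleP; split=> // -[|r] //.
- move=> Cs [sC rC _ lC]; exists (map (head 0) Cs).
    apply/vec0_sorted; split.
    + by rewrite size_map -(size_map size) sC size_nseq.
    + rewrite all_map; apply/allP => C CCs /=; have := allP rC _ CCs.
      have : size C \in nseq k 1 by rewrite -sC map_f.
      by rewrite mem_nseq => /andP[_]; case: C {CCs} => [|x [|]] //= _; rewrite andbT.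
    + have al : all (fun C => size C == 1) Cs.
        apply/allP => C CCs; have : size C \in nseq k 1 by rewrite -sC map_f.
        by rewrite mem_nseq => /andP[].
      apply: homo_sorted_in al lC => C D /=.
      by case: C D => [|x [|]] // [|x' [|]] //= _ _ /colleP[_ /(_ 0)]; apply.
  rewrite /enc -map_comp -[LHS]map_id; apply/eq_in_map => C CCs /=.
  have : size C \in nseq k 1 by rewrite -sC map_f.
  by rewrite mem_nseq => /andP[_]; case: C {CCs} => [|x [|]].
- by apply: inj_map => x y [].
- apply/vec0_sorted; split; first exact: size_nseq.
    by apply/allP => x; rewrite mem_nseq => /andP[_ /eqP->].
  by case: k => //= k; elim: k.
- by move=> y [_ ry _] j lt_j; rewrite nth_nseq lt_j; case/andP: (ry _ lt_j).
- move=> y a vy st; move EC: (enc y) st => Cs st.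
  case: st EC => i A C B i_n rC okA okB EC.
  have [s1 [x [s2 [Ey -> Ex EB]]]] := map_split EC.
  move: rC; rewrite Ex rp1 => /eqP Exi; exists (size s1).
  have [sy ry gy] := vy; rewrite Ey in sy.
  have lt_s : size s1 < k by rewrite -sy size_cat /= addnS ltnS leq_addr.
  split=> //; last by rewrite Ey incr_mid /enc map_cat /= Exi eqxx EB.
  apply: vec_incr => //; first by rewrite Ey nth_mid Exi ltnS; case/andP: i_n.
  move=> lt_s1; have := gy _ lt_s1; rewrite addn0 Ey nth_mid.
  case: s2 Ey EB sy => [|x2 s2] Ey EB sy.
    by move: lt_s1; rewrite -sy size_cat addn1 ltnn.
  have -> : nth 0 (s1 ++ x :: x2 :: s2) (size s1).+1 = x2.
    by rewrite -addn1 -cat_rcons addn1 -(size_rcons s1 x) nth_mid.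
  move: okB; rewrite EB => /okR_head; rewrite rp1 Exi; lia.
move=> y j vy lt_j vj; have [sy ry gy] := vy; have /vec0_sorted[_ _ srt] := vy.
have [sj rj gj] := vj; have Ey : y = take j y ++ nth 0 y j :: drop j.+1 y.
  by rewrite -drop_nth ?sy // cat_take_drop.
have szt : size (take j y) = j by rewrite size_takel // sy ltnW.
have -> : enc (incr y j) = enc (take j y) ++ raise (nth 0 y j) [:: nth 0 y j] :: enc (drop j.+1 y).
  by rewrite {1}Ey -{4}szt incr_mid /enc map_cat /= eqxx.
rewrite {1}Ey /enc map_cat /=; apply: CStep.
- by have := ry _ lt_j; have := rj _ lt_j; rewrite nth_incr eqxx; lia.
- by rewrite rp1.
- apply: okL_none => _ /mapP[x /(nthP 0)[l lt_l <-] ->]; rewrite lp1 szt in lt_l *.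
  rewrite nth_take //; have := nth_sorted_leq (r := l) (s := j) srt; rewrite sy lt_j ltnW //.
  by move=> /(_ isT) le; rewrite neq_ltn ltnS le.
apply: okR_none => _ /mapP[x /(nthP 0)[l lt_l <-] ->]; rewrite rp1 nth_drop.
rewrite size_drop sy in lt_l; have lt_jl : j.+1 + l < k by have := lt_l; lia.
have lt_j1 : j.+1 < k by lia.
have := gj _ lt_j1; rewrite !nth_incr eqxx gtn_eqF // addn0 => lt1.
have := nth_sorted_leq (r := j.+1) (s := j.+1 + l) srt; rewrite sy lt_jl leq_addr => /(_ isT) le2.
by rewrite gtn_eqF // (leq_trans lt1).
Qed.

Lemma cstep1 n C X : cstep n [:: C] X <-> exists i, [/\ 0 < i <= n, rp i C & X = [:: raise i C]].
Proof.
split=> [st|[i [i_n rC ->]]]; last first.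
  by rewrite -[[:: C]]cat0s -[[:: raise _ _]]cat0s; apply: CStep => // j.
move E: [:: C] st => Cs st; case: st E => i [|? []] C' // B i_n rC _ _ //= [EC EB].
by exists i; rewrite EC -EB.
Qed.

Lemma raise_incr C j : sorted ltn C -> j < size C -> raise (nth 0 C j) C = incr C j.
Proof.
move=> sC lt_j; apply: (@eq_from_nth _ 0); first by rewrite size_raise size_incr.
move=> k; rewrite size_raise => lt_k; rewrite nth_raise // nth_incr.
by rewrite nth_uniq ?sorted_ltn_uniq.
Qed.

(** In a single column [i] can be raised exactly when [i.+1] is absent, that is, when the column
    stays strictly increasing. *)
Lemma clattice_col n m : m <= n.+1 -> clattice n [:: m].
Proof.
move=> m_n; apply: (@lattice_vec _ _ _ n.+1 m (fun=> 1) (fun y => [:: y]) (iota 1 m)).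
- by move=> y /vec1_sorted[sy ry gy]; split; rewrite /= ?sy // ?ry ?gy.
- case=> [|C [|? ?]] [] //= [sC] /andP[rC _] /andP[gC _] _.
  by exists C => //; apply/vec1_sorted.
- by move=> x y [].
- apply/vec1_sorted; split; [exact: size_iota | | exact: iota_ltn_sorted].
  by apply/allP => x; rewrite mem_iota; lia.
- move=> y [sy ry gy]; elim=> [|j IH] lt_j; first by rewrite nth_iota //; case/andP: (ry _ lt_j).
  have := gy _ lt_j; have := IH (ltnW lt_j); rewrite !nth_iota //; last exact: ltnW.
  by lia.
- move=> y a /vec1_sorted[sy ry gy] /cstep1[i [i_n rC ->]]; exists (index i y).
  have [iy siy] := andP rC; have lt_i : index i y < size y by rewrite index_mem.
  have E : raise i y = incr y (index i y) by rewrite -raise_incr // nth_index.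
  rewrite -sy lt_i -E; split=> //; apply/vec1_sorted; split.
  + by rewrite size_raise.
  + by apply/allP => x; rewrite mem_raise // => /orP[/eqP->|/andP[/(allP ry)]] //; lia.
  + exact: raise_sorted.
move=> y j /vec1_sorted[sy ry gy] lt_j [sj rj gj]; apply/cstep1; exists (nth 0 y j).
rewrite raise_incr ?sy //; split=> //.
  have := rj _ lt_j; rewrite nth_incr eqxx.
  by have := allP ry (nth 0 y j); rewrite mem_nth ?sy // => /(_ isT); lia.
rewrite /rp mem_nth ?sy //=; apply/negP => /(nthP 0)[l]; rewrite sy => lt_l El.
have {}lt_l : l < m := lt_l; have {}El : nth 0 y l = (nth 0 y j).+1 := El.
have lt_jl : j < l.
  rewrite ltnNge; apply/negP; rewrite leq_eqVlt => /predU1P[E|lt]; first by move: El; rewrite E; lia.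
  by have := nth_sorted_ltn (r := l) (s := j) gy; rewrite lt sy lt_j => /(_ isT); lia.
have lt_j1 : j.+1 < m by apply: leq_trans lt_l.
have := gj _ lt_j1; rewrite !nth_incr eqxx gtn_eqF //.
have le_l : nth 0 y j.+1 <= nth 0 y l.
  case: (ltngtP j.+1 l) lt_jl => [lt _|//|-> //].
  by apply: ltnW; apply: nth_sorted_ltn => //; rewrite lt sy.
by lia.
Qed.

Lemma vec_le M N g y k l : vec M N g y -> k <= l < N -> nth 0 y k <= nth 0 y l.
Proof.
move=> [_ _ gy] /andP[]; elim: l => [|l IH]; first by rewrite leqn0 => /eqP->.
rewrite leq_eqVlt => /predU1P[->//|]; rewrite ltnS => le_kl lt_l.
apply: leq_trans (IH le_kl (ltnW lt_l)) _; apply: leq_trans (gy _ lt_l); exact: leq_addr.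
Qed.

(** * Two columns, of heights m and 1 *)

Lemma cstep2 n C D X : cstep n [:: C; D] X <-> exists2 i, 0 < i <= n &
  [/\ rp i C, ~~ rp i D & X = [:: raise i C; D]] \/
  [/\ rp i D, ~~ lp i C & X = [:: C; raise i D]].
Proof.
split=> [st|[i i_n [[rC rD ->]|[rD lC ->]]]].
- move E: [:: C; D] st => Cs st; case: st E => i [|A0 [|A1 A]] C' B i_n rC okA okB //=.
  + case=> EC EB; exists i => //; left; rewrite EC -EB; split=> //.
    by move: okB; rewrite -EB => /okR_head.
  + case=> EC ED EB; exists i => //; right; rewrite EC ED -EB; split=> //.
    exact: (@okL_last _ [::]).
  + by case: A {okA}.
- rewrite -[[:: C; D]]cat0s -[[:: raise _ _; _]]cat0s; apply: CStep => //.
  by apply: okR_none => C'; rewrite inE => /eqP->.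
rewrite -[[:: C; D]]/([:: C] ++ [:: D]) -[[:: C; _]]/([:: C] ++ [:: raise i D]).
by apply: CStep => //; apply: okL_none => C'; rewrite inE => /eqP->.
Qed.

(* The tableau with first column [C] and second column [[:: r]] is coded by
   the sequence [y] obtained by inserting [r] into [C] after the last entry
   [<= r], together with the position [p] such that [r] is entry [p+1] of [y].
   Thus [y] is strictly increasing except that [y_p <= y_(p+1)]. *)
Section HookOne.

Variables (n m : nat).
Hypothesis m_gt1 : 1 < m.
Hypothesis m_le : m <= n.+1.

Definition gap1 (p j : nat) : nat := j != p.

Definition code1 (x : seq nat * nat) : Prop := vec n.+1 m.+1 (gap1 x.2) x.1 /\ x.2 < m.

Definition colC (y : seq nat) (p : nat) : seq nat := mkseq (fun k => nth 0 y (bump p.+1 k)) m.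

Definition enc1 (x : seq nat * nat) : seq (seq nat) := [:: colC x.1 x.2; [:: nth 0 x.1 x.2.+1]].

(** The position passes from [l] to [l+1] only when entries [l], [l+1], [l+2] are [i], [i], [i+1].
    Entries do not decrease before or after that moment, so entry [l+2] of the source is at most one
    more than entry [l] of the target, for every [l] that is passed. *)
Definition le1 (x z : seq nat * nat) : Prop :=
  [/\ x.2 <= z.2, lev m.+1 x.1 z.1 &
      forall l, x.2 <= l < z.2 -> nth 0 x.1 l.+2 <= (nth 0 z.1 l).+1].

Lemma gap1_lt p y k l : vec n.+1 m.+1 (gap1 p) y -> k < l <= m -> (k != p) || (l != p.+1) ->
  nth 0 y k < nth 0 y l.
Proof.
move=> vy kl; have [_ _ gy] := vy; case: (eqVneq k p) => [Ek /= l_p|kp _].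
  have lt1 : nth 0 y p.+1 < nth 0 y p.+2.
    by have := gy p.+1; rewrite /gap1 gtn_eqF // addn1; apply; lia.
  have := vec_le (k := k) (l := p.+1) vy; have := vec_le (k := p.+2) (l := l) vy.
  have -> : p.+2 <= l < m.+1 by lia.
  have -> : k <= p.+1 < m.+1 by lia.
  by move=> /(_ isT) le1 /(_ isT) le2; apply: leq_trans le1; apply: leq_ltn_trans lt1.
have := gy k; rewrite /gap1 kp addn1 => /(_ _) lt; apply: leq_trans (lt _) _; first by lia.
by apply: vec_le vy _; lia.
Qed.

Lemma size_colC y p : size (colC y p) = m.
Proof. exact: size_mkseq. Qed.

Lemma nth_colC y p k : k < m -> nth 0 (colC y p) k = nth 0 y (bump p.+1 k).
Proof. exact: nth_mkseq. Qed.

Lemma bump_le p k : k < m -> bump p k <= m.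
Proof. by rewrite /bump; lia. Qed.

Lemma colC_sorted y p : vec n.+1 m.+1 (gap1 p) y -> sorted ltn (colC y p).
Proof.
move=> vy; apply/(sortedP 0) => k; rewrite size_colC => lt_k.
rewrite /= !nth_colC //; last exact: ltnW.
by apply: gap1_lt vy _ _; rewrite /bump; lia.
Qed.

Lemma mem_colC y p x (lt_p : p < m) : reflect (exists l, [/\ l <= m, l != p.+1 & nth 0 y l = x]) (x \in colC y p).
Proof.
apply: (iffP (nthP 0)) => [[k]|[l [le_l nl <-]]].
  rewrite size_colC => lt_k <-; exists (bump p.+1 k).
  by rewrite nth_colC // bump_le // eq_sym neq_bump.
have lt_l : unbump p.+1 l < m by rewrite /unbump; lia.
by exists (unbump p.+1 l); rewrite ?size_colC // nth_colC // unbumpK.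
Qed.

Lemma code1_valid x : code1 x -> cvalid n [:: m; 1] (enc1 x).
Proof.
case: x => y p [/= vy lt_p]; have [sy ry gy] := vy; split.
- by rewrite /= size_colC.
- rewrite /= ry //= !andbT; apply/allP => _ /(mem_colC _ _ lt_p)[l [le_l _ <-]]; exact: ry.
- by rewrite /= colC_sorted.
rewrite /= andbT; apply/colleP; rewrite size_colC; split; first by rewrite /=; lia.
case=> //= _; rewrite nth_colC; last by lia.
by apply: vec_le vy _; rewrite /bump; lia.
Qed.

Lemma code1_surj a : cvalid n [:: m; 1] a -> exists2 x, code1 x & a = enc1 x.
Proof.
case: a => [|C [|D [|? ?]]] [] //= [sC]; case: D => [|r [|? ?]] //= _.
rewrite !andbT => /andP[rC rr] sortC /colleP[_ /(_ 0 isT) /= Cr].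
(* [r] is inserted after the [c] entries of [C] that are at most [r], so the position is [c.-1]; the
   first entry of [C] is one of them, hence [c] is positive. *)
pose c := count (geq r) C.
have cP k : (k < c) = (k < m) && (nth 0 C k <= r) by rewrite /c ltn_count_sorted // sC.
have c_gt0 : 0 < c by rewrite cP Cr andbT; lia.
have c_le : c <= m by rewrite -sC count_size.
have C_lt k l : k < l < m -> nth 0 C k < nth 0 C l.
  by move=> kl; apply: nth_sorted_ltn => //; rewrite sC.
pose y := mkseq (fun j => if j < c then nth 0 C j else if j == c then r else nth 0 C j.-1) m.+1.
have ny j : j < m.+1 -> nth 0 y j = if j < c then nth 0 C j else if j == c then r else nth 0 C j.-1.
  exact: nth_mkseq.
have sy : size y = m.+1 by exact: size_mkseq.
clearbody y; exists (y, c.-1).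
  split; rewrite /=; last by lia.
  have rng k : k < m -> 0 < nth 0 C k <= n.+1.
    by move=> lt_k; apply: (allP rC); rewrite mem_nth // sC.
  split=> //.
    move=> j lt_j; rewrite ny //; by case: (ltngtP j c) => [lt|gt|_ //]; apply: rng; lia.
  move=> j lt_j; rewrite !ny //; last exact: ltnW.
  have -> : gap1 c.-1 j = (j.+1 != c) by rewrite /gap1; lia.
  case: (ltngtP j.+1 c) => [lt|gt|Ec] /=.
  - by rewrite ?(ltnW lt) addn1; apply: C_lt; lia.
  - have [lt|gt'|Ec] := ltngtP j c; first by lia.
      by rewrite addn1; apply: C_lt; lia.
    have := cP c; rewrite ltnn Ec; have -> : c < m by lia.
    by move=> /esym/negbT /=; lia.
  by have := cP j; rewrite -Ec leqnn addn0; lia.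
rewrite /enc1 /= prednK // ny ?ltnS // ltnn eqxx; congr [:: _; _].
apply: (@eq_from_nth _ 0); rewrite ?size_colC ?sC // => k lt_k.
rewrite nth_colC // prednK // ny; last exact: bump_le.
rewrite /bump; case: (leqP c k) => [le_ck|lt_kc]; last by rewrite add0n lt_kc.
by rewrite add1n ltnNge (leq_trans le_ck) //= gtn_eqF.
Qed.

Lemma enc1_inj x z : code1 x -> code1 z -> enc1 x = enc1 z -> x = z.
Proof.
case: x z => [y p] [z q] [/= vy lt_p] [/= vz lt_q] [] /= EC Er.
have E k : k < m -> nth 0 y (bump p.+1 k) = nth 0 z (bump q.+1 k).
  by move=> lt_k; rewrite -!nth_colC // EC.
have aux y' z' p' q' : vec n.+1 m.+1 (gap1 p') y' -> vec n.+1 m.+1 (gap1 q') z' -> q' < m ->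
    (forall k, k < m -> nth 0 y' (bump p'.+1 k) = nth 0 z' (bump q'.+1 k)) ->
    nth 0 y' p'.+1 = nth 0 z' q'.+1 -> q' <= p'.
  move=> vy' vz' lt_q' E' Er'; rewrite leqNgt; apply/negP => lt_pq.
  have b1 : bump p'.+1 p'.+1 = p'.+2 by rewrite /bump; lia.
  have b2 : bump q'.+1 p'.+1 = p'.+1 by rewrite /bump; lia.
  have := E' p'.+1; rewrite b1 b2.
  have := gap1_lt (k := p'.+1) (l := p'.+2) vy'; have := vec_le (k := p'.+1) (l := q'.+1) vz'.
  by lia.
have Epq : p = q.
  apply/eqP; rewrite eqn_leq (aux z y q p) ?(aux y z p q) // => k lt_k; exact/esym/E.
subst q; congr (_, _).
have [sy _ _] := vy; have [sz _ _] := vz.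
apply: (@eq_from_nth _ 0); rewrite sy ?sz // => j lt_j.
case: (eqVneq j p.+1) => [->//|nj].
have lt_u : unbump p.+1 j < m by rewrite /unbump; lia.
by have := E _ lt_u; rewrite unbumpK.
Qed.

Lemma raise_colC y p j : vec n.+1 m.+1 (gap1 p) y -> j <= m -> j != p.+1 ->
  raise (nth 0 y j) (colC y p) = colC (incr y j) p.
Proof.
move=> vy le_j nj; apply: (@eq_from_nth _ 0); rewrite ?size_raise !size_colC // => k lt_k.
rewrite nth_raise ?size_colC // !nth_colC // nth_incr.
have le_b := bump_le p.+1 lt_k; have nb := neq_bump p.+1 k.
case: (ltngtP (bump p.+1 k) j) => [lt|gt|->]; last by rewrite eqxx.
  by rewrite ltn_eqF //; apply: gap1_lt vy _ _; lia.
by rewrite gtn_eqF //; apply: gap1_lt vy _ _; lia.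
Qed.

Lemma colC_incr y p : colC (incr y p.+1) p = colC y p.
Proof.
by apply: eq_map => k; rewrite nth_incr eq_sym (negPf (neq_bump _ _)).
Qed.

(** The crossing: after the increment, entries [p+1] and [p+2] are equal, and deleting either of
    them leaves the same column. *)
Lemma colC_next y p : nth 0 y p.+2 = (nth 0 y p.+1).+1 ->
  colC (incr y p.+1) p.+1 = colC y p.
Proof.
move=> E2; apply: (@eq_from_nth _ 0); rewrite !size_colC // => k lt_k.
rewrite !nth_colC // nth_incr; have [lt|gt|->] := ltngtP k p.+1.
- have -> : bump p.+2 k = k by rewrite /bump; lia.
  by rewrite ltn_eqF //; have -> : bump p.+1 k = k by rewrite /bump; lia.
- have -> : bump p.+2 k = k.+1 by rewrite /bump; lia.
  have -> : bump p.+1 k = k.+1 by rewrite /bump; lia.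
  by rewrite gtn_eqF // ltnW.
have -> : bump p.+2 p.+1 = p.+1 by rewrite /bump; lia.
have -> : bump p.+1 p.+1 = p.+2 by rewrite /bump; lia.
by rewrite eqxx E2.
Qed.

Lemma step1_same y p j : code1 (y, p) -> j <= m -> code1 (incr y j, p) ->
  cstep n (enc1 (y, p)) (enc1 (incr y j, p)).
Proof.
move=> [/= vy lt_p] le_j [/= vj _]; have [sy ry gy] := vy; have [_ rj gj] := vj.
apply/cstep2; exists (nth 0 y j).
  by have := ry j le_j; have := rj j le_j; rewrite /= nth_incr eqxx; lia.
have gj' : j < m -> nth 0 y j + gap1 p j < nth 0 y j.+1.
  by move=> lt_j; have := gj j lt_j; rewrite /= !nth_incr eqxx gtn_eqF.
have next l : j < l <= m -> (j != p) || (l != p.+1) -> (nth 0 y j).+1 < nth 0 y l.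
  move=> jl ne; case: (eqVneq j p) => [Ejp|njp].
    have : nth 0 y p.+1 < nth 0 y l by apply: gap1_lt vy _ _; lia.
    by move: jl gj'; rewrite /gap1 Ejp eqxx /=; lia.
  have := vec_le (k := j.+1) (l := l) vy; have := gj'; rewrite /gap1 njp; lia.
case: (eqVneq j p.+1) => [Ej|nj].
  right; rewrite rp1 Ej eqxx /enc1 /= colC_incr nth_incr eqxx; split=> //; last by rewrite /raise /= eqxx.
  apply/negP => /andP[/(mem_colC _ _ lt_p)[l [le_l nl El]] _].
  have jl : j < l by rewrite ltnNge; apply/negP => le_lj; have := vec_le (k := l) (l := p.+1) vy; lia.
  by have := next l; rewrite Ej; lia.
left; rewrite /enc1 /= raise_colC // nth_incr eq_sym (negPf nj); split=> //.
  apply/andP; split; first by apply/(mem_colC _ _ lt_p); exists j.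
  apply/negP => /(mem_colC _ _ lt_p)[l [le_l nl El]].
  have jl : j < l by rewrite ltnNge; apply/negP => le_lj; have := vec_le (k := l) (l := j) vy; lia.
  by have := next l; lia.
rewrite rp1; apply/negP => /eqP E.
case: (ltngtP j p.+1) nj => // [lt _|gt _].
  case: (eqVneq j p) => [Ej|nj]; first by move: gj' E; rewrite /gap1 Ej eqxx /=; lia.
  by have := gap1_lt (k := j) (l := p.+1) vy; lia.
by have := gap1_lt (k := p.+1) (l := j) vy; lia.
Qed.

Lemma step1_next y p : code1 (y, p) -> p.+1 < m -> nth 0 y p = nth 0 y p.+1 ->
  nth 0 y p.+2 = (nth 0 y p.+1).+1 ->
  code1 (incr y p.+1, p.+1) /\ cstep n (enc1 (y, p)) (enc1 (incr y p.+1, p.+1)).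
Proof.
move=> [/= vy lt_p] lt_p1 E1 E2; have [sy ry gy] := vy.
split.
  split=> //=; split; first by rewrite size_incr sy // ltnS ltnW.
    move=> j lt_j; rewrite nth_incr; case: eqP => _; last exact: ry.
    by have := ry p.+2; lia.
  move=> j lt_j; rewrite !nth_incr; have := gy _ lt_j; rewrite /gap1.
  case: (eqVneq j p.+1) => [->|n1]; first by rewrite !gtn_eqF //=; lia.
  rewrite eqSS; case: (eqVneq j p) => [->|n2] /=; first by rewrite E1; lia.
  by lia.
apply/cstep2; exists (nth 0 y p.+1).
  by have := ry p.+1; have := ry p.+2; lia.
right; rewrite rp1 eqxx; split=> //.
  rewrite /lp negb_and; apply/orP; right; rewrite negbK; apply/(mem_colC _ _ lt_p); exists p.
  by split=> //; [lia | rewrite ltn_eqF].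
by rewrite /enc1 /= colC_next // nth_incr gtn_eqF // E2 /raise /= eqxx.
Qed.

Lemma step1_inv y p a : code1 (y, p) -> cstep n (enc1 (y, p)) a ->
  (exists j, [/\ j <= m, code1 (incr y j, p) & a = enc1 (incr y j, p)]) \/
  [/\ p.+1 < m, nth 0 y p = nth 0 y p.+1, nth 0 y p.+2 = (nth 0 y p.+1).+1 &
      a = enc1 (incr y p.+1, p.+1)].
Proof.
move=> cy; have [/= vy lt_p] := cy; have [sy ry gy] := vy.
case/cstep2=> i i_n /= [[riC rD ->]|[rD lC ->]].
  have [iC siC] := andP riC; have [j [le_j nj Ej]] := mem_colC _ _ lt_p iC.
  left; exists j; split=> //; last first.
    by rewrite -Ej raise_colC // /enc1 /= nth_incr eq_sym (negPf nj).
  split=> //=; apply: vec_incr => //; first by rewrite Ej; lia.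
  rewrite ltnS => lt_j; have := gy _ lt_j; rewrite /gap1; case: (eqVneq j p) => [Ejp|njp] _.
    rewrite addn0 ltn_neqAle (vec_le vy) ?andbT; last by lia.
    by move: rD; rewrite rp1 Ej Ejp eq_sym.
  have nE : nth 0 y j.+1 != i.+1.
    by apply: contraNneq siC => E; apply/(mem_colC _ _ lt_p); exists j.+1; rewrite lt_j eqSS.
  have := gap1_lt (k := j) (l := j.+1) vy; rewrite Ej njp leqnn lt_j /= => /(_ isT isT); lia.
move: rD; rewrite rp1 => /eqP Ei.
have Ea : [:: colC y p; raise i [:: nth 0 y p.+1]] = enc1 (incr y p.+1, p).
  by rewrite /enc1 /= colC_incr nth_incr eqxx /raise /= Ei eqxx.
(* If the next letter of the first column is [i.+1], that column would be an opening bracket unless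
   it also contains [i]. Hence entry [p] is [i], and [r] crosses. *)
case: (boolP ((p.+1 < m) && (nth 0 y p.+2 == i.+1))) => [/andP[lt_p1 /eqP E2]|no].
  right; have E1 : nth 0 y p = i.
    move: lC; rewrite /lp negb_and negbK => /orP[/negP[]|/(mem_colC _ _ lt_p)[l [le_l nl El]]].
      by apply/(mem_colC _ _ lt_p); exists p.+2; rewrite eqSS gtn_eqF.
    have [lt_l|le_l'] := ltnP l p.+2; last first.
      by have := gap1_lt (k := p.+1) (l := l) vy; lia.
    have le_lp : l <= p by lia.
    have := vec_le (k := l) (l := p) vy; have := vec_le (k := p) (l := p.+1) vy; lia.
  have E2' : nth 0 y p.+2 = (nth 0 y p.+1).+1 by rewrite Ei.
  split=> //; first by rewrite E1.
  by rewrite /enc1 /= colC_next // nth_incr Ei eqxx gtn_eqF // E2.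
left; exists p.+1; split=> //.
split=> //=; apply: vec_incr => //; first by rewrite Ei; lia.
rewrite ltnS => lt_p1; rewrite lt_p1 /= in no.
by have := gap1_lt (k := p.+1) (l := p.+2) vy; rewrite /gap1 gtn_eqF // Ei; lia.
Qed.

Lemma le1_trans x y z : code1 x -> code1 y -> code1 z -> le1 x y -> le1 y z -> le1 x z.
Proof.
move=> _ [_ lt_y] [_ lt_z] [pxy xy hxy] [pyz yz hyz]; split.
- exact: leq_trans pxy pyz.
- by move=> j lt_j; apply: leq_trans (xy _ lt_j) (yz _ lt_j).
move=> l /andP[le_l lt_l]; case: (ltnP l y.2) => [lt_ly|le_yl].
  by apply: leq_trans (hxy l _) _; [rewrite le_l | rewrite ltnS; apply: yz; lia].
by apply: leq_trans (xy _ _) (hyz l _); lia.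
Qed.

Lemma clattice_hook1 : clattice n [:: m; 1].
Proof.
have bot_nth j : 0 < j <= m -> nth 0 (1 :: iota 1 m) j = j.
  by case: j => // j lt_j; rewrite /= nth_iota.
have ge_j y p : vec n.+1 m.+1 (gap1 p) y ->
    (forall j, j <= p -> j <= m -> j < nth 0 y j) /\ (forall j, j <= m -> j <= nth 0 y j).
  move=> vy; have [sy ry gy] := vy.
  have H1 j : j <= p -> j <= m -> j < nth 0 y j.
    elim: j => [|j IH] le_j lt_j; first by case/andP: (ry 0 isT).
    have := gy _ lt_j; rewrite /gap1 ltn_eqF //; have := IH (ltnW le_j) (ltnW lt_j); lia.
  split=> //; elim=> [|j IH] lt_j //.
  case: (ltnP j p) => [lt|ge]; first exact/ltnW/H1.
  have := gy _ lt_j; rewrite /gap1; case: (eqVneq j p) => [Ej|nj] /=.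
    by have := H1 j; lia.
  by have := IH (ltnW lt_j); lia.
(* First column [1..m] and second column [1], the latter inserted at index 1. *)
have cbot : code1 (1 :: iota 1 m, 0).
  split; rewrite /=; last by lia.
  split; first by rewrite /= size_iota.
    by case=> [|j] lt_j //=; rewrite nth_iota //; lia.
  case=> [|j] lt_j; first by rewrite /= nth_iota.
  by rewrite !bot_nth /gap1 //=; lia.
apply: (lattice_of_code (PX := code1) (enc := enc1) (R := le1)
  (rk := fun x => sumn x.1) (bot := (1 :: iota 1 m, 0))) => //.
- exact: code1_valid.
- exact: code1_surj.
- exact: enc1_inj.
- case=> y p [/= vy lt_p]; have [H1 H2] := ge_j _ _ vy; have [sy ry gy] := vy; split=> //=.
    case=> [|j] lt_j; first by case/andP: (ry 0 isT).
    by rewrite bot_nth ?H2.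
  by move=> l lt_l; rewrite nth_iota; [have := H1 l; lia | lia].
- by move=> x cx; split=> // l; lia.
- exact: le1_trans.
- by move=> [y p] [z q] [[sy _ _] _] [[sz _ _] _] [_ le _]; apply: sumn_lev le.
- case=> y p a cy /(step1_inv cy)[[j [le_j cj ->]]|[lt_p1 E1 E2 ->]].
    exists (incr y j, p); split=> //; last by rewrite sumn_incr.
    by split=> //=; [exact: lev_incr_self | lia].
  have [cz _] := step1_next cy lt_p1 E1 E2.
  exists (incr y p.+1, p.+1); split=> //; last by rewrite sumn_incr.
  split=> //=; first exact: lev_incr_self.
  move=> l lt_l; have -> : l = p by lia.
  by rewrite nth_incr ltn_eqF // E2 E1.
- case=> y p [z q] cy cz [/= le_pq le_yz hyz] ne.
  have [/= vy lt_p] := cy; have [/= vz lt_q] := cz.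
  have [Epq|npq] := eqVneq p q.
    rewrite -Epq in vz ne cz le_pq hyz *.
    have ne' : y <> z by move=> E; apply: ne; rewrite E.
    have [j [lt_j lt vj]] := vec_progress vy vz le_yz ne'.
    have cj : code1 (incr y j, p) by [].
    exists (incr y j, p); split=> //; first exact: step1_same.
    by split=> //=; [exact: lev_incr | lia].
  have lt_pq : p < q by lia.
  have lt_p1 : p.+1 < m by lia.
  have hp := hyz p; rewrite leqnn lt_pq in hp; have {}hp := hp isT.
  have [sz rz gz] := vz.
  have zp : nth 0 z p < nth 0 z p.+1 by apply: gap1_lt vz _ _; lia.
  have y12 : nth 0 y p.+1 < nth 0 y p.+2 by apply: gap1_lt vy _ _; lia.
  have y01 : nth 0 y p <= nth 0 y p.+1 by apply: vec_le vy _; lia.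
  have lift j : j <= m -> nth 0 y j < nth 0 z j -> p <= j <= p.+1 ->
      (j < m -> nth 0 y j + gap1 p j < nth 0 y j.+1) ->
      exists x, [/\ code1 x, cstep n (enc1 (y, p)) (enc1 x) & le1 x (z, q)].
    move=> le_j lt jp gj; have vj : vec n.+1 m.+1 (gap1 p) (incr y j).
      apply: vec_incr => //; first by apply: leq_trans lt _; case/andP: (rz j le_j).
    exists (incr y j, p); split=> //; first exact: step1_same.
    split=> //=; first exact: lev_incr.
    by move=> l pl; rewrite nth_incr gtn_eqF; [apply: hyz | lia].
  (* The positions still differ: raise entry [p+1] until it is just below entry [p+2], then entry
     [p] until it meets entry [p+1], then cross. The inequality [hp] keeps these moves below [z]. *)
  case: (ltnP (nth 0 y p.+1).+1 (nth 0 y p.+2)) => [lt2|ge2].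
    by apply: (lift p.+1) => //; rewrite /gap1 ?gtn_eqF; lia.
  have E2 : nth 0 y p.+2 = (nth 0 y p.+1).+1 by lia.
  case: (ltnP (nth 0 y p) (nth 0 y p.+1)) => [lt1|ge1].
    by apply: (lift p) => //; rewrite /gap1 ?eqxx; lia.
  have E1 : nth 0 y p = nth 0 y p.+1 by lia.
  have [cx st] := step1_next cy lt_p1 E1 E2.
  exists (incr y p.+1, p.+1); split=> //; split=> //=; first by apply: lev_incr => //; lia.
  by move=> l pl; rewrite nth_incr gtn_eqF; [apply: hyz | ]; lia.
have join x z : code1 x -> code1 z -> x.2 <= z.2 -> exists j, [/\ code1 j, le1 x j, le1 z j &
    forall u, code1 u -> le1 x u -> le1 z u -> le1 j u].
  case: x z => [y p] [z q] [/= vy lt_p] [/= vz lt_q] le_pq.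
  (* [yh] is the least code at position [q] above [y]. *)
  pose yh := mkseq (fun j => if p <= j < q then (nth 0 y j.+2).-1
    else if (j == q) && (p < q) then nth 0 y j.+1 else nth 0 y j) m.+1.
  have nyh j : j < m.+1 -> nth 0 yh j = if p <= j < q then (nth 0 y j.+2).-1
      else if (j == q) && (p < q) then nth 0 y j.+1 else nth 0 y j.
    exact: nth_mkseq.
  have syh : size yh = m.+1 by exact: size_mkseq.
  clearbody yh; have [sy ry gy] := vy.
  have lt_y j k : j < k <= m -> (j != p) || (k != p.+1) -> nth 0 y j < nth 0 y k.
    exact: gap1_lt vy.
  have vyh : vec n.+1 m.+1 (gap1 q) yh.
    split=> //.
      move=> j lt_j; rewrite nyh //; case: ifP => [pj|_].
        have := ry j.+2; have := ry j; have := lt_y j j.+2; lia.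
      by case: ifP => [/andP[/eqP-> _]|_]; apply: ry; lia.
    move=> j lt_j; rewrite !nyh //; last exact: ltnW.
    have := gy j lt_j; have := lt_y j j.+1; have := lt_y j j.+2; have := lt_y j.+2 j.+3.
    have := lt_y j.+1 j.+2; have := lt_y j.+1 j.+3.
    clear - le_pq lt_p lt_q lt_j; rewrite /gap1; case: (boolP (p <= j < q)) => c1; case: (boolP (p <= j.+1 < q)) => c2;
    case: (boolP ((j == q) && (p < q))) => c3; case: (boolP ((j.+1 == q) && (p < q))) => c4; lia.
  have le_yyh : lev m.+1 y yh.
    move=> j lt_j; rewrite nyh //; have := lt_y j j.+2; have := lt_y j j.+1.
    by have := vec_le (k := j) (l := j.+1) vy; case: ifP => c1; [lia | case: ifP => c2; lia].
  (* Both vectors now belong to the same position [q], where the codes are closed under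
     componentwise maxima. *)
  have [w vw nw] : exists2 w, vec n.+1 m.+1 (gap1 q) w &
      forall j, j < m.+1 -> nth 0 w j = maxn (nth 0 yh j) (nth 0 z j).
    by exists (vmax m.+1 yh z); [exact: vmax_vec | move=> j; exact: nth_vmax].
  exists (w, q); split=> //.
  - split=> //=; first by move=> j lt_j; rewrite nw // leq_max le_yyh.
    move=> l pl; rewrite nw; last by lia.
    by rewrite nyh ?pl; lia.
  - split=> //=; last by lia.
    by move=> j lt_j; rewrite nw // leq_maxr.
  case=> u s [/= vu lt_s] [/= ps yu hyu] [/= qs zu hzu]; split=> //=.
    move=> j lt_j; rewrite nw // geq_max zu // andbT nyh //; case: ifP => [pj|_].
      by have := hyu j; lia.
    case: ifP => [/andP[/eqP-> lt_pq]|_]; last exact: yu.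
    have := hyu q.-1; have := gap1_lt (k := q.-1) (l := q) vu; rewrite prednK; last by lia.
    by lia.
  move=> l ql; rewrite nw; last by lia.
  rewrite geq_max hzu // andbT nyh; last by lia.
  have -> : p <= l.+2 < q = false by lia.
  have -> : (l.+2 == q) = false by lia.
  by apply: hyu; lia.
move=> x z cx cz; case: (leqP x.2 z.2) => [le|/ltnW le]; first exact: join.
by have [j [cj zj xj jmin]] := join _ _ cz cx le; exists j; split=> // u cu xu zu; apply: jmin.
Qed.

End HookOne.

(** * One column of height 2 followed by columns of height 1 *)

Lemma okR_first i S C B : okR i (S ++ C :: B) -> (forall D, D \in S -> ~~ lp i D) -> ~~ rp i C.
Proof.
move=> /(_ (size S).+1); rewrite take_cat ltnNge leqnSn subSnn /= take0 !count_cat /= => H nl.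
apply/negP => rC; move: H; rewrite rC (rp_lp rC) (_ : count (lp i) S = 0); first by lia.
by apply/eqP; rewrite -leqn0 leqNgt -has_count; apply/hasPn.
Qed.

Lemma okL_first i C S : (forall D, D \in S -> ~~ lp i D) -> has (rp i) S -> okL i (C :: S).
Proof.
move=> nl; rewrite has_count => hr [|j] /=.
  by rewrite (_ : count (lp i) S = 0); [lia | apply/eqP; rewrite -leqn0 leqNgt -has_count; apply/hasPn].
exact: (okL_none nl j).
Qed.

Lemma okL_first_inv i C S : okL i (C :: S) -> (forall D, D \in S -> ~~ lp i D) -> lp i C -> has (rp i) S.
Proof.
move=> /(_ 0) /= H nl lC; have [iC siC] := andP lC.
by move: H; rewrite lC /rp (negPf siC) /= has_count; lia.
Qed.

Lemma ltn_count_sorted_leq (C : seq nat) v r : sorted leq C ->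
  (r < count (gtn v) C) = (r < size C) && (nth 0 C r < v).
Proof.
elim: C r => [|c C IH] r //= sC.
have ge_c : all (leq c) C by apply: order_path_min sC; apply: leq_trans.
case: (ltnP c v) => [lt_cv|le_vc].
  by case: r => [|r] //=; rewrite add1n ltnS IH ?(path_sorted sC).
have -> : count (gtn v) C = 0.
  apply/eqP; rewrite -leqn0 leqNgt -has_count; apply/hasPn => x /(allP ge_c) /=; lia.
rewrite ltn0; case: r => [|r] /=; first by lia.
apply/esym/negP => /andP[lt_r le_r].
by have := allP ge_c _ (mem_nth 0 lt_r); rewrite /=; lia.
Qed.

Lemma mkseq_split (T : Type) (f : nat -> T) N k : k < N ->
  mkseq f N = mkseq f k ++ f k :: mkseq (fun j => f (k.+1 + j)) (N - k.+1).
Proof.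
move=> lt_k; rewrite /mkseq -{1}(subnKC lt_k) addSnnS iotaD map_cat /= add0n.
have -> : iota k.+1 (N - k.+1) = map (addn k.+1) (iota 0 (N - k.+1)).
  by have := iotaDl k.+1 0 (N - k.+1); rewrite addn0.
by rewrite -map_comp.
Qed.

(* The tableau with first row [alpha] and second row [[:: b]] is coded by the
   sequence [y] obtained by inserting [b] into [alpha] before the first entry
   [>= b], together with the position [p] such that [b] is entry [p+1] of [y].
   Thus [y] is weakly increasing with [y_p < y_(p+1)]. *)
Section HookTwo.

Variables (n m : nat).
Hypothesis n_gt0 : 0 < n.

Definition gap2 (p j : nat) : nat := j == p.

Definition code2 (x : seq nat * nat) : Prop := vec n.+1 m.+2 (gap2 x.2) x.1 /\ x.2 <= m.

Definition singles (y : seq nat) (p : nat) : seq (seq nat) :=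
  mkseq (fun k => [:: nth 0 y (bump p.+1 k.+1)]) m.

Definition enc2 (x : seq nat * nat) : seq (seq nat) :=
  [:: nth 0 x.1 0; nth 0 x.1 x.2.+1] :: singles x.1 x.2.

(** The position drops from [p] to [p-1] only when entries [p-1], [p], [p+1] are [i], [i], [i+1],
    the last being [b]. As [b] never decreases, the last drop, the one that reaches [z.2], bounds
    the initial [b]; the bounds from earlier drops follow because [z.1] is weakly increasing. *)
Definition le2 (x z : seq nat * nat) : Prop :=
  [/\ z.2 <= x.2, lev m.+2 x.1 z.1 &
      z.2 < x.2 -> nth 0 x.1 x.2.+1 <= (nth 0 z.1 z.2).+1].

Lemma gap2_lt p y k l : vec n.+1 m.+2 (gap2 p) y -> k <= p -> p < l -> l < m.+2 ->
  nth 0 y k < nth 0 y l.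
Proof.
move=> vy kp pl lt_l; have [_ _ gy] := vy.
have := gy p; rewrite /gap2 eqxx addn1.
have := vec_le (k := k) (l := p) vy; have := vec_le (k := p.+1) (l := l) vy; lia.
Qed.

Lemma size_singles y p : size (singles y p) = m.
Proof. exact: size_mkseq. Qed.

Lemma nth_singles y p k : k < m -> nth [::] (singles y p) k = [:: nth 0 y (bump p.+1 k.+1)].
Proof. exact: nth_mkseq. Qed.

Lemma code2_valid x : code2 x -> cvalid n (2 :: nseq m 1) (enc2 x).
Proof.
case: x => y p [/= vy le_p]; have [sy ry gy] := vy; split.
- rewrite /= /singles /mkseq -map_comp; congr (_ :: _).
  apply: (@eq_from_nth _ 0); rewrite size_map size_iota ?size_nseq // => k lt_k.
  by rewrite nth_nseq lt_k (nth_map 0) ?size_iota.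
- rewrite /= !ry //= ?ltnS //=; apply/allP => D /mapP[k]; rewrite mem_iota => lt_k ->.
  by rewrite /= andbT; apply: ry; rewrite /bump; lia.
- rewrite /= (gap2_lt vy) //=.
  by apply/allP => _ /mapP[k _ ->].
rewrite /=; apply/(pathP [::]) => k; rewrite size_singles => lt_k.
case: k lt_k => [|k] lt_k /=.
  rewrite nth_singles //; apply/colleP; split=> // -[|//] _ /=.
  by apply: vec_le vy _; rewrite /bump; lia.
rewrite !nth_singles //; last by lia.
apply/colleP; split=> // -[|//] _ /=.
by apply: vec_le vy _; rewrite /bump; lia.
Qed.

Lemma code2_surj a : cvalid n (2 :: nseq m 1) a -> exists2 x, code2 x & a = enc2 x.
Proof.
case: a => [|C0 S] [] //= [sC sS]; case: C0 sC => [|a0 [|b [|? ?]]] //= _.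
rewrite !andbT => /andP[/andP[ra rb] rS] /andP[lt_ab _] pS.
have szS : size S = m by have := congr1 size sS; rewrite size_map size_nseq.
have S1 k : k < m -> nth [::] S k = [:: head 0 (nth [::] S k)].
  move=> lt_k; have : size (nth [::] S k) = 1 by rewrite nth_shape sS nth_nseq lt_k.
  by case: (nth [::] S k) => [|? []].
pose al := a0 :: map (head 0) S.
have sal : size al = m.+1 by rewrite /= size_map szS.
have nal k : k < m -> nth 0 al k.+1 = head 0 (nth [::] S k).
  by move=> lt_k; rewrite /= (nth_map [::]) ?szS.
have al_srt : sorted leq al.
  apply/(sortedP 0) => k; rewrite sal ltnS => lt_k; rewrite nal //.
  have lt_k' : k < size S by rewrite szS.
  have /colleP[_ /(_ 0)] := pathP [::] pS k lt_k'; rewrite S1 //= => /(_ isT).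
  by case: k lt_k {lt_k'} => [|k] lt_k //; rewrite [nth [::] (_ :: S) _]/= S1 ?nal //=; lia.
have ral k : k <= m -> 0 < nth 0 al k <= n.+1.
  case: k => [|k] lt_k //; rewrite nal //.
  have := allP rS (nth [::] S k); rewrite mem_nth ?szS // => /(_ isT).
  by rewrite S1 //= andbT.
have al_le k l : k <= l <= m -> nth 0 al k <= nth 0 al l.
  by move=> kl; apply: nth_sorted_leq => //; rewrite sal ltnS.
(* [b] is inserted after the [c] entries of the first row that are smaller than [b]; the top of the
   first column is one of them, so [c.-1] is a position. *)
pose c := count (gtn b) al.
have cP k : (k < c) = (k <= m) && (nth 0 al k < b) by rewrite /c ltn_count_sorted_leq // sal.
have c_gt0 : 0 < c by rewrite cP.
have c_le : c <= m.+1 by rewrite -sal count_size.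
have a0E : nth 0 al 0 = a0 by [].
have SE : S = mkseq (fun k => [:: nth 0 al k.+1]) m.
  apply: (@eq_from_nth _ [::]); rewrite ?size_mkseq // szS => k lt_k.
  by rewrite nth_mkseq // S1 // nal.
clearbody c; clearbody al.
pose y := mkseq (fun j => if j < c then nth 0 al j else if j == c then b else nth 0 al j.-1) m.+2.
have ny j : j < m.+2 -> nth 0 y j = if j < c then nth 0 al j else if j == c then b else nth 0 al j.-1.
  exact: nth_mkseq.
have sy : size y = m.+2 by exact: size_mkseq.
clearbody y; exists (y, c.-1).
  split; rewrite /=; last by lia.
  split=> //.
    by move=> j lt_j; rewrite ny //; case: (ltngtP j c) => [lt|gt|_ //]; apply: ral; lia.
  move=> j lt_j; rewrite !ny //; last exact: ltnW.
  have -> : gap2 c.-1 j = (j.+1 == c) by rewrite /gap2; lia.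
  case: (ltngtP j.+1 c) => [lt|gt|Ec] /=.
  - by rewrite addn0; apply: al_le; lia.
  - have [lt|gt'|Ec] := ltngtP j c; first by lia.
      by rewrite addn0; apply: al_le; lia.
    by have := cP c; rewrite ltnn Ec addn0; lia.
  by have := cP j; rewrite -Ec leqnn addn1; lia.
rewrite /enc2 /= prednK // !ny // c_gt0 ltnn eqxx a0E; congr (_ :: _).
rewrite SE; apply/eq_in_map => k; rewrite mem_iota add0n => /= lt_k.
rewrite prednK // ny; last by rewrite /bump; lia.
rewrite /bump; case: (leqP c k.+1) => [le_ck|lt_kc]; last by rewrite add0n lt_kc.
by rewrite add1n ltnNge (leq_trans le_ck) //= gtn_eqF.
Qed.

Lemma enc2_inj x z : code2 x -> code2 z -> enc2 x = enc2 z -> x = z.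
Proof.
case: x z => [y p] [z q] [/= vy le_p] [/= vz le_q] [] /= E0 Eb ES.
have E k : k <= m -> nth 0 y (bump p.+1 k) = nth 0 z (bump q.+1 k).
  case: k => [|k] lt_k //.
  have := congr1 (fun S => nth [::] S k) ES.
  by rewrite !nth_singles // => -[].
have aux y' z' p' q' : vec n.+1 m.+2 (gap2 p') y' -> vec n.+1 m.+2 (gap2 q') z' -> q' <= m ->
    (forall k, k <= m -> nth 0 y' (bump p'.+1 k) = nth 0 z' (bump q'.+1 k)) ->
    nth 0 y' p'.+1 = nth 0 z' q'.+1 -> q' <= p'.
  move=> vy' vz' lt_q' E' Er'; rewrite leqNgt; apply/negP => lt_pq.
  have b1 : bump p'.+1 p'.+1 = p'.+2 by rewrite /bump; lia.
  have b2 : bump q'.+1 p'.+1 = p'.+1 by rewrite /bump; lia.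
  have := E' p'.+1; rewrite b1 b2.
  have := gap2_lt (k := p'.+1) (l := q'.+1) vz'; have := vec_le (k := p'.+1) (l := p'.+2) vy'.
  by lia.
have Epq : p = q.
  apply/eqP; rewrite eqn_leq (aux z y q p) ?(aux y z p q) // => k lt_k; exact/esym/E.
subst q; congr (_, _).
have [sy _ _] := vy; have [sz _ _] := vz.
apply: (@eq_from_nth _ 0); rewrite sy ?sz // => j lt_j.
case: (eqVneq j p.+1) => [->//|nj].
have lt_u : unbump p.+1 j <= m by rewrite /unbump; lia.
by have := E _ lt_u; rewrite unbumpK.
Qed.

Lemma mem_singles y p D : p <= m -> D \in singles y p ->
  exists l, [/\ 0 < l <= m.+1, l != p.+1 & D = [:: nth 0 y l]].
Proof.
move=> le_p /mapP[k]; rewrite mem_iota => lt_k ->; exists (bump p.+1 k.+1).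
by rewrite eq_sym neq_bump /bump; split=> //; lia.
Qed.

(** Which column holds entry [j] depends on [p] only, not on the vector. The decomposition for every
    [z] is used for [y] before and after an increment. *)
Lemma singles_split y p j : p <= m -> 0 < j <= m.+1 -> j != p.+1 ->
  exists S1 S2, [/\ forall z, singles z p =
     mkseq (fun k => [:: nth 0 z (bump p.+1 k.+1)]) (size S1) ++ [:: nth 0 z j] ::
     mkseq (fun k => [:: nth 0 z (bump p.+1 ((size S1).+1 + k).+1)]) (m - (size S1).+1),
     singles y p = S1 ++ [:: nth 0 y j] :: S2,
     bump p.+1 (size S1).+1 = j,
     forall D, D \in S1 -> exists l, [/\ 0 < l < j, l != p.+1 & D = [:: nth 0 y l]] &
     forall D, D \in S2 -> exists l, [/\ j < l <= m.+1, l != p.+1 & D = [:: nth 0 y l]]].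
Proof.
move=> le_p jm nj; pose k := (unbump p.+1 j).-1.
have k_lt : k < m by rewrite /k /unbump; lia.
have Ej : bump p.+1 k.+1 = j.
  by rewrite /k prednK ?unbumpK // /unbump; lia.
exists (mkseq (fun k => [:: nth 0 y (bump p.+1 k.+1)]) k).
exists (mkseq (fun j => [:: nth 0 y (bump p.+1 (k.+1 + j).+1)]) (m - k.+1)).
rewrite size_mkseq; split=> //.
- by move=> z; rewrite /singles (mkseq_split _ k_lt) Ej.
- by rewrite /singles (mkseq_split _ k_lt) Ej.
- move=> D /mapP[l]; rewrite mem_iota => lt_l ->; exists (bump p.+1 l.+1).
  rewrite eq_sym neq_bump; split=> //; rewrite -Ej /bump; lia.
move=> D /mapP[l]; rewrite mem_iota => lt_l ->; exists (bump p.+1 (k.+1 + l).+1).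
rewrite eq_sym neq_bump; split=> //; rewrite -Ej /bump; lia.
Qed.

Lemma singles_incr y p j S1 S2 : p <= m -> 0 < j <= m.+1 -> j != p.+1 ->
  (forall z, singles z p =
     mkseq (fun k => [:: nth 0 z (bump p.+1 k.+1)]) (size S1) ++ [:: nth 0 z j] ::
     mkseq (fun k => [:: nth 0 z (bump p.+1 ((size S1).+1 + k).+1)]) (m - (size S1).+1)) ->
  singles y p = S1 ++ [:: nth 0 y j] :: S2 -> bump p.+1 (size S1).+1 = j ->
  singles (incr y j) p = S1 ++ [:: (nth 0 y j).+1] :: S2.
Proof.
move=> le_p jm nj Hz Ey Ej.
have := Hz y; rewrite Ey => /eqP; rewrite eqseq_cat ?size_mkseq // => /andP[/eqP E1 /eqP[E2]].
rewrite Hz nth_incr eqxx E2; congr (_ ++ _ :: _).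
  rewrite [RHS]E1; apply/eq_in_map => k; rewrite mem_iota => lt_k; rewrite nth_incr.
  case: eqP => // Ejk; move: Ej; rewrite -Ejk => /(can_inj (@bumpK _)); lia.
apply/eq_in_map => k; rewrite mem_iota => lt_k; rewrite nth_incr.
case: eqP => // Ejk; move: Ej; rewrite -Ejk => /(can_inj (@bumpK _)); lia.
Qed.

Lemma singles_incr_out y p j : (j == 0) || (j == p.+1) -> singles (incr y j) p = singles y p.
Proof.
move=> j0; apply: eq_map => k; rewrite nth_incr; case: eqP => // Ej; exfalso.
move: j0 (neq_bump p.+1 k.+1); rewrite -Ej => /orP[|/eqP->]; last by rewrite eqxx.
by rewrite /bump; lia.
Qed.

Lemma rp2 i a b : a < b -> rp i [:: a; b] = (a == i) && (b != i.+1) || (b == i).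
Proof. by rewrite /rp !inE; lia. Qed.

Lemma lp2 i a b : a < b -> a <= i -> lp i [:: a; b] = (b == i.+1) && (a != i).
Proof. by rewrite /lp !inE; lia. Qed.

Lemma step2_same y p j : code2 (y, p) -> j <= m.+1 -> code2 (incr y j, p) ->
  cstep n (enc2 (y, p)) (enc2 (incr y j, p)).
Proof.
move=> [/= vy le_p] le_j [/= vj _]; have [sy ry gy] := vy; have [_ rj gj] := vj.
have i_n : 0 < nth 0 y j <= n.
  by have := ry j le_j; have := rj j le_j; rewrite /= nth_incr eqxx; lia.
have gj' : j < m.+1 -> nth 0 y j + gap2 p j < nth 0 y j.+1.
  by move=> lt_j; have := gj j lt_j; rewrite /= !nth_incr eqxx gtn_eqF.
have b0 : nth 0 y 0 < nth 0 y p.+1 by apply: gap2_lt vy _ _ _.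
have next l : j < l <= m.+1 -> nth 0 y j < nth 0 y l.
  move=> jl; have := gj'; have := vec_le (k := j.+1) (l := l) vy; lia.
have [Ej0|j0] := posnP j.
  subst j; have := @CStep n (nth 0 y 0) [::] [:: nth 0 y 0; nth 0 y p.+1] (singles y p).
  rewrite /enc2 /= singles_incr_out // !nth_incr /raise /= !eqxx gtn_eqF //; apply=> //.
  - rewrite rp2 // eqxx /=; apply/orP; left.
    case: (posnP p) => [p0|p_gt0]; first by have := gj'; rewrite p0 /gap2 /=; lia.
    have := next p; have := gap2_lt (k := p) (l := p.+1) vy; lia.
  apply: okR_none => D /(mem_singles le_p)[l [lm _ ->]]; rewrite rp1.
  by rewrite gtn_eqF //; apply: next; lia.
have [Ej|nj] := eqVneq j p.+1.
  have := @CStep n (nth 0 y p.+1) [::] [:: nth 0 y 0; nth 0 y p.+1] (singles y p).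
  rewrite /enc2 /= singles_incr_out ?Ej ?eqxx // !nth_incr /raise /= !eqxx ltn_eqF //; apply=> //.
  - by rewrite -Ej.
  - by rewrite rp2 // eqxx orbT.
  apply: okR_none => D /(mem_singles le_p)[l [lm nl ->]]; rewrite rp1.
  have [lt|gt|E] := ltngtP l p.+1; last by rewrite E eqxx in nl.
    by rewrite ltn_eqF //; apply: gap2_lt vy _ _ _; lia.
  by rewrite gtn_eqF // -Ej; apply: next; lia.
have jm : 0 < j <= m.+1 by rewrite j0.
have [S1 [S2 [Hz Ey Ej H1 H2]]] := singles_split y le_p jm nj.
have := @CStep n (nth 0 y j) ([:: nth 0 y 0; nth 0 y p.+1] :: S1) [:: nth 0 y j] S2.
have e0 : (0 == j) = false by rewrite ltn_eqF.
have ep : (p.+1 == j) = false by rewrite eq_sym (negPf nj).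
rewrite /enc2 /= (singles_incr le_p jm nj Hz Ey Ej) Ey !nth_incr e0 ep /raise /= eqxx.
apply=> //.
- by rewrite rp1.
- apply: okL_none => D; rewrite inE => /predU1P[->|/H1[l [lj _ ->]]].
    have y0j : nth 0 y 0 <= nth 0 y j by apply: vec_le vy _; lia.
    rewrite lp2 // negb_and; apply/orP; left.
    have [lt|gt|E] := ltngtP j p; last first.
    + by have := gj'; rewrite /gap2 E eqxx; lia.
    + by have := vec_le (k := p.+1) (l := j) vy; lia.
    by have := next p; have := gap2_lt (k := p) (l := p.+1) vy; lia.
  by rewrite lp1; have := vec_le (k := l) (l := j) vy; lia.
by apply: okR_none => D /H2[l [jl _ ->]]; rewrite rp1 gtn_eqF //; apply: next.
Qed.

(** After the increment, entries [p] and [p+1] both equal [b], and either of them may serve as the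
    letter of the second row. *)
Lemma enc2_prev y p : 0 < p <= m -> nth 0 y p.+1 = (nth 0 y p).+1 ->
  enc2 (incr y p, p.-1) =
  [:: nth 0 y 0; nth 0 y p.+1] :: singles (incr y p) p.
Proof.
move=> pm E2; rewrite /enc2 /= prednK; last by lia.
rewrite !nth_incr eqxx -E2 ltn_eqF; last by lia.
congr (_ :: _); apply/eq_in_map => k; rewrite mem_iota => lt_k; congr [:: _].
rewrite prednK; last by lia.
rewrite !nth_incr; have [lt|gt|->] := ltngtP k.+1 p.
- have -> : bump p k.+1 = k.+1 by rewrite /bump; lia.
  have -> : bump p.+1 k.+1 = k.+1 by rewrite /bump; lia.
  by [].
- have -> : bump p k.+1 = k.+2 by rewrite /bump; lia.
  by have -> : bump p.+1 k.+1 = k.+2 by rewrite /bump; lia.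
have -> : bump p p = p.+1 by rewrite /bump; lia.
have -> : bump p.+1 p = p by rewrite /bump; lia.
by rewrite eqxx gtn_eqF.
Qed.

Lemma step2_prev y p : code2 (y, p) -> 0 < p -> nth 0 y p.-1 = nth 0 y p ->
  nth 0 y p.+1 = (nth 0 y p).+1 ->
  code2 (incr y p, p.-1) /\ cstep n (enc2 (y, p)) (enc2 (incr y p, p.-1)).
Proof.
move=> [/= vy le_p] p_gt0 E1 E2; have [sy ry gy] := vy.
split.
  split=> //=; last by lia.
  split; first by rewrite size_incr sy //; lia.
    move=> j lt_j; rewrite nth_incr; case: eqP => _; last exact: ry.
    by have := ry p.+1; lia.
  move=> j lt_j; rewrite !nth_incr; have := gy _ lt_j; rewrite /gap2.
  have [->|n1] := eqVneq j p.
    have e1 : (p == p.-1) = false by lia.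
    have e2 : (p.+1 == p) = false by lia.
    by rewrite ?e1 ?e2; lia.
  have [E|n2] := eqVneq j.+1 p; last by rewrite (_ : (j == p.-1) = false); lia.
  by rewrite (_ : j == p.-1); [have -> : j = p.-1 by lia|]; lia.
have pm : 0 < p <= m by lia.
have pm1 : 0 < p <= m.+1 by lia.
have np : p != p.+1 by rewrite ltn_eqF.
have i_n : 0 < nth 0 y p <= n.
  by have := ry p; have := ry p.+1; lia.
have b0 : nth 0 y 0 < nth 0 y p.+1 by apply: gap2_lt vy _ _ _.
have [S1 [S2 [Hz Ey Ej H1 H2]]] := singles_split y le_p pm1 np.
rewrite enc2_prev // (singles_incr le_p pm1 np Hz Ey Ej) /enc2 /= Ey.
have := @CStep n (nth 0 y p) ([:: nth 0 y 0; nth 0 y p.+1] :: S1) [:: nth 0 y p] S2.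
rewrite /raise /= eqxx; apply=> //.
- by rewrite rp1.
- have nl D : D \in S1 -> ~~ lp (nth 0 y p) D.
    by move=> /H1[l [lj _ ->]]; rewrite lp1; have := vec_le (k := l) (l := p) vy; lia.
  have y0p : nth 0 y 0 <= nth 0 y p by apply: vec_le vy _; lia.
  (* Write [i] for entry [p], so [b = i.+1]. If the top of the first column is [i], that column is
     neutral. Otherwise it is an opening bracket, closed by the column that holds entry [p-1 = i],
     and entry [p] stays unmatched. *)
  have [y0E|y0N] := eqVneq (nth 0 y 0) (nth 0 y p).
    apply: okL_none => D; rewrite inE => /predU1P[->|/nl //].
    by rewrite lp2 // y0E eqxx andbF.
  apply: okL_first => //; apply/hasP.
  have p1 : p.-1 != 0 by apply: contraNneq y0N => E; rewrite -E1 E.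
  have szS : size S1 = p.-1 by move: Ej; rewrite /bump; lia.
  exists (nth [::] S1 p.-2); first by apply: mem_nth; rewrite szS; lia.
  have -> : nth [::] S1 p.-2 = nth [::] (singles y p) p.-2.
    by rewrite Ey nth_cat szS (_ : p.-2 < p.-1) //; lia.
  rewrite nth_singles; last by lia.
  rewrite rp1 -E1; apply/eqP; congr (nth _ _ _); rewrite /bump; lia.
apply: okR_none => D /H2[l [jl nl ->]]; rewrite rp1 gtn_eqF //.
by apply: gap2_lt vy _ _ _; lia.
Qed.

Lemma step2_inv y p a : code2 (y, p) -> cstep n (enc2 (y, p)) a ->
  (exists j, [/\ j <= m.+1, code2 (incr y j, p) & a = enc2 (incr y j, p)]) \/
  [/\ 0 < p, nth 0 y p.-1 = nth 0 y p, nth 0 y p.+1 = (nth 0 y p).+1 &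
      a = enc2 (incr y p, p.-1)].
Proof.
move=> cy; have [/= vy le_p] := cy; have [sy ry gy] := vy.
have b0 : nth 0 y 0 < nth 0 y p.+1 by apply: gap2_lt vy _ _ _.
move EX: (enc2 (y, p)) => X st; case: st EX => i [|A0 A] C B i_n rC okA okB; rewrite /enc2 /=.
  case=> EC EB; left; move: rC; rewrite -EC rp2 // => /orP[/andP[/eqP Ei bi]|/eqP Ei].
    exists 0; split=> //; last first.
      by rewrite -EB -Ei singles_incr_out // !nth_incr /raise /= !eqxx gtn_eqF.
    split=> //=; apply: vec_incr => //; first by rewrite Ei; lia.
    move=> _; rewrite /gap2; have [p0|p_gt0] := posnP p.
      by rewrite p0 /= addn1; move: bi b0; rewrite p0 -Ei; lia.
    rewrite ltn_eqF // addn0 ltn_neqAle (vec_le vy) // andbT.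
    have n1 : 1 != p.+1 by lia.
    have [S1 [S2 [_ Ey Ej _ _]]] := singles_split (j := 1) y le_p isT n1.
    have S10 : S1 = [::] by case: S1 Ej {Ey} => // ? ? /=; rewrite /bump; lia.
    by move: okB; rewrite -EB Ey S10 /= => /okR_head; rewrite rp1 Ei eq_sym.
  exists p.+1; split=> //; first last.
  - by rewrite -EB -Ei singles_incr_out ?eqxx ?orbT // !nth_incr /raise /= !eqxx (ltn_eqF b0).
  split=> //=; apply: vec_incr => //; first by rewrite Ei; lia.
  move=> lt_p; rewrite /gap2 gtn_eqF // addn0 ltn_neqAle (vec_le vy) ?andbT; last by lia.
  have pm : 0 < p.+2 <= m.+1 by lia.
  have np : p.+2 != p.+1 by lia.
  have [S1 [S2 [_ Ey _ H1 _]]] := singles_split y le_p pm np.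
  have := okB; rewrite -EB Ey => /okR_first; rewrite rp1 Ei eq_sym; apply=> D /H1[l [lp nl ->]].
  by rewrite lp1; have := gap2_lt (k := l) (l := p.+1) vy; lia.
case=> EA0 EA; have szA : size A < m by rewrite -(size_singles y p) EA size_cat /= addnS ltnS leq_addr.
pose j := bump p.+1 (size A).+1.
have nj : j != p.+1 by rewrite eq_sym neq_bump.
have jm : 0 < j <= m.+1 by rewrite /j /bump; lia.
have [S1 [S2 [Hz Ey Ej H1 H2]]] := singles_split y le_p jm nj.
have szS : size S1 = size A by have := can_inj (@bumpK _) Ej; case.
have := EA; rewrite Ey => /eqP; rewrite eqseq_cat // => /andP[/eqP ES1 /eqP[EC ES2]].
clearbody j; subst A C B A0.
move: rC; rewrite rp1 => /eqP Ei.
have Ea : [:: nth 0 y 0; nth 0 y p.+1] :: S1 ++ raise i [:: nth 0 y j] :: S2 =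
    [:: nth 0 y 0; nth 0 y p.+1] :: singles (incr y j) p.
  by rewrite (singles_incr le_p jm nj Hz Ey Ej) /raise /= Ei eqxx.
have le_i l : l <= j -> nth 0 y l <= i by move=> lj; rewrite -Ei; apply: vec_le vy _; lia.
have nlS D : D \in S1 -> ~~ lp i D.
  by move=> /H1[l [lj _ ->]]; rewrite lp1; have := le_i l; lia.
(* Raising entry [p] to the value of [b] breaks the gap at [p]. Such a step exists only if an
   earlier [i] cancels the [i.+1] of the second row, and then it is a crossing. *)
case: (boolP ((j == p) && (nth 0 y p.+1 == i.+1))) => [/andP[/eqP Ejp /eqP Eb]|no].
  right; have p_gt0 : 0 < p by lia.
  rewrite Ejp in Ei; have E1 : nth 0 y p.-1 = i.
    suff [l lp El] : exists2 l, l < p & nth 0 y l = i.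
      have := vec_le (k := l) (l := p.-1) vy; have := le_i p.-1; lia.
    have [y0E|y0N] := eqVneq (nth 0 y 0) i; first by exists 0.
    have /hasP[D /H1[l [lj _ ->]]] : has (rp i) S1.
      apply: okL_first_inv okA nlS _.
      by rewrite lp2 //; [rewrite Eb eqxx y0N | apply: le_i].
    by rewrite rp1 => /eqP El; exists l; lia.
  have pm : 0 < p <= m by lia.
  have := enc2_prev (y := y) pm; rewrite Ei Eb => /(_ erefl); rewrite /enc2 /= => ->.
  by rewrite Ejp Eb in Ea; rewrite E1 -Ea Ejp.
have e0 : (0 == j) = false by lia.
have ep : (p.+1 == j) = false by rewrite eq_sym (negPf nj).
left; exists j; split; [by lia | | by rewrite Ea !nth_incr e0 ep].
split=> //=; apply: vec_incr => //; [by lia | by rewrite Ei; lia |].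
move=> lt_j; rewrite /gap2 Ei; have [Ejp|njp] := eqVneq j p.
  move: no; rewrite Ejp eqxx /= => no.
  have Eip : nth 0 y p = i by rewrite -Ejp.
  by have := gap2_lt (k := p) (l := p.+1) vy; lia.
rewrite addn0 ltn_neqAle -{2}Ei (vec_le vy) ?andbT; last by lia.
case: S2 Ey okB {EA Ea H2} => [|D S2] Ey okB.
  have := congr1 size Ey; rewrite size_singles size_cat /= addn1 => Em.
  by move: Ej lt_j njp; rewrite /bump -Em; lia.
have := okR_head okB; have -> : D = [:: nth 0 y j.+1].
  have := congr1 (fun S => nth [::] S (size S1).+1) Ey.
  rewrite nth_singles; last by rewrite -(size_singles y p) Ey size_cat /=; lia.
  rewrite nth_cat ltnNge leqnSn subSnn /= => <-; congr [:: nth _ _ _].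
  by move: Ej njp nj; rewrite /bump; lia.
by rewrite rp1 eq_sym.
Qed.

Lemma le2_trans x y z : code2 x -> code2 y -> code2 z -> le2 x y -> le2 y z -> le2 x z.
Proof.
case: x y z => [x p] [y q] [z s] [/= vx le_p] [/= vy le_q] [/= vz le_s].
move=> [/= qp xy hxy] [/= sq yz hyz]; split=> /=.
- exact: leq_trans sq qp.
- by move=> j lt_j; apply: leq_trans (xy _ lt_j) (yz _ lt_j).
move=> sp; case: (ltnP s q) => [lt_sq|le_qs].
  apply: leq_trans (hyz lt_sq); case: (ltnP q p) => [lt_qp|le_pq].
    by apply: leq_trans (hxy lt_qp) _; apply: gap2_lt vy _ _ _; lia.
  have -> : q = p by lia.
  by apply: xy; lia.
have E : s = q by lia.
by subst s; apply: leq_trans (hxy sp) _; rewrite ltnS; apply: yz; lia.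
Qed.

Lemma clattice_hook2 : clattice n (2 :: nseq m 1).
Proof.
pose bot := nseq m.+1 1 ++ [:: 2].
have nbot j : j < m.+2 -> nth 0 bot j = if j == m.+1 then 2 else 1.
  rewrite ltnS leq_eqVlt => /predU1P[->|lt_j].
    by rewrite /bot nth_cat size_nseq ltnn subnn eqxx.
  by rewrite /bot nth_cat size_nseq lt_j nth_nseq lt_j ltn_eqF.
have sbot : size bot = m.+2 by rewrite size_cat size_nseq addn1.
clearbody bot.
(* The first row consists of letters 1 and [b = 2]; so [b] is inserted at the end, and the position
   is [m]. *)
have cbot : code2 (bot, m).
  split=> //=; split=> //.
    by move=> j lt_j; rewrite nbot //; case: eqP => _; lia.
  move=> j lt_j; rewrite !nbot //; last exact: ltnW.
  by rewrite /gap2; do 3 case: eqP => ?; lia.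
apply: (lattice_of_code (PX := code2) (enc := enc2) (R := le2)
  (rk := fun x => sumn x.1) (bot := (bot, m))) => //.
- exact: code2_valid.
- exact: code2_surj.
- exact: enc2_inj.
- case=> y p [/= vy le_p]; have [sy ry gy] := vy; split=> //=.
    move=> j lt_j; rewrite nbot //; case: eqP => [->|_]; last by have := ry _ lt_j; lia.
    by have := gap2_lt (k := p) (l := m.+1) vy; have := ry p; lia.
  by move=> pm; rewrite nbot // eqxx; have := ry p; lia.
- by move=> x cx; split=> //; rewrite ltnn.
- exact: le2_trans.
- by move=> [y p] [z q] [[sy _ _] _] [[sz _ _] _] [_ le _]; apply: sumn_lev le.
- case=> y p a cy /(step2_inv cy)[[j [le_j cj ->]]|[p_gt0 E1 E2 ->]].
    exists (incr y j, p); split=> //; last by rewrite sumn_incr.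
    by split=> //=; [exact: lev_incr_self | rewrite ltnn].
  have [cz _] := step2_prev cy p_gt0 E1 E2.
  exists (incr y p, p.-1); split=> //; last by rewrite sumn_incr.
  split=> //=; [by lia | exact: lev_incr_self |] => _.
  by rewrite nth_incr ltn_eqF; [rewrite E2 E1 | lia].
- case=> y p [z q] cy cz [/= le_qp le_yz hyz] ne.
  have [/= vy le_p] := cy; have [/= vz le_q] := cz.
  have [sz rz gz] := vz.
  have [Epq|npq] := eqVneq p q.
    subst q; have ne' : y <> z by move=> E; apply: ne; rewrite E.
    have [j [lt_j lt vj]] := vec_progress vy vz le_yz ne'.
    have cj : code2 (incr y j, p) by [].
    exists (incr y j, p); split=> //; first exact: step2_same.
    by split=> //=; [exact: lev_incr | rewrite ltnn].
  have lt_qp : q < p by lia.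
  have hp := hyz lt_qp.
  have yp : nth 0 y p < nth 0 y p.+1 by apply: gap2_lt vy _ _ _; lia.
  have z_gt l : q < l < m.+2 -> nth 0 y p.+1 <= nth 0 z l.
    by move=> ql; apply: leq_trans hp _; apply: gap2_lt vz _ _ _; lia.
  have lift j : j <= p -> nth 0 y j < nth 0 z j ->
      (j < m.+1 -> nth 0 y j + gap2 p j < nth 0 y j.+1) ->
      exists x, [/\ code2 x, cstep n (enc2 (y, p)) (enc2 x) & le2 x (z, q)].
    move=> le_j lt gj; have lt_j : j < m.+2 by lia.
    have vj : vec n.+1 m.+2 (gap2 p) (incr y j).
      apply: vec_incr => //; first by apply: leq_trans lt _; case/andP: (rz j lt_j).
    exists (incr y j, p); split=> //; first exact: step2_same.
    split=> //=; first exact: lev_incr.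
    by move=> _; rewrite nth_incr gtn_eqF.
  (* Raise entry [p] until it is just below [b], then entry [p-1] until it meets entry [p], then
     cross. *)
  have zp := z_gt p; case: (ltnP (nth 0 y p).+1 (nth 0 y p.+1)) => [lt2|ge2].
    by apply: (lift p) => //; rewrite /gap2 ?eqxx; lia.
  have E2 : nth 0 y p.+1 = (nth 0 y p).+1 by lia.
  have p_gt0 : 0 < p by lia.
  have le1p : nth 0 y p.-1 <= nth 0 y p by apply: vec_le vy _; lia.
  case: (ltnP (nth 0 y p.-1) (nth 0 y p)) => [lt1|ge1].
    apply: (lift p.-1); first by lia.
      by have := vec_le (k := q) (l := p.-1) vz; lia.
    by move=> _; rewrite prednK // /gap2 ltn_eqF ?addn0 //; lia.
  have E1 : nth 0 y p.-1 = nth 0 y p by lia.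
  have [cx st] := step2_prev cy p_gt0 E1 E2.
  exists (incr y p, p.-1); split=> //; split=> //=; first by lia.
    by apply: lev_incr => //; lia.
  by move=> qp; rewrite prednK // nth_incr eqxx -E2.
have join x z : code2 x -> code2 z -> z.2 <= x.2 -> exists j, [/\ code2 j, le2 x j, le2 z j &
    forall u, code2 u -> le2 x u -> le2 z u -> le2 j u].
  case: x z => [y p] [z q] [/= vy le_p] [/= vz le_q] le_qp.
  (* [yh] is the least code at position [q] above [y]. *)
  pose yh := mkseq (fun j => if (j == q) && (q < p) then (nth 0 y p.+1).-1
    else if q < j <= p then nth 0 y p.+1 else nth 0 y j) m.+2.
  have nyh j : j < m.+2 -> nth 0 yh j = if (j == q) && (q < p) then (nth 0 y p.+1).-1
      else if q < j <= p then nth 0 y p.+1 else nth 0 y j.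
    exact: nth_mkseq.
  have syh : size yh = m.+2 by exact: size_mkseq.
  clearbody yh; have [sy ry gy] := vy.
  have le_y j k : j <= k < m.+2 -> nth 0 y j <= nth 0 y k by exact: vec_le vy.
  have lt_y j : j <= p -> nth 0 y j < nth 0 y p.+1 by move=> jp; apply: gap2_lt vy _ _ _; lia.
  have vyh : vec n.+1 m.+2 (gap2 q) yh.
    split=> //.
      move=> j lt_j; rewrite nyh //; case: ifP => [jq|_].
        by have := ry p.+1; have := ry p; have := lt_y p; lia.
      by case: ifP => _; apply: ry; lia.
    move=> j lt_j; rewrite !nyh //; last exact: ltnW.
    have := gy j lt_j; have := lt_y j; have := le_y p.+1 j.+1; have := ry p.+1.
    rewrite /gap2; case: (boolP (j == p)) => c0; case: (boolP (j == q)) => c1;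
    case: (boolP (q < p)) => c2; case: (boolP (q < j <= p)) => c3;
    case: (boolP (j.+1 == q)) => c4; case: (boolP (q < j.+1 <= p)) => c5; rewrite /=; lia.
  have le_yyh : lev m.+2 y yh.
    move=> j lt_j; rewrite nyh //; have := lt_y j.
    by case: ifP => [c1|_]; [lia | case: ifP => c2; lia].
  have [w vw nw] : exists2 w, vec n.+1 m.+2 (gap2 q) w &
      forall j, j < m.+2 -> nth 0 w j = maxn (nth 0 yh j) (nth 0 z j).
    by exists (vmax m.+2 yh z); [exact: vmax_vec | move=> j; exact: nth_vmax].
  exists (w, q); split=> //.
  - split=> //=; first by move=> j lt_j; rewrite nw // leq_max le_yyh.
    by move=> lt_qp; rewrite nw ?nyh ?eqxx ?lt_qp /=; lia.
  - split=> //=; last by rewrite ltnn.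
    by move=> j lt_j; rewrite nw // leq_maxr.
  case=> u s [/= vu le_s] [/= sp yu hyu] [/= sq zu hzu]; split=> //=.
    move=> j lt_j; rewrite nw // geq_max zu // andbT nyh //; case: ifP => [/andP[/eqP-> lt_qp]|_].
      by have := vec_le (k := s) (l := q) vu; have := hyu; lia.
    case: ifP => [qj|_]; last exact: yu.
    by have := gap2_lt (k := s) (l := j) vu; have := hyu; lia.
  move=> lt_sq; rewrite nw; last by lia.
  rewrite geq_max hzu // andbT nyh; last by lia.
  rewrite gtn_eqF // ltnSn /=; case: ifP => [_|qp]; first by apply: hyu; lia.
  have -> : q = p by lia.
  by apply: hyu; lia.
move=> x z cx cz; case: (leqP z.2 x.2) => [le|/ltnW le]; first exact: join.
by have [j [cj zj xj jmin]] := join _ _ cz cx le; exists j; split=> // u cu xu zu; apply: jmin.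
Qed.

End HookTwo.

(** * Rank two *)

(** With three letters a row is determined by two cut points. Two rows of arbitrary length are
    easier to handle in this form than as a long list of columns. *)
Definition row3 (l r p : nat) : seq nat := nseq r 1 ++ nseq (p - r) 2 ++ nseq (l - p) 3.

Lemma size_row3 l r p : r <= p <= l -> size (row3 l r p) = l.
Proof. by move=> rp; rewrite !size_cat !size_nseq; lia. Qed.

Lemma nth_row3 l r p k : r <= p -> k < l ->
  nth 0 (row3 l r p) k = if k < r then 1 else if k < p then 2 else 3.
Proof.
move=> rp lt_k; rewrite !nth_cat !size_nseq; case: ifP => [lt|ge]; first by rewrite nth_nseq lt.
case: ltnP => [lt|ge']; rewrite nth_nseq.
  have -> : k < p by lia.
  by rewrite lt.
have -> : (k < p) = false by lia.
have -> //: k - r - (p - r) < l - p by lia.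
Qed.

Lemma row3_surj s : sorted leq s -> all (fun x => 0 < x <= 3) s ->
  exists r p, r <= p <= size s /\ s = row3 (size s) r p.
Proof.
move=> srt rng; exists (count (gtn 2) s), (count (gtn 3) s).
have rp : count (gtn 2) s <= count (gtn 3) s <= size s.
  by rewrite count_size andbT; apply: sub_count => x /=; lia.
split=> //; apply: (@eq_from_nth _ 0); first by rewrite size_row3.
move=> k lt_k; rewrite nth_row3 //; last by case/andP: rp.
rewrite !ltn_count_sorted_leq // lt_k /=.
by have := allP rng _ (mem_nth 0 lt_k); case: (nth 0 s k) => [|[|[|[|]]]].
Qed.

(** A block of [k] closing brackets first uses up the [o] open ones; if some are left over, the last
    letter of the block is unmatched. *)
Lemma unmatched_nseq i a k w pos o last :
  rightmost_unmatched i (nseq k a ++ w) pos o last =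
  if a == i then
    if k <= o then rightmost_unmatched i w (pos + k) (o - k) last
    else rightmost_unmatched i w (pos + k) 0 (Some (pos + k).-1)
  else if a == i.+1 then rightmost_unmatched i w (pos + k) (o + k) last
  else rightmost_unmatched i w (pos + k) o last.
Proof.
elim: k pos o last => [|k IH] pos o last.
  by rewrite /= !addn0 subn0 !if_same.
rewrite /=; case: (eqVneq a i) => [Ea|na].
  case: o => [|o] /=; rewrite IH Ea eqxx addSnnS; last by rewrite ltnS subSS.
  by case: k {IH} => [|k] /=; rewrite ?addn1.
by case: (eqVneq a i.+1) => [Ea|na'] /=; rewrite IH (negPf na) ?Ea ?eqxx ?(negPf na') !addSnnS.
Qed.

Section RankTwo.

Variables (l b : nat).
Hypothesis b_le : b <= l.

(* Gelfand-Tsetlin pattern: [r] entries [1] and [p] entries [<= 2] in the first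
   row, [q] entries [2] in the second row. *)
Definition code3 (x : nat * nat * nat) : Prop :=
  let: (r, p, q) := x in q <= r <= p /\ q <= b <= p /\ p <= l.

Definition enc3 (x : nat * nat * nat) : tableau :=
  let: (r, p, q) := x in [:: row3 l r p; row3 b 0 q].

(** The parameters only decrease. Lowering [q] requires [p + q <= r + b]; read at the first such
    step, where [q] still has its initial value, this gives the first implication. Lowering [p]
    requires [r + b < p + q]; read at the last such step, which ends at [p'], it gives the
    second. *)
Definition le3 (x y : nat * nat * nat) : Prop :=
  let: (r, p, q) := x in let: (r', p', q') := y in
  (r' <= r /\ p' <= p /\ q' <= q) /\
  ((q' < q -> p' + q <= r + b) /\ (p' < p -> r' + b <= p' + q)).

(** On codes the subtraction does not truncate, because [r], [p] and [q] are at most [l]. *)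
Definition rk3 (x : nat * nat * nat) : nat :=
  let: (r, p, q) := x in 3 * l - (r + p + q).

Lemma set_nth_block (X Y : seq nat) k a v :
  0 < k -> set_nth 0 (X ++ nseq k a ++ Y) (size X + k).-1 v = X ++ nseq k.-1 a ++ v :: Y.
Proof.
case: k => // k _; have -> : nseq k.+1 a = nseq k a ++ [:: a] by rewrite -addn1 nseqD.
have -> : (size X + k.+1).-1 = size (X ++ nseq k a) by rewrite size_cat size_nseq addnS.
by rewrite -catA catA /= set_nth_mid -catA.
Qed.

Lemma Ftab1 r p q : code3 (r, p, q) ->
  Ftab 1 (enc3 (r, p, q)) = if q < r then Some (enc3 (r.-1, p, q)) else None.
Proof.
move=> [/= qrp [qbp pl]]; rewrite /Ftab /Fword /reading_word /= cats0.
have s1 : size (row3 l r p) = l by rewrite size_row3; lia.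
have s2 : size (row3 b 0 q) = b by rewrite size_row3; lia.
have E : rightmost_unmatched 1 (row3 b 0 q ++ row3 l r p) 0 0 None =
    if q < r then Some (b + r).-1 else None.
  rewrite /row3 /= subn0 -!catA !unmatched_nseq /= -[nseq (l - p) 3]cats0 !unmatched_nseq /=.
  rewrite !add0n leqNgt; have -> : q + (b - q) = b by lia.
  by case: ltnP.
rewrite E; case: ltnP => // lt_qr; congr Some; rewrite s1 s2.
have -> : set_nth 0 (row3 b 0 q ++ row3 l r p) (b + r).-1 2 = row3 b 0 q ++ row3 l r.-1 p.
  have := @set_nth_block (row3 b 0 q) (nseq (p - r) 2 ++ nseq (l - p) 3) r 1 2.
  rewrite s2 => ->; last by lia.
  rewrite -cat_cons; congr (_ ++ (_ ++ (_ ++ _))).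
  by rewrite -[2 :: _]/(nseq (p - r).+1 2); congr nseq; lia.
rewrite /rev /= take_size_cat // drop_size_cat // take_oversize // size_row3; lia.
Qed.

(** The [b - q] letters 3 of the second row are matched with the [p - r] letters 2 of the first row;
    comparing the two numbers decides which row changes. *)
Lemma Ftab2 r p q : code3 (r, p, q) ->
  Ftab 2 (enc3 (r, p, q)) =
  if r + b < p + q then Some (enc3 (r, p.-1, q))
  else if 0 < q then Some (enc3 (r, p, q.-1)) else None.
Proof.
move=> [/= qrp [qbp pl]]; rewrite /Ftab /Fword /reading_word /= cats0.
have s1 : size (row3 l r p) = l by rewrite size_row3; lia.
have s2 : size (row3 b 0 q) = b by rewrite size_row3; lia.
have E : rightmost_unmatched 2 (row3 b 0 q ++ row3 l r p) 0 0 None =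
    if r + b < p + q then Some (b + p).-1 else if 0 < q then Some q.-1 else None.
  rewrite /row3 /= subn0 -!catA !unmatched_nseq /= -[nseq (l - p) 3]cats0 !unmatched_nseq /=.
  rewrite !add0n (_ : (p - r <= b - q) = (p + q <= r + b)); last by lia.
  case: posnP => [q0|q_gt0]; rewrite leqn0 ?q0 ?eqxx ?(gtn_eqF q_gt0) leqNgt;
    by case: ltnP => //= H; congr Some; lia.
rewrite E; case: ltnP => lt; last first.
  case: posnP => // q_gt0; congr Some; rewrite s1 s2.
  have -> : set_nth 0 (row3 b 0 q ++ row3 l r p) q.-1 3 = row3 b 0 q.-1 ++ row3 l r p.
    rewrite {1}/row3 /= subn0 -catA.
    have := @set_nth_block [::] (nseq (b - q) 3 ++ row3 l r p) q 2 3 q_gt0.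
    rewrite add0n => ->; rewrite /row3 /= subn0 -!catA; congr (_ ++ _).
    rewrite -cat_cons; congr (_ ++ _).
    by rewrite -[3 :: _]/(nseq (b - q).+1 3); congr nseq; lia.
  rewrite /rev /= take_size_cat ?drop_size_cat ?size_row3 //; try lia.
  by rewrite take_oversize // s1.
congr Some; rewrite s1 s2.
have -> : set_nth 0 (row3 b 0 q ++ row3 l r p) (b + p).-1 3 = row3 b 0 q ++ row3 l r p.-1.
  rewrite {2}/row3 catA.
  have := @set_nth_block (row3 b 0 q ++ nseq r 1) (nseq (l - p) 3) (p - r) 2 3.
  rewrite size_cat size_nseq s2 -addnA subnKC; last by lia.
  move=> ->; last by lia.
  rewrite -catA; congr (_ ++ (_ ++ _)); rewrite -[3 :: _]/(nseq (l - p).+1 3).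
  by congr (nseq _ _ ++ nseq _ _); lia.
rewrite /rev /= take_size_cat // drop_size_cat // take_oversize // size_row3; lia.
Qed.

Lemma enc3_valid x : code3 x -> is_ssyt 2 [:: l; b] (enc3 x).
Proof.
case: x => [[r p] q] [/= qrp [qbp pl]]; have s1 : size (row3 l r p) = l by rewrite size_row3; lia.
have s2 : size (row3 b 0 q) = b by rewrite size_row3; lia.
have n1 k : k < l -> nth 0 (row3 l r p) k = if k < r then 1 else if k < p then 2 else 3.
  by apply: nth_row3; lia.
have n2 k : k < b -> nth 0 (row3 b 0 q) k = if k < q then 2 else 3.
  by move=> lt_k; rewrite nth_row3.
apply/is_ssytP; split; rewrite /= ?s1 ?s2 // => -[|[|k]] k' //=; rewrite /ent /= ?nth_nil //.
- by move=> lt_k; rewrite n1 //; case: (k' < r); case: (k' < p).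
- by move=> lt_k; rewrite n2 //=; case: (k' < q).
- by move=> lt_k; rewrite !n1 ?(ltnW lt_k) //;
  case: (ltnP k' r); case: (ltnP k' p); case: (ltnP k'.+1 r); case: (ltnP k'.+1 p); lia.
- by move=> lt_k; rewrite !n2 ?(ltnW lt_k) //; case: (ltnP k' q); case: (ltnP k'.+1 q); lia.
- by move=> lt_k; rewrite n1 ?n2; try lia; case: (ltnP k' r); case: (ltnP k' p); case: (ltnP k' q); lia.
Qed.

Lemma enc3_surj T : is_ssyt 2 [:: l; b] T -> exists2 x, code3 x & T = enc3 x.
Proof.
case: T => [|R1 [|R2 [|? ?]]] [] //= [s1 s2] /and3P[a1 a2 _] /and3P[o1 o2 _] /(_ 0) col.
have {}col k : k < b -> nth 0 R1 k < nth 0 R2 k by rewrite -s2 => lt_k; apply: col.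
have [r [p [rp E1]]] := row3_surj o1 a1; have [q0 [q [qq E2]]] := row3_surj o2 a2.
rewrite s1 in rp E1; rewrite s2 in qq E2.
have n1 k : k < l -> nth 0 R1 k = if k < r then 1 else if k < p then 2 else 3.
  by rewrite {1}E1; apply: nth_row3; lia.
have n2 k : k < b -> nth 0 R2 k = if k < q0 then 1 else if k < q then 2 else 3.
  by rewrite {1}E2; apply: nth_row3; lia.
have q00 : q0 = 0.
  case: (posnP q0) => // q0_gt0; have := col 0; rewrite n1 ?n2 ?q0_gt0; try lia.
  by case: ifP => _; [lia | case: ifP; lia].
exists (r, p, q); last by rewrite /enc3 E1 E2 q00.
have qr : q <= r.
  rewrite leqNgt; apply/negP => lt; have := col r; rewrite n1 ?n2 ?ltnn; try lia.
  by case: (ltnP r p); case: (ltnP r q0); case: (ltnP r q); lia.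
have bp : b <= p.
  rewrite leqNgt; apply/negP => lt; have := col p; rewrite n1 ?n2 ?ltnn; try lia.
  by case: (ltnP p r); case: (ltnP p q0); case: (ltnP p q); lia.
by rewrite /=; lia.
Qed.

Lemma enc3_inj x y : code3 x -> code3 y -> enc3 x = enc3 y -> x = y.
Proof.
case: x y => [[r p] q] [[r' p'] q'] [/= c1 [c2 c3]] [/= c4 [c5 c6]] [E1 E2].
have cnt a l' s s' : count_mem a (row3 l' s s') = (1 == a) * s + (2 == a) * (s' - s) + (3 == a) * (l' - s').
  by rewrite !count_cat !count_nseq /= addnA.
have := congr1 (count_mem 1) E1; have := congr1 (count_mem 2) E1; have := congr1 (count_mem 2) E2.
by rewrite !cnt /= => e1 e2 e3; congr (_, _, _); lia.
Qed.

Lemma crystal_is_lattice_rank2 : crystal_is_lattice 2 [:: l; b].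
Proof.
apply: (lattice_of_code (PX := code3) (enc := enc3) (R := le3) (rk := rk3) (bot := (l, l, b))).
- exact: enc3_valid.
- exact: enc3_surj.
- exact: enc3_inj.
- by rewrite /=; lia.
- by case=> [[r p] q] /=; lia.
- by case=> [[r p] q] /=; lia.
- by case=> [[r p] q] [[r' p'] q'] [[r'' p''] q''] /=; lia.
- by case=> [[r p] q] [[r' p'] q'] /=; lia.
- case=> [[r p] q] a cx [i i12].
  have {i12} [->|->] : i = 1 \/ i = 2 by lia.
    rewrite Ftab1 //; case: ltnP => // lt [<-]; exists (r.-1, p, q).
    by split=> //; move: cx; rewrite /=; lia.
  rewrite Ftab2 //; case: ltnP => [lt [<-]|le].
    by exists (r, p.-1, q); split=> //; move: cx; rewrite /=; lia.
  case: posnP => // q_gt0 [<-]; exists (r, p, q.-1).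
  by split=> //; move: cx; rewrite /=; lia.
- case=> [[r p] q] [[r' p'] q'] cx cy xy ne.
  have ne' : r <> r' \/ p <> p' \/ q <> q'.
    have [Er|] := eqVneq r r'; last by move/eqP; left.
    have [Ep|] := eqVneq p p'; last by move/eqP; right; left.
    by right; right => Eq; apply: ne; rewrite Er Ep Eq.
  have [H|[H|H]] : (q < r /\ le3 (r.-1, p, q) (r', p', q')) \/
      (r + b < p + q /\ le3 (r, p.-1, q) (r', p', q')) \/
      (p + q <= r + b /\ 0 < q /\ le3 (r, p, q.-1) (r', p', q')).
  + by move: cx cy xy ne' => /=; lia.
  + have cz : code3 (r.-1, p, q) by move: cx H => /=; lia.
    exists (r.-1, p, q); split=> //; [exists 1 => // | by case: H].
    by rewrite Ftab1 // (proj1 H).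
  + have cz : code3 (r, p.-1, q) by move: cx H => /=; lia.
    exists (r, p.-1, q); split=> //; [exists 2 => // | by case: H].
    by rewrite Ftab2 // (proj1 H).
  have cz : code3 (r, p, q.-1) by move: cx H => /=; lia.
  exists (r, p, q.-1); split=> //; [exists 2 => // | by case: H => _ []].
  by rewrite Ftab2 // ltnNge; case: H => -> [-> _].
have join x y : code3 x -> code3 y -> x.2 <= y.2 -> exists j, [/\ code3 j, le3 x j, le3 y j &
    forall u, code3 u -> le3 x u -> le3 y u -> le3 j u].
  case: x y => [[r p] q] [[s t] u] cx cy /= le_qu.
  move: cx cy => [/= qrp [qbp pl]] [/= ust [ubt tl]].
  (* Larger parameters are lower in the order, so the join takes the largest admissible ones: [q] is
     the smaller of the two, then [p1] is maximal given [q], then [r1] is maximal given [q] and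
     [p1]. *)
  have [p1 [p1p p1t p1c p1max]] : exists p1, [/\ p1 <= p, p1 <= t, q < u -> p1 + u <= s + b &
      forall v, v <= p -> v <= t -> (q < u -> v + u <= s + b) -> v <= p1].
    case: (ltnP q u) => qu; last by exists (minn p t); split=> [|||v]; lia.
    by exists (minn (minn p t) (s + b - u)); split=> [|||v]; lia.
  have bp1 : b <= p1 by apply: p1max; lia.
  have [r1 [r1r r1s r1c r1d r1max]] : exists r1, [/\ r1 <= r, r1 <= s, p1 < p -> r1 + b <= p1 + q,
      p1 < t -> r1 + b <= p1 + u &
      forall v, v <= r -> v <= s -> (p1 < p -> v + b <= p1 + q) ->
        (p1 < t -> v + b <= p1 + u) -> v <= r1].
    case: (ltnP p1 p) => p1p'; case: (ltnP p1 t) => p1t'.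
    + by exists (minn (minn r s) (minn (p1 + q - b) (p1 + u - b))); split=> [||||v]; lia.
    + by exists (minn (minn r s) (p1 + q - b)); split=> [||||v]; lia.
    + by exists (minn (minn r s) (p1 + u - b)); split=> [||||v]; lia.
    by exists (minn r s); split=> [||||v]; lia.
  have qr1 : q <= r1 by apply: r1max; lia.
  have r1p1 : r1 <= p1 by lia.
  exists (r1, p1, q); split; rewrite /=; [lia | lia | lia |].
  move=> [[r2 p2] q2] /= [c1 [c2 c3]] [[x1 [x2 x3]] [x4 x5]] [[y1 [y2 y3]] [y4 y5]].
  have p2p1 : p2 <= p1 by apply: p1max; lia.
  have r2r1 : r2 <= r1 by apply: r1max; lia.
  split; first by [].
  split; last by lia.
  (* The required inequality compares [r1] with [p2 + q - b], which is itself a competitor in the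
     choice of [r1]. *)
  move=> q2q; suff : p2 + q - b <= r1 by lia.
  by apply: r1max; lia.
move=> x y cx cy; case: (leqP x.2 y.2) => [le|/ltnW le]; first exact: join.
by have [j [cj yj xj jmin]] := join _ _ cy cx le; exists j; split=> // v cv xv yv; apply: jmin.
Qed.

End RankTwo.

(** * The case of (3,2,1) *)

Definition cols4 (h : nat) : seq (seq nat) :=
  [seq C <- foldr (fun x S => S ++ map (cons x) S) [:: [::]] (iota 1 4) | size C == h].

Lemma mem_cols4 C : sorted ltn C -> all (fun x => 0 < x <= 4) C -> C \in cols4 (size C).
Proof.
move=> sC rC; rewrite mem_filter eqxx /=.
pose m := [seq x \in C | x <- iota 1 4].
have -> : C = mask m (iota 1 4).
  rewrite -filter_mask; apply: sorted_ltn_eq => // [|x].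
    exact/(sorted_filter ltn_trans)/iota_ltn_sorted.
  by rewrite mem_filter mem_iota; case: (boolP (x \in C)) => //= /(allP rC); lia.
rewrite /m /=.
by case: (1 \in C); case: (2 \in C); case: (3 \in C); case: (4 \in C).
Qed.

(** Sorting by [tot], which increases strictly along the order, makes the first common upper bound
    in the list the only candidate for a join. *)
Definition elts321 : seq (seq (seq nat)) :=
  sort (fun X Y => tot X <= tot Y)
  [seq X <- [seq C :: X | C <- cols4 3, X <- [seq [:: D; E] | D <- cols4 2, E <- cols4 1]] | sorted colle X].

Definition upbits (L : seq (seq (seq nat))) : seq bitseq :=
  [seq [seq Y \in upset 3 10 X | Y <- L] | X <- L].

(** [M] is the matrix of the order and [c] marks the common upper bounds of two elements; the first
    of them must lie below all the others. *)
Definition join_check (M : seq bitseq) : bool :=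
  all (fun a => all (fun b =>
    let c := [seq p.1 && p.2 | p <- zip a b] in
    let j := index true c in
    (j < size M) && all (fun p => p.1 ==> p.2) (zip c (nth [::] M j))) M) M.

Lemma mem_elts321 Cs : cvalid 3 [:: 3; 2; 1] Cs -> Cs \in elts321.
Proof.
case: Cs => [|C [|D [|E [|? ?]]]] [] // [sC sD sE] /and4P[rC rD rE _] /and4P[oC oD oE _] le.
rewrite mem_sort mem_filter le andTb.
apply/allpairsPdep; exists C, [:: D; E]; split=> //; first by rewrite -sC mem_cols4.
by apply/allpairsPdep; exists D, E; split=> //; [rewrite -sD mem_cols4 | rewrite -sE mem_cols4].
Qed.

Lemma join_checkP : join_check (upbits elts321).
Proof. by vm_compute. Qed.

Lemma bot_elts321 : all (fun X => X \in upset 3 10 [:: [:: 1; 2; 3]; [:: 1; 2]; [:: 1]]) elts321.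
Proof. by vm_compute. Qed.

(** The spread of these sums is the search depth 10 in [upbits]. *)
Lemma tot_elts321 : all (fun X => 10 <= tot X <= 20) elts321.
Proof. by vm_compute. Qed.

Lemma elts321_valid X : X \in elts321 -> cvalid 3 [:: 3; 2; 1] X.
Proof.
move=> XL; have b : cvalid 3 [:: 3; 2; 1] [:: [:: 1; 2; 3]; [:: 1; 2]; [:: 1]] by [].
have /upset_reach c := allP bot_elts321 _ XL.
apply: (clos_mono (P := cvalid 3 [:: 3; 2; 1]) (sB := cstep 3) (f := id) _ b c).1.
by move=> A B vA st; split=> //; apply: cstep_valid st.
Qed.

Lemma join_of_check (le : seq (seq nat) -> seq (seq nat) -> Prop) L X Y :
    {in L &, forall A B, le A B <-> B \in upset 3 10 A} -> join_check (upbits L) ->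
    X \in L -> Y \in L ->
  exists J, [/\ J \in L, le X J, le Y J & forall U, U \in L -> le X U -> le Y U -> le J U].
Proof.
move=> leE check XL YL; pose M := upbits L.
have szM : size M = size L by rewrite size_map.
have row k : k < size M -> nth [::] M k = [seq B \in upset 3 10 (nth [::] L k) | B <- L].
  by rewrite szM => lt_k; rewrite (nth_map [::]).
have ent_row k l : k < size M -> l < size M ->
    nth false (nth [::] M k) l = (nth [::] L l \in upset 3 10 (nth [::] L k)).
  by move=> lt_k lt_l; rewrite row // (nth_map [::]) -?szM.
have sz_row k : k < size M -> size (nth [::] M k) = size M.
  by move=> lt_k; rewrite row // size_map szM.
have {check} : join_check M by [].
move: (M) szM row ent_row sz_row => {}M szM row ent_row sz_row check.
pose a := index X L; pose b := index Y L.
have lt_a : a < size M by rewrite szM index_mem.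
have lt_b : b < size M by rewrite szM index_mem.
have Xa : nth [::] L a = X by rewrite nth_index.
have Yb : nth [::] L b = Y by rewrite nth_index.
have := allP (allP check _ (mem_nth [::] lt_a)) _ (mem_nth [::] lt_b) => /=.
set c := [seq _ | p <- _]; set j := index true c => /andP[lt_j /allP sub].
have sz_c : size c = size M by rewrite size_map size_zip !sz_row // minnn.
have nc l : l < size M -> nth false c l =
    (nth [::] L l \in upset 3 10 X) && (nth [::] L l \in upset 3 10 Y).
  move=> lt_l; rewrite (nth_map (false, false)) ?size_zip ?sz_row ?minnn //.
  by rewrite nth_zip ?sz_row // !ent_row // Xa Yb.
have jL : nth [::] L j \in L by rewrite mem_nth // -szM.
have : nth false c j by rewrite nth_index // -index_mem sz_c.
rewrite nc // => /andP[Xj Yj]; exists (nth [::] L j).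
split; [by [] | exact/leE | exact/leE | move=> U UL /leE XU /leE YU].
apply/leE => //; have lt_u : index U L < size M by rewrite szM index_mem.
have := sub (nth false c (index U L), nth false (nth [::] M j) (index U L)).
rewrite -nth_zip ?sz_row // mem_nth ?size_zip ?sz_c ?sz_row ?minnn // nth_zip ?sz_row //=.
by rewrite nc // ent_row // nth_index // XU ?YU //=; move=> /(_ isT).
Qed.

Lemma clattice_321 : clattice 3 [:: 3; 2; 1].
Proof.
pose le := clos_refl_trans _ (cstep 3).
have leE : {in elts321 &, forall X Y, le X Y <-> Y \in upset 3 10 X}.
  move=> X Y XL YL; split; last exact: upset_reach.
  move=> c; apply: upset_complete; first exact: c.
  by have := allP tot_elts321 _ XL; have := allP tot_elts321 _ YL; lia.
have join X Y := join_of_check leE join_checkP (X := X) (Y := Y).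
have botP x : x \in elts321 -> le [:: [:: 1; 2; 3]; [:: 1; 2]; [:: 1]] x.
  by move=> xL; apply: upset_reach (allP bot_elts321 _ xL).
have v X : cvalid 3 [:: 3; 2; 1] X <-> X \in elts321.
  by split; [exact: mem_elts321 | exact: elts321_valid].
clear leE; pose L := elts321; move: (L) join botP v => {}L join botP v.
pose bot := [:: [:: 1; 2; 3]; [:: 1; 2]; [:: 1]].
apply: (lattice_of_code (PX := cvalid 3 [:: 3; 2; 1]) (enc := id) (R := le) (rk := tot) (bot := bot)) => //.
- by move=> a va; exists a.
- by move=> x /v; apply: botP.
- by move=> x _; apply: rt_refl.
- by move=> x y z _ _ _ xy yz; apply: rt_trans xy yz.
- by move=> x y _ _; apply: clos_tot.
- move=> x a vx st; exists a; split=> //; [exact: cstep_valid st | exact: rt_step | exact: cstep_tot st].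
- move=> x y vx vy xy; have {xy} := clos_rt_rt1n _ _ _ _ xy => xy; case: xy => [//|z w xz zw] _.
  by exists z; split=> //; [exact: cstep_valid xz | exact: clos_rt1n_rt].
move=> x y /v xL /v yL; have [J [JL xJ yJ Jmin]] := join _ _ xL yL.
by exists J; split=> //; [exact/v | move=> u /v uL; apply: Jmin].
Qed.

(** * The classification *)

Lemma partition_2blocks a b x y : 0 < y <= x ->
  is_partition (size (nseq a x ++ nseq b y)) (nseq a x ++ nseq b y).
Proof.
move=> yx; apply/and3P; split=> //.
  apply/(sortedP 0) => j _; rewrite /= !nth_cat !size_nseq !nth_nseq.
  by case: (ltnP j a); case: (ltnP j.+1 a); case: (ltnP (j - a) b); case: (ltnP (j.+1 - a) b); lia.
by rewrite all_cat !all_nseq; lia.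
Qed.

(** All families except (3,2,1) have at most two different parts, so this formula gives all their
    column heights. *)
Lemma conj_2blocks a b x y : 0 < a -> 0 < y <= x ->
  conjugate (nseq a x ++ nseq b y) = nseq y (a + b) ++ nseq (x - y) a.
Proof.
case: a => // a _ yx; rewrite /conjugate /=.
apply: (@eq_from_nth _ 0); first by rewrite size_map size_iota size_cat !size_nseq; lia.
move=> r; rewrite size_map size_iota => lt_r.
rewrite (nth_map 0) ?size_iota // nth_iota // add0n nth_cat size_nseq !nth_nseq.
rewrite count_cat !count_nseq /= lt_r.
by case: (ltnP r y) => [lt_y|ge_y]; [|have -> : r - y < x - y by lia]; lia.
Qed.

Lemma conj_inj lam lam' : is_partition (size lam) lam -> is_partition (size lam') lam' ->
  conjugate lam = conjugate lam' -> lam = lam'.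
Proof. by move=> P P' E; rewrite -(conjK P) E conjK. Qed.

Lemma conj_heights n lam : is_partition n lam ->
  sorted geq (conjugate lam) /\ all (fun h => 0 < h <= n) (conjugate lam).
Proof.
case/and3P=> s_lam pos le_n; split; first exact: conj_sorted.
apply/(all_nthP 0) => r; rewrite size_map size_iota => lt_r.
by rewrite conjP // nth0 lt_r /= nth_conj // (leq_trans (count_size _ _)).
Qed.

(** The multiplicity is a truth value: for [k = 1] the last part is 0 and disappears. *)
Lemma rect_minus_oneE n k : 0 < k ->
  rect_minus_one n k = nseq n.-1 k ++ nseq (1 < k) k.-1.
Proof.
move=> k_gt0; rewrite /rect_minus_one -cats1 filter_cat; congr (_ ++ _).
  by apply/all_filterP; rewrite all_nseq k_gt0 orbT.
by case: k k_gt0 => [|[|k]].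
Qed.

(** One row is a lattice in every rank, so Gelfand-Tsetlin patterns are needed only for two rows and
    [n = 2]. *)
Lemma lattice_low_rank n lam : 1 <= n <= 2 -> is_partition n lam -> crystal_is_lattice n lam.
Proof.
move=> n12 P; have [s_lam _ sz] := and3P P.
case: lam P s_lam sz => [|a [|b [|? ?]]] P s_lam sz; last by move: sz; rewrite /=; lia.
- apply: (proj2 (crystal_is_lattice_cols n s_lam)).
  have -> : conjugate [::] = nseq 0 1 by [].
  exact: clattice_nseq1.
- apply: (proj2 (crystal_is_lattice_cols n s_lam)).
  have a_gt0 : 0 < a <= a by move: P; rewrite /is_partition /=; lia.
  have := conj_2blocks 0 (ltn0Sn 0) a_gt0; rewrite /= subnn cats0 => ->.
  exact: clattice_nseq1.
have -> : n = 2 by move: sz; rewrite /=; lia.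
by apply: crystal_is_lattice_rank2; move: s_lam; rewrite /=; lia.
Qed.

(** Duality replaces each height [h] by [n+1-h], so the families with heights [n] come from those
    with heights 1, and the single [n-1] comes from the single 2. *)
Lemma clattice_families n hs : 3 <= n ->
  [\/ exists2 m, m <= n.+1 & hs = [:: m],
      exists2 m, 1 < m <= n & hs = [:: m; 1],
      exists2 m, 1 <= m < n & hs = [:: n; m] |
   [\/ exists k, hs = nseq k 1, exists k, hs = nseq k n,
       exists k, hs = 2 :: nseq k 1 | exists k, hs = rcons (nseq k n) n.-1]] ->
  clattice n hs.
Proof.
move=> n3; case=> [[m m_n ->]|[m m_n ->]|[m m_n ->]|[[k ->]|[k ->]|[k ->]|[k ->]]].
- exact: clattice_col.
- by apply: clattice_hook1; lia.
- rewrite (_ : [:: n; m] = dual_heights n [:: n.+1 - m; 1]).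
    by apply: clattice_dual; [rewrite /=; lia | apply: clattice_hook1; lia].
  by rewrite /dual_heights /rev /=; congr [:: _; _]; lia.
- exact: clattice_nseq1.
- rewrite (_ : nseq k n = dual_heights n (nseq k 1)); last first.
    by rewrite /dual_heights map_nseq rev_nseq subn1.
  by apply: clattice_dual; [rewrite all_nseq /= orbT | apply: clattice_nseq1].
- by apply: clattice_hook2; lia.
rewrite (_ : rcons _ _ = dual_heights n (2 :: nseq k 1)); last first.
  by rewrite /dual_heights /= map_nseq rev_cons rev_nseq subn1 subSS subn1.
apply: clattice_dual; last by apply: clattice_hook2; lia.
by rewrite /= all_nseq /= orbT andbT; lia.
Qed.

Theorem theorem1p2 :
  (forall n : nat, 1 <= n <= 2 -> forall lam : seq nat,
     is_partition n lam -> crystal_is_lattice n lam) /\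
  (forall n : nat, 3 <= n -> forall lam : seq nat, is_partition n lam ->
     (crystal_is_lattice n lam <->
       (exists m, m <= n /\ lam = nseq m 1) \/
       (exists m, 1 <= m <= n.-1 /\ lam = 2 :: nseq m 1) \/
       (exists m, 1 <= m <= n.-1 /\ lam = nseq (n - m) 2 ++ nseq m 1) \/
       (exists k, 1 <= k /\ lam = [:: k]) \/
       (exists k, 1 <= k /\ lam = nseq n k) \/
       (exists k, 1 <= k /\ lam = [:: k; 1]) \/
       (exists k, 1 <= k /\ lam = rect_minus_one n k) \/
       (lam = [:: 3; 2; 1] /\ n = 3))).
Proof.
split=> [n n12 lam|n n3 lam P]; first exact: lattice_low_rank.
have [s_lam pos sz] := and3P P.
have P' : is_partition (size lam) lam by rewrite /is_partition s_lam pos leqnn.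
have [s_c a_c] := conj_heights P.
split=> [/(proj1 (crystal_is_lattice_cols n s_lam)) L|H].
  (* A partition is determined by its conjugate, so each family is recognised from its column
     heights. *)
  have lamE a b x y : 0 < a -> 0 < y <= x -> conjugate lam = nseq y (a + b) ++ nseq (x - y) a ->
      lam = nseq a x ++ nseq b y.
    move=> a_gt0 yx E; apply: conj_inj => //; first exact: partition_2blocks.
    by rewrite conj_2blocks.
  have lam0 : conjugate lam = [::] -> lam = [::] by move=> E; apply: conj_inj.
  have conj321 : conjugate lam = [:: 3; 2; 1] -> lam = [:: 3; 2; 1].
    by move=> E; apply: conj_inj.
  have H := clattice_heights n3 s_c a_c L; clear L s_c a_c P P' s_lam pos sz.
  have n_gt0 : 0 < n by apply: leq_trans n3.
  case: H.
    case=> [[|c] E]; first by left; exists 0; rewrite (lam0 E).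
    do 4 right; left; exists c.+1; split=> //.
    by rewrite (lamE n 0 c.+1 c.+1) ?cats0 ?E ?subnn ?cats0 ?addn0 ?leqnn.
  case=> [[[|c] E]|]; first by left; exists 0; rewrite (lam0 E).
    do 3 right; left; exists c.+1; split=> //.
    by rewrite (lamE 1 0 c.+1 c.+1) ?cats0 ?E ?subnn ?cats0 ?addn0 ?leqnn.
  case=> [[m [/andP[m_gt0 m_n] E]]|].
    left; exists m; split=> //.
    by rewrite (lamE m 0 1 1) ?cats0 ?E ?addn0.
  case=> [[m [/andP[m_gt1 m_n] E]]|].
    have m_gt0 := ltnW m_gt1.
    right; left; exists m.-1; split; first by rewrite -[0 < _]ltnS -[_ <= n.-1]ltnS !prednK // m_gt1.
    by rewrite (lamE 1 m.-1 2 1) ?E //= add1n prednK.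
  case=> [[m [/andP[m_gt0 m_n] E]]|].
    right; right; left; exists (n - m).
    split; first by rewrite subn_gt0 m_n -ltnS prednK // ltn_subrL m_gt0 n_gt0.
    by rewrite (subKn (ltnW m_n)) (lamE m (n - m) 2 1) ?E ?(subnKC (ltnW m_n)).
  case=> [[a E]|].
    do 5 right; left; exists a.+1; split=> //.
    by rewrite (lamE 1 1 a.+1 1) ?E ?subn1.
  case=> [[c E]|[n_3 E]]; last by do 7 right; split=> //; apply: conj321.
  have n1_gt0 : 0 < n.-1 by rewrite -ltnS prednK //; apply: leq_trans n3.
  do 6 right; left; exists c.+1; split=> //; rewrite rect_minus_oneE // ltnS.
  case: c E => [|c] E.
    by rewrite (lamE n.-1 0 1 1) ?E ?addn0.
  rewrite (lamE n.-1 1 c.+2 c.+1) ?E ?leqnSn //.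
  by rewrite addn1 prednK ?subSnn.
apply: (proj2 (crystal_is_lattice_cols n s_lam)).
clear P P' s_lam pos sz s_c a_c.
case: H => [[[|m] [m_n ->]]|].
    have -> : conjugate (nseq 0 1) = nseq 0 1 by [].
    exact: clattice_nseq1.
  apply: clattice_families => //; constructor 1; exists m.+1; first by lia.
  by have := @conj_2blocks m.+1 0 1 1; rewrite cats0 addn0; apply.
case=> [[m [m_n ->]]|].
  apply: clattice_families => //; constructor 2; exists m.+1; first by lia.
  by have := @conj_2blocks 1 m 2 1; rewrite add1n; apply.
case=> [[m [m_n ->]]|].
  apply: clattice_families => //; constructor 3; exists (n - m); first by lia.
  by rewrite conj_2blocks ?subnK //; lia.
case=> [[k [k_gt0 ->]]|].
  apply: clattice_families => //; constructor 4; constructor 1; exists k.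
  by have := @conj_2blocks 1 0 k k; rewrite subnn !cats0 addn0; apply=> //; rewrite k_gt0 leqnn.
case=> [[k [k_gt0 ->]]|].
  apply: clattice_families => //; constructor 4; constructor 2; exists k.
  have := @conj_2blocks n 0 k k; rewrite subnn !cats0 addn0; apply; first by lia.
  by rewrite k_gt0 leqnn.
case=> [[k [k_gt0 ->]]|].
  apply: clattice_families => //; constructor 4; constructor 3; exists k.-1.
  by have := @conj_2blocks 1 1 k 1; rewrite subn1; apply.
(* For [k = 1] the shape is a single column of height [n-1]; for larger [k] the heights are [k-1]
   copies of [n] followed by [n-1]. *)
case=> [[[|[|k]] [] // _ ->]|[-> ->]]; last exact: clattice_321.
  apply: clattice_families => //; constructor 1; exists n.-1; first by lia.
  rewrite rect_minus_oneE // ltnn; have := @conj_2blocks n.-1 0 1 1.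
  by rewrite subnn !cats0 addn0; apply; first by lia.
apply: clattice_families => //; constructor 4; constructor 4; exists k.+1.
rewrite rect_minus_oneE // conj_2blocks //; [|by lia | by rewrite /= leqnSn].
by rewrite addn1 prednK ?subSnn ?cats1 //; lia.
Qed.
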